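(* For each $n\ge1$ let $D_n=(D_{n,1},\dots,D_{n,n})$ be a random sequence of positive integers with even sum $L_n=\sum_{i=1}^nD_{n,i}$, all defined on a probability space $(\Omega,\mathcal{F},\mathbb{P})$, and let $G_n\sim\mathrm{CM}(D_n)$ be the configuration random multigraph with degree sequence $D_n$. Let $Y_n=L_n/n^2$ and, for $k\ge1$ (and $n\ge k$), let $Z_{n,1},\dots,Z_{n,k}$ be a simple random sample drawn uniformly and without replacement from $\{nD_{n,1}/L_n,\dots,nD_{n,n}/L_n\}$. Assume that for each $k\ge1$ there is a vector of random variables $(Z_1,\dots,Z_k,Y)$ such that $$(Z_{n,1},\dots,Z_{n,k},Y_n)\Longrightarrow(Z_1,\dots,Z_k,Y)\quad\text{in }\mathbb{R}^k\times\mathbb{R}\text{ as }n\to\infty,$$ where $Z_1,\dots,Z_k$ are conditionally independent given $Y$ with a common (conditional) distribution function $\Psi$, which may depend on $Y$. Assume moreover that, $\mathbb{P}$-almost surely, $$L_n\ge n\quad\text{and}\quad\max_{1\le i\le n}\frac{D_{n,i}}{L_n^{1/2}(\log n)^2}\to0 .$$ Let $\bar\Psi(x)=\inf\{y:\Psi(y)\ge x\}$, $x\in[0,1]$, and let $h$ be the random multigraphon $$h(r;x,y)=\begin{cases}p\bigl(r;Y\bar\Psi(x)\bar\Psi(y)\bigr)&\text{if }x\ne y,\\ p\bigl(\tfrac r2;\tfrac{Y\bar\Psi(x)^2}{2}\bigr)&\text{if }x=y\text{ and }r\text{ is even},\\0&\text{otherwise},\end{cases}$$ where $p(r;\lambda)=e^{-\lambda}\lambda^r/r!$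 for $r\ge0$. Then $G_n\Longrightarrow h$ in $(\mathcal{H},d_{\mathrm{ms}})$ as $n\to\infty$.
   Context: Notation: $[n]=\{1,\dots,n\}$, $\mathbb{N}_0=\{0,1,2,\dots\}$; $\Longrightarrow$ denotes weak convergence. Multigraphs. A multigraph on $[n]$ (multiple edges and multiple loops allowed) is represented by its symmetric adjacency matrix $(z_{ij})_{i,j\in[n]}$ with entries in $\mathbb{N}_0$, where for $i\ne j$, $z_{ij}$ is the number of edges between $i$ and $j$, and $z_{ii}$ is twice the number of loops at $i$ (so $z_{ii}$ is even). $\mathcal{M}_n$ is the set of multigraphs on $[n]$ and $\mathcal{M}=\bigcup_{n\ge1}\mathcal{M}_n$. $K_{2,r}$ is the multigraph on two vertices with $r$ edges between them (and no loops); $L_r$ (with one index; not to be confused with the degree sum $L_n$) is the multigraph on one vertex with $r$ loops (adjacency entry $2r$). Configuration model. For a degree sequence $d_n=(d_{n,1},\dots,d_{n,n})$ with even sum $\ell_n$, give vertex $j$ exactly $d_{n,j}$ half-edges and pair the $\ell_n$ half-edges by a uniformly random perfect matching (successively connect the first unpaired half-edge to a uniformly chosen remaining one); $\mathrm{CM}(d_n)$ is the law on $\mathcal{M}_n$ of the resulting multigraph. For random $D_n$, $G_n\sim\mathrm{CM}(D_n)$ means that conditionally on $D_n$ the law of $G_n$ is $\mathrm{CM}(D_n)$. Multigraphons. A multigraphon is a function $h:\mathbb{N}_0\times[0,1]^2\to[0,1]$ such that: (i) for each $r\ge0$, $(x,y)\mapsto h(r;x,y)$ belongs to $L_1([0,1]^2)$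 and $x\mapsto h(r;x,x)$ belongs to $L_1([0,1])$; (ii) for all $r\ge 0$ and $(x,y)\in[0,1]^2$, $h(r;x,y)=h(r;y,x)$ and $\sum_{r\ge0}h(r;x,y)=1$, and for all $x\in[0,1]$, $h(2r+1;x,x)=0$. Multigraphons are identified if for every $r$ they agree a.e. on $[0,1]^2$ and a.e. on the diagonal (so values of $\bar\Psi$ at the endpoints $0,1$ are immaterial); $\mathcal{H}$ is the set of equivalence classes. Densities. For $F=(a_{ij})_{i,j\in[k]}\in\mathcal{M}_k$ and $h\in\mathcal{H}$, $$t_F(h)=\int_{[0,1]^k}\prod_{1\le i\le j\le k}\sum_{r=a_{ij}}^\infty h(r;x_i,x_j)\,dx_1\cdots dx_k,\qquad t_F^{\mathrm{ind}}(h)=\int_{[0,1]^k}\prod_{1\le i\le j\le k}h(a_{ij};x_i,x_j)\,dx_1\cdots dx_k.$$ Distance. With $F_1^*,F_2^*,\dots$ a fixed enumeration of $\mathcal{M}$, $$d_{\mathrm{ms}}(h,h')=\sum_{i\ge1}2^{-i}|t_{F_i^*}(h)-t_{F_i^*}(h')|+\sum_{r\ge0}|t^{\mathrm{ind}}_{K_{2,r}}(h)-t^{\mathrm{ind}}_{K_{2,r}}(h')|+\sum_{r\ge0}|t^{\mathrm{ind}}_{L_r}(h)-t^{\mathrm{ind}}_{L_r}(h')|,$$ a pseudo-metric on $\mathcal{H}$. A multigraph $G=(z_{ij})\in\mathcal{M}_n$ is identified with the multigraphon $h^G(r;x,y)=\mathbf{1}[z_{\lceil nx\rceil\lceil ny\rceil}=r]$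 (with index $0$ read as $1$). $G_n\Longrightarrow h$ means $h^{G_n}\Longrightarrow h$, i.e. $\mathbb{E}f(h^{G_n})\to\mathbb{E}f(h)$ for every bounded $d_{\mathrm{ms}}$-continuous $f:\mathcal{H}\to\mathbb{R}$. *)

(* Defs.v *)
From HB Require Import structures.
From mathcomp Require Import all_boot all_order all_algebra.
From mathcomp Require Import all_classical all_reals all_analysis.

Set Implicit Arguments.
Unset Strict Implicit.
Unset Printing Implicit Defensive.

Import Order.TTheory GRing.Theory Num.Theory.
Import numFieldNormedType.Exports.

Local Open Scope classical_set_scope.
Local Open Scope ring_scope.

(* The diagonal entry counts each loop twice. *)
Definition is_multigraph n (z : 'M[nat]_n) : bool :=
  (z^T == z) && [forall i, ~~ odd (z i i)].

Definition multigraph n := {z : 'M[nat]_n | is_multigraph z}.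

Definition any_multigraph := {k : nat & multigraph k.+1}.

Definition K2_mx r : 'M[nat]_2 := \matrix_(i, j) (if i == j then 0%N else r).

Fact K2_subproof r : is_multigraph (K2_mx r).
Proof.
apply/andP; split; last by apply/forallP => i; rewrite mxE eqxx.
by apply/eqP/matrixP => i j; rewrite !mxE eq_sym.
Qed.

Definition K2 r : multigraph 2 := exist _ (K2_mx r) (K2_subproof r).

Fact loops_subproof r : is_multigraph (const_mx r.*2 : 'M[nat]_1).
Proof.
apply/andP; split; last by apply/forallP => i; rewrite mxE odd_double.
by apply/eqP/matrixP => i j; rewrite !mxE.
Qed.

Definition loops r : multigraph 1 := exist _ (const_mx r.*2) (loops_subproof r).

Section ConfigurationModel.
Variables (n : nat) (d : {ffun 'I_n -> nat}).

Definition half_edge := {i : 'I_n & 'I_(d i)}.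

(* Perfect matchings of the half-edges, as fixed-point-free involutions. *)
Definition pairings : {set {ffun half_edge -> half_edge}} :=
  [set m : {ffun half_edge -> half_edge}
     | [forall e, (m e != e) && (m (m e) == e)]]%SET.

(* A loop at i contributes both of its half-edges to the entry (i, i). *)
Definition pairing_mx (m : {ffun half_edge -> half_edge}) : 'M[nat]_n :=
  \matrix_(i, j) #|[set e : half_edge | (tag e == i) && (tag (m e) == j)]%SET|.

Definition cm_pmf (R : realType) (g : multigraph n) : R :=
  #|[set m in pairings | pairing_mx m == val g]%SET|%:R / #|pairings|%:R.

End ConfigurationModel.

(* Law of (x_{s 1}, ..., x_{s k}) for s uniform among the injections from [k]
   to [n]: the sample is drawn from the n-element list x, so that equal values
   are counted with multiplicity. *)
Definition sample_pmf (R : realType) n k (x : 'I_n -> R) (z : 'rV[R]_k) : R :=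
  #|[set s : {ffun 'I_k -> 'I_n} | injectiveb s && (z == \row_j x (s j))]%SET|%:R
    / #|[set s : {ffun 'I_k -> 'I_n} | injectiveb s]%SET|%:R.

Section Probability.
Context (R : realType) d (Omega : measurableType d) (P : probability Omega R).

(* Conditionally on the countably-valued variable X, the variable V is discrete
   with probability mass function K X. *)
Definition cond_pmf (A B : Type) (X : Omega -> A) (V : Omega -> B)
    (K : A -> B -> R) : Prop :=
  forall a b, P ([set w | X w = a] `&` [set w | V w = b])
            = (P [set w | X w = a] * (K a b)%:E)%E.

(* g \o Y is a version of P(E | Y). *)
Definition is_cond_prob (Y : Omega -> R) (E : set Omega) (g : R -> R) : Prop :=
  measurable_fun setT g /\
  forall B : set R, measurable B ->
    P (E `&` Y @^-1` B) = (\int[P]_(w in Y @^-1` B) (g (Y w))%:E)%E.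

Definition cond_cdf (Y Z : Omega -> R) (Psi : R -> R -> R) : Prop :=
  forall t, is_cond_prob Y [set w | Z w <= t] (Psi ^~ t).

Definition cond_independent (Y : Omega -> R) k (Z : 'I_k -> Omega -> R) : Prop :=
  forall (A : 'I_k -> set R) (g : 'I_k -> R -> R),
    (forall j, measurable (A j)) ->
    (forall j, is_cond_prob Y (Z j @^-1` A j) (g j)) ->
    is_cond_prob Y [set w | forall j, A j (Z j w)] (fun y => \prod_j g j y).

End Probability.

Definition weak_cvg (R : realType) d (Omega : measurableType d)
    (P : probability Omega R) d' (Omega' : measurableType d')
    (P' : probability Omega' R) (T : topologicalType)
    (X : nat -> Omega -> T) (X' : Omega' -> T) : Prop :=
  forall g : T -> R, continuous g -> (exists M, forall t, `|g t| <= M) ->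
    ('E_P[fun w => g (X n w)] @[n --> \oo] --> 'E_P'[fun w => g (X' w)])%E.

Section Multigraphon.
Variable R : realType.
Local Notation mu := (@lebesgue_measure R).
Local Notation I01 := (`[0, 1]%classic : set R).

(* Only the values on [0, 1]^2 are meaningful. *)
Definition mkernel := nat -> R -> R -> R.

(* Measurability is Borel measurability; every Lebesgue measurable multigraphon
   is equivalent, in the sense of mequiv below, to a Borel measurable one. *)
Definition is_multigraphon (h : mkernel) : Prop :=
  [/\ (forall r x y, I01 x -> I01 y -> 0 <= h r x y <= 1),
      (forall r, (mu \x mu)%E.-integrable (I01 `*` I01)
                   (fun z => (h r z.1 z.2)%:E)
                 /\ mu.-integrable I01 (fun x => (h r x x)%:E)),
      (forall r x y, I01 x -> I01 y -> h r x y = h r y x),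
      (forall x y, I01 x -> I01 y -> series (fun r => h r x y) @ \oo --> (1 : R))
    & (forall r x, I01 x -> h r.*2.+1 x x = 0)].

Definition mequiv (h h' : mkernel) : Prop :=
  forall r,
    {ae (mu \x mu)%E,
       forall z, (I01 `*` I01) z -> h r z.1 z.2 = h' r z.1 z.2} /\
    {ae mu, forall x, I01 x -> h r x x = h' r x x}.

(* The integral over [0, 1]^k, as an iterated integral. *)
Fixpoint cube_integral k : (k.-tuple R -> \bar R) -> \bar R :=
  match k with
  | 0 => fun f => f [tuple]
  | k'.+1 => fun f =>
      (\int[mu]_(x in I01) cube_integral (fun v => f [tuple of x :: v]))%E
  end.

Definition mtail (h : mkernel) a x y : R :=
  limn (fun m => \sum_(a <= r < m) h r x y).

Definition t_hom k (F : multigraph k) (h : mkernel) : R :=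
  fine (cube_integral (fun v : k.-tuple R =>
    (\prod_(i < k) \prod_(j < k | (i <= j)%N)
       mtail h (val F i j) (tnth v i) (tnth v j))%:E)).

Definition t_ind k (F : multigraph k) (h : mkernel) : R :=
  fine (cube_integral (fun v : k.-tuple R =>
    (\prod_(i < k) \prod_(j < k | (i <= j)%N)
       h (val F i j) (tnth v i) (tnth v j))%:E)).

(* F enumerates all multigraphs from index 0, whence the weight 2^-(i+1). *)
Definition d_ms (F : nat -> any_multigraph) (h h' : mkernel) : \bar R :=
  (\sum_(0 <= i <oo)
      (2^-1 ^+ i.+1 * `|t_hom (projT2 (F i)) h - t_hom (projT2 (F i)) h'|)%:E
   + \sum_(0 <= r <oo) (`|t_ind (K2 r) h - t_ind (K2 r) h'|)%:E
   + \sum_(0 <= r <oo) (`|t_ind (loops r) h - t_ind (loops r) h'|)%:E)%E.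

(* The bounded d_ms-continuous functions on the set of multigraphons up to
   equivalence. *)
Definition ms_test (F : nat -> any_multigraph) (f : mkernel -> R) : Prop :=
  [/\ (forall h h', is_multigraphon h -> is_multigraphon h' ->
         mequiv h h' -> f h = f h'),
      (exists M, forall h, is_multigraphon h -> `|f h| <= M)
    & forall h, is_multigraphon h -> forall e : R, 0 < e ->
        exists2 delta : R, 0 < delta &
          forall h', is_multigraphon h' -> (d_ms F h h' < delta%:E)%E ->
            `|f h - f h'| < e].

(* The vertex ceil(n x), vertices being numbered from 0 here; index 0 and
   index 1 of the numbering from 1 both give vertex 0. *)
Definition vertex_at n (x : R) : 'I_n.+1 :=
  inord `|Num.ceil (n.+1%:R * x)|%N.-1.

Definition graphon_of n (G : multigraph n.+1) : mkernel :=
  fun r x y => (val G (vertex_at n x) (vertex_at n y) == r)%:R.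

(* Both sides of the convergence are almost surely multigraphons, so that the
   values of f outside of the set of multigraphons play no role. *)
Definition ms_weak_cvg (F : nat -> any_multigraph)
    d (Omega : measurableType d) (P : probability Omega R)
    d' (Omega' : measurableType d') (P' : probability Omega' R)
    (X : nat -> Omega -> mkernel) (X' : Omega' -> mkernel) : Prop :=
  [/\ (forall n, {ae P, forall w, is_multigraphon (X n w)}),
      {ae P', forall w, is_multigraphon (X' w)}
    & forall f, ms_test F f ->
        ('E_P[fun w => f (X n w)] @[n --> \oo] --> 'E_P'[fun w => f (X' w)])%E].

Definition quantile (Psi : R -> R) (x : R) : R := inf [set y | x <= Psi y].

Definition poisson_p (r : nat) (lambda : R) : R :=
  expR (- lambda) * lambda ^+ r / r`!%:R.

Definition cm_limit (y : R) (Psi : R -> R) : mkernel :=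
  fun r a b =>
    if a != b then poisson_p r (y * quantile Psi a * quantile Psi b)
    else if ~~ odd r then poisson_p r./2 (y * quantile Psi a ^+ 2 / 2)
    else 0.

Definition degree_sum n (d : {ffun 'I_n -> nat}) : nat := \sum_i d i.

Definition rescaled_degree n (d : {ffun 'I_n -> nat}) (i : 'I_n) : R :=
  n%:R * (d i)%:R / (degree_sum d)%:R.

Definition edge_density n (d : {ffun 'I_n -> nat}) : R :=
  (degree_sum d)%:R / n%:R ^+ 2.

End Multigraphon.

Arguments cm_pmf {n} d R g.
Arguments rescaled_degree R {n} d i.
Arguments edge_density R {n} d.
Arguments graphon_of R {n} G.

(* Main.v *)
(** Homomorphism densities are multiplicative under disjoint unions, so their linear
combinations form an algebra; with Bernstein polynomials, convergence of all expected
densities gives convergence of expectations of continuous functions of finitely many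
densities.  A bounded d_ms-continuous function f is the limit from below of its Lipschitz
regularisations in finitely many densities, which bounds the lower limit of the
expectations of f, and of - f.  The two other sums of d_ms are controlled by densities as
well: their terms are differences of tails that sum to 1, so Scheffe's argument applies.

It remains to compute the limit of the expected density of F in the configuration model,
that is, of the probability that the sampled vertices carry the edges of F.  Switching the
partners of two linked half-edges shows that the joint law of the numbers of edges between
k vertices of degree at most K sqrt(L_n) satisfies, up to a relative error of order
1 / sqrt(L_n), the recursion that characterises independent Poisson variables of means
Y_n Z_i Z_j and Y_n Z_i ^ 2 / 2.  A vertex violating the degree bound has
Y_n Z_j ^ 2 > K ^ 2, which is asymptotically unlikely as K grows.  The resulting bounded
continuous function of (Z_n, Y_n) converges in mean by assumption, and conditional
independence turns its limit into the density of the Poisson kernel with the quantile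
function. *)

Require Import Defs.
From mathcomp Require Import all_boot all_order all_algebra perm.
From mathcomp Require Import zify ring lra.

Set Implicit Arguments.
Unset Strict Implicit.
Unset Printing Implicit Defensive.

Import Order.TTheory GRing.Theory Num.Theory.

(** * Switchings of perfect matchings *)

(** The switching recursion determines the joint law of the edge counts only up to its value at the
    zero vector. That unknown is eliminated by applying the same estimate to the total mass, which
    is 1. The level [K] is fixed from the limit variables before the number of vertices grows: the
    error carries a factor [expR (8 * K ^+ 2) ^+ (k * k)], which only the factor 1 / sqrt(n) defeats
    for fixed [K].

    The other obstacles are measurability and null sets. Kernels carry no sigma-algebra, so a test
    function of a random kernel is measurable only as a limit of regularisations. The limit
    variables are nonnegative only almost surely; clipping by [pos] gives a kernel that satisfies
    all axioms on the whole plane for every outcome and agrees almost surely with the limit.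
    Conditional laws are given through probabilities of events, so the Poisson integrand is reached
    by rounding to a finite grid. The diagonal is null in the plane but carries the loops: in the
    integrands it is seen through equal indices, and points of the cube with repeated coordinates
    are discarded. *)

Section Switching.
Variables (T : finType) (k : nat) (c : T -> option 'I_k).
Implicit Types (m : {ffun T -> T}) (p q : option 'I_k) (a b : 'I_k).

Definition matchings : {set {ffun T -> T}} :=
  [set m : {ffun T -> T} | [forall e, (m e != e) && (m (m e) == e)]].

Lemma matchingsP m :
  reflect (forall e, m e != e /\ m (m e) = e) (m \in matchings).
Proof.
rewrite inE; apply: (iffP forallP) => h e; first by case/andP: (h e) => ? /eqP.
by case: (h e) => -> ->; rewrite eqxx.
Qed.

Lemma matching_involutive m : m \in matchings -> involutive m.
Proof. by move=> /matchingsP mP e; case: (mP e). Qed.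

(** The colour [Some a] stands for the a-th sampled vertex and [None] for all other vertices.
    Half-edges are counted, not pairs, so a pair inside one colour counts twice. *)
Definition links m p q : nat := #|[set e | (c e == p) && (c (m e) == q)]|.

Lemma links_sum m p : \sum_q links m p q = #|[set e | c e == p]|.
Proof.
rewrite -sum1_card (eq_bigl (fun e => c e == p)); last by move=> e; rewrite inE.
rewrite (partition_big (fun e => c (m e)) xpredT) //=; apply: eq_bigr => q _.
by rewrite /links -sum1_card; apply: eq_bigl => e; rewrite inE.
Qed.

Lemma links_sym m p q : m \in matchings -> links m p q = links m q p.
Proof.
move=> /matchingsP mP.
rewrite /links -!sum1_card (reindex_onto m m) => [|e _]; last by case: (mP e).
apply: eq_bigl => e; rewrite !inE; case: (mP e) => _ ->.
by rewrite eqxx andbT andbC.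
Qed.

(** Removing an element together with its partner leaves a smaller stable set. *)
Lemma fixfree_involution_even m (A : {set T}) : m \in matchings ->
  (forall e, e \in A -> m e \in A) -> ~~ odd #|A|.
Proof.
move=> /matchingsP mP; have [n] := ubnP #|A|.
elim: n => // n IH in A * => ltn AP.
have [->|[x xA]] := set_0Vmem A; first by rewrite cards0.
have [mxx mmx] := mP x.
rewrite (cardsD1 x) xA (cardsD1 (m x)) !inE mxx AP //= negbK.
rewrite add0n; apply: IH => [|e].
  move: ltn; rewrite (cardsD1 x) xA (cardsD1 (m x)) !inE mxx AP //=; lia.
rewrite !inE => /and3P[e1 e2 eA]; rewrite AP // andbT.
have mK : involutive m by move=> y; case: (mP y).
by rewrite (inj_eq (inv_inj mK)) e2 -(inj_eq (inv_inj mK)) mK.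
Qed.

Lemma links_diag_even m p : m \in matchings -> ~~ odd (links m p p).
Proof.
move=> mP; apply: fixfree_involution_even (mP) _ => e; rewrite !inE.
by rewrite matching_involutive // => /andP[-> ->].
Qed.

(* Replaces the pairs {x, m x} and {u, m u} by {x, u} and {m x, m u}. *)
Definition switch m x u : {ffun T -> T} :=
  [ffun e => tperm (m x) u (m (tperm (m x) u e))].

Lemma switch_matching m x u : m \in matchings -> switch m x u \in matchings.
Proof.
move=> /matchingsP mP; apply/matchingsP => e; rewrite !ffunE tpermK.
set t := tperm _ _; case: (mP (t e)) => h ->; rewrite tpermK; split=> //.
by apply: contra h => /eqP{2}<-; rewrite tpermK.
Qed.

Lemma switch_partner m x u : m \in matchings -> u != x -> switch m x u x = u.
Proof.
move=> /matchingsP mP ux; rewrite ffunE [tperm _ _ x]tpermD ?tpermL //.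
by case: (mP x).
Qed.

Lemma switch_partner2 m x u : m \in matchings -> u != x ->
  switch m x u (m x) = m u.
Proof.
move=> mP ux; have mK := matching_involutive mP.
rewrite ffunE tpermL tpermD // ?(inj_eq (inv_inj mK)) 1?eq_sym //.
by case: (matchingsP _ mP u).
Qed.

(** The reverse switching conjugates by the same transposition, because the new partner of [x] is
    [u]. *)
Lemma switchK m x u : m \in matchings -> u != x ->
  switch (switch m x u) x (m x) = m.
Proof.
move=> mP ux; apply/ffunP => e.
by rewrite ffunE switch_partner // ffunE [tperm u _]tpermC !tpermK.
Qed.

(** Each of the new pairs {x, u} and {m x, m u} has an end outside the sample, so the pair {x, m x}
    is the only link between sampled vertices that is affected. If [a = b], both indicators fire, as
    a loop counts for two. *)
Lemma links_switch m x u a b (p q : 'I_k) : m \in matchings ->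
  c x = Some a -> c (m x) = Some b -> c u = None -> c (m u) = None ->
  links m (Some p) (Some q) = links (switch m x u) (Some p) (Some q)
    + ((p == a) && (q == b)) + ((p == b) && (q == a)).
Proof.
move=> mP cx cmx cu cmu; have ux : u != x by apply/eqP => ux; rewrite ux cx in cu.
have mK := matching_involutive mP; have mI := inv_inj mK.
have [mxx mmx] := matchingsP _ mP x.
have [muu mmu] := matchingsP _ mP u.
set t := tperm (m x) u.
have -> : links (switch m x u) (Some p) (Some q) =
    #|[set e | (c (t e) == Some p) && (c (t (m e)) == Some q)]|.
  rewrite /links -!sum1_card (reindex_onto t t) => [|e _]; last by rewrite tpermK.
  by apply: eq_bigl => e; rewrite !inE ffunE !tpermK eqxx andbT.
rewrite /links; set S := [set e | _].
have hx : (x \in S) = (p == a) && (q == b).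
  by rewrite inE cx cmx !(inj_eq Some_inj) eq_sym [b == q]eq_sym.
have hmx : (m x \in S :\ x) = (p == b) && (q == a).
  by rewrite !inE mxx mmx cx cmx !(inj_eq Some_inj) eq_sym [a == q]eq_sym.
rewrite (cardsD1 x S) (cardsD1 (m x) (S :\ x)) hx hmx.
rewrite [RHS]addnC addnCA; congr (_ + _); rewrite [RHS]addnC; congr (_ + _).
apply: eq_card => e; rewrite !inE.
have [ex|ex] := eqVneq e x.
  by rewrite ex andbF /= /t tpermL cu andbF.
have [emx|emx] := eqVneq e (m x); first by rewrite emx /= /t tpermL cu.
have [eu|eu] := eqVneq e u.
  rewrite eu /= cu /t [tperm _ _ (m u)]tpermD ?cmu ?andbF //.
    by rewrite (inj_eq mI) eq_sym.
  by rewrite eq_sym.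
have [emu|emu] := eqVneq (m e) u.
  have -> : e = m u by rewrite -emu mK.
  by rewrite mK cu cmu andbF /t tpermD ?cmu // ?(inj_eq mI) eq_sym.
rewrite /= [t e]tpermD 1?eq_sym // tpermD // 1?eq_sym //.
by rewrite (inj_eq mI).
Qed.

(* Double counting of the switches that destroy an (a, b)-link. *)
Lemma switch_count (A B : {set {ffun T -> T}}) a b :
  A \subset matchings -> B \subset matchings ->
  (forall m x u, m \in A -> c x = Some a -> c (m x) = Some b -> c u = None ->
     c (m u) = None -> switch m x u \in B) ->
  (forall m x y, m \in B -> c x = Some a -> c (m x) = None -> c y = Some b ->
     c (m y) = None -> y != x -> switch m x y \in A) ->
  \sum_(m in A) links m (Some a) (Some b) * links m None None =
  \sum_(m in B) links m (Some a) None * (links m (Some b) None - (a == b)).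
Proof.
move=> AM BM AB BA.
pose X := [set t : {ffun T -> T} * (T * T) | [&& t.1 \in A, c t.2.1 == Some a,
  c (t.1 t.2.1) == Some b, c t.2.2 == None & c (t.1 t.2.2) == None]].
pose Y := [set t : {ffun T -> T} * (T * T) | [&& t.1 \in B, c t.2.1 == Some a,
  c (t.1 t.2.1) == None, c t.2.2 == Some b, c (t.1 t.2.2) == None & t.2.2 != t.2.1]].
have -> : \sum_(m in A) links m (Some a) (Some b) * links m None None = #|X|.
  rewrite -sum1_card (eq_bigl (fun t : {ffun T -> T} * (T * T) =>
     (t.1 \in A) && [&& c t.2.1 == Some a, c (t.1 t.2.1) == Some b,
      c t.2.2 == None & c (t.1 t.2.2) == None])); last by move=> t; rewrite inE.
  rewrite -(pair_big_dep (fun m => m \in A) (fun m u => [&& c u.1 == Some a,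
    c (m u.1) == Some b, c u.2 == None & c (m u.2) == None]) (fun _ _ => 1)) /=.
  apply: eq_bigr => m _; rewrite /links -cardsX -sum1_card; apply: eq_bigl => -[x u].
  by rewrite in_setX !inE /= -!andbA.
have -> : \sum_(m in B) links m (Some a) None * (links m (Some b) None - (a == b)) = #|Y|.
  rewrite -sum1_card (eq_bigl (fun t : {ffun T -> T} * (T * T) =>
     (t.1 \in B) && [&& c t.2.1 == Some a, c (t.1 t.2.1) == None,
      c t.2.2 == Some b, c (t.1 t.2.2) == None & t.2.2 != t.2.1])); last first.
    by move=> t; rewrite inE.
  rewrite -(pair_big_dep (fun m => m \in B) (fun m u => [&& c u.1 == Some a,
    c (m u.1) == None, c u.2 == Some b, c (m u.2) == None & u.2 != u.1])
    (fun _ _ => 1)) /=.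
  apply: eq_bigr => m _.
  rewrite (eq_bigl (fun u : T * T => ((c u.1 == Some a) && (c (m u.1) == None)) &&
    [&& c u.2 == Some b, c (m u.2) == None & u.2 != u.1])); last first.
    by move=> u; rewrite !andbA.
  rewrite -(pair_big_dep (fun x => (c x == Some a) && (c (m x) == None)) (fun x y =>
    [&& c y == Some b, c (m y) == None & y != x]) (fun _ _ => 1)) /=.
  rewrite [RHS](_ : _ = \sum_(x | (c x == Some a) && (c (m x) == None))
    (links m (Some b) None - (a == b))).
    by rewrite sum_nat_const; congr (_ * _); apply: eq_card => x; rewrite !inE.
  apply: eq_bigr => x /andP[/eqP cx /eqP cmx]; rewrite sum1_card /links.
  (* The half-edge [x] is itself a candidate for [y] exactly when [a = b], whence the subtraction of
     one. *)
  rewrite [in RHS](cardsD1 x) inE cx cmx (inj_eq Some_inj) andbT addKn.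
  apply: eq_card => y; rewrite !inE unfold_in /=.
  by case: (y != x); rewrite ?andbT ?andbF.
rewrite -!sum1_card.
(* The image remembers the old partner of [x], which is what the reverse switching needs; the same
   formula then describes both directions of the bijection. *)
pose f (t : {ffun T -> T} * (T * T)) := (switch t.1 t.2.1 t.2.2, (t.2.1, t.1 t.2.1)).
have neq m x u : c x = Some a -> c u = None -> u != x.
  by move=> cx cu; apply/eqP => ux; rewrite ux cx in cu.
rewrite (reindex_onto f f) => [|[m [x u]]]; last first.
  rewrite inE /= => /and5P[mA /eqP cx /eqP cmx /eqP cu _].
  have mP := subsetP AM _ mA.
  by rewrite /f /= switchK ?switch_partner // (neq m).
apply: eq_bigl => -[m [x y]]; rewrite !inE /=.
set m' := switch m x y; rewrite /f /= -/m'.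
apply/andP/idP => [[/and5P[m'A /eqP cx /eqP cm'x /eqP cmx /eqP cm'mx] /eqP[em ey]]|].
  have m'P := subsetP AM _ m'A.
  have mB : m \in B by rewrite -em; apply: AB.
  have ymx := neq m _ _ cx cmx.
  rewrite mB cx cmx -ey cm'x -{1}em switch_partner2 // cm'mx !eqxx /=.
  by case: (matchingsP _ m'P x).
case/and5P => mB /eqP cx /eqP cmx /eqP cy /andP[/eqP cmy yx].
have mP := subsetP BM _ mB.
rewrite /m' BA // cx switch_partner // switch_partner2 // cy cmx cmy !eqxx; split=> //.
by rewrite switchK.
Qed.
End Switching.

(** * Mass functions that satisfy an approximate Poisson recursion *)

Section PoissonComparison.
Local Open Scope ring_scope.
Variables (R : realFieldType) (I : finType).
Implicit Types (r : {ffun I -> nat}) (i : I).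

Definition incr r i : {ffun I -> nat} := [ffun j => (r j + (j == i))%N].

Definition total r : nat := (\sum_i r i)%N.

Definition mfact r : R := \prod_i (r i)`!%:R.

Lemma mfact_gt0 r : 0 < mfact r.
Proof. by apply: prodr_gt0 => i _; rewrite ltr0n fact_gt0. Qed.

Lemma total_incr r i : total (incr r i) = (total r).+1.
Proof.
rewrite /total (eq_bigr (fun j => (r j + (j == i))%N)); last by move=> j; rewrite ffunE.
rewrite big_split /= -addn1; congr addn.
by rewrite (bigD1 i) //= eqxx big1 // => j /negbTE ->.
Qed.

Lemma mfact_incr r i : mfact (incr r i) = (r i).+1%:R * mfact r.
Proof.
rewrite /mfact (bigD1 i) // [in RHS](bigD1 i) //= ffunE eqxx addn1 factS natrM mulrA.
by congr (_ * _); apply: eq_bigr => j /negbTE ji; rewrite ffunE ji addn0.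
Qed.

Lemma prod_incr (l : I -> R) r i :
  \prod_j l j ^+ incr r i j = l i * \prod_j l j ^+ r j.
Proof.
rewrite (bigD1 i) // [in RHS](bigD1 i) //= ffunE eqxx addn1 exprS mulrA.
by congr (_ * _); apply: eq_bigr => j /negbTE ji; rewrite ffunE ji addn0.
Qed.

Lemma ffun_nat_ind (Q : {ffun I -> nat} -> Prop) :
  Q [ffun=> 0%N] -> (forall r i, Q r -> Q (incr r i)) -> forall r, Q r.
Proof.
move=> Q0 QS r; move e : (total r) => n; elim: n r e => [|n IH] r e.
  suff -> : r = [ffun=> 0%N] by [].
  apply/ffunP => i; rewrite ffunE; apply/eqP; rewrite -leqn0 -e.
  by rewrite /total (bigD1 i) // leq_addr.
have [i ri] : exists i, (0 < r i)%N.
  apply/existsP; apply: contra_eqT e => /existsPn h.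
  by rewrite /total big1 // => i _; move: (h i); rewrite lt0n negbK => /eqP.
pose r' := [ffun j => (r j - (j == i))%N].
have rr' : r = incr r' i.
  apply/ffunP => j; rewrite !ffunE; case: eqP => [->|_]; last by rewrite subn0 addn0.
  by rewrite subnK.
by rewrite rr'; apply: QS; apply: IH; move: e; rewrite rr' total_incr => -[].
Qed.

Variables (p : {ffun I -> nat} -> R) (theta : I -> {ffun I -> nat} -> R).
Variables (lambda : I -> R) (M delta : R).
Hypothesis p_ge0 : forall r, 0 <= p r.
Hypothesis p_step : forall r i, (r i).+1%:R * p (incr r i) = theta i r * p r.
Hypothesis M_ge1 : 1 <= M.
Hypothesis delta_ge0 : 0 <= delta.
Hypothesis lambda_itv : forall i, 0 <= lambda i <= M.
Hypothesis theta_le : forall r i, p r != 0 -> theta i r <= M.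
Hypothesis theta_lambda : forall r i, p r != 0 ->
  `|theta i r - lambda i| <= delta * (1 + (total r)%:R).

Local Notation p0 := (p [ffun=> 0%N]).

Lemma recursive_pmf_step r i :
  p (incr r i) * mfact (incr r i) = theta i r * (p r * mfact r).
Proof. by rewrite mfact_incr mulrCA mulrA p_step; ring. Qed.

Lemma recursive_pmf_le r : p r * mfact r <= p0 * M ^+ total r.
Proof.
elim/ffun_nat_ind: r => [|r i IH].
  rewrite /mfact /total big1 => [|i _]; last by rewrite ffunE fact0.
  by rewrite big1 => [|i _]; rewrite ?ffunE // mulr1 expr0 mulr1.
rewrite recursive_pmf_step total_incr exprS [leRHS]mulrCA.
have M0 : 0 <= M by apply: le_trans M_ge1.
have [->|pr0] := eqVneq (p r) 0.
  by rewrite mul0r mulr0 mulr_ge0 // mulr_ge0 // exprn_ge0.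
apply: le_trans (ler_wpM2r _ (theta_le i pr0)) _; last exact: ler_wpM2l.
by rewrite mulr_ge0 // ltW // mfact_gt0.
Qed.

(** With rates exactly [lambda], the product [p r * mfact r] would be [p0] times a monomial. Each
    step adds the rate error [delta * (1 + total r)] times the crude bound [recursive_pmf_le]; these
    errors add up to the quadratic factor. *)
Lemma recursive_pmf_approx r :
  `|p r * mfact r - p0 * \prod_j lambda j ^+ r j|
    <= p0 * delta * (total r)%:R ^+ 2 * M ^+ total r.
Proof.
have M0 : 0 <= M by apply: le_trans M_ge1.
elim/ffun_nat_ind: r => [|r i IH].
  rewrite /mfact /total !big1 ?mulr1 => [|i _|i _|i _]; rewrite ?ffunE //.
  by rewrite subrr normr0 mulr0n expr0n /= mulr0.
rewrite recursive_pmf_step prod_incr total_incr.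
set x := p r * mfact r; set y := \prod_j _; set N := total r.
have x0 : 0 <= x by rewrite mulr_ge0 // ltW // mfact_gt0.
have xM : x <= p0 * M ^+ N := recursive_pmf_le r.
have /andP[l0 lM] := lambda_itv i.
have h1 : `|(theta i r - lambda i) * x| <= delta * (1 + N%:R) * (p0 * M ^+ N).
  have [pr0|pr0] := eqVneq (p r) 0.
    by rewrite /x pr0 mul0r mulr0 normr0 !mulr_ge0 // ?addr_ge0 ?exprn_ge0.
  rewrite normrM (ger0_norm x0); apply: ler_pM => //; exact: theta_lambda.
have h2 : `|lambda i * (x - p0 * y)| <= M * (p0 * delta * N%:R ^+ 2 * M ^+ N).
  by rewrite normrM (ger0_norm l0); apply: ler_pM.
have -> : theta i r * x - p0 * (lambda i * y) =
  (theta i r - lambda i) * x + lambda i * (x - p0 * y) by ring.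
apply: le_trans (ler_normD _ _) _; apply: le_trans (lerD h1 h2) _.
rewrite -natr1 [M ^+ _.+1]exprS.
have MN : 0 <= M ^+ N by rewrite exprn_ge0.
set m := M ^+ N in MN *; set n := N%:R.
have n0 : 0 <= n by rewrite /n.
have h0 : 0 <= p0 * delta * m by rewrite !mulr_ge0.
have -> : delta * (1 + n) * (p0 * m) + M * (p0 * delta * n ^+ 2 * m) =
  (p0 * delta * m) * ((1 + n) + M * n ^+ 2) by ring.
have -> : p0 * delta * (n + 1) ^+ 2 * (M * m) =
  (p0 * delta * m) * (M * (n + 1) ^+ 2) by ring.
apply: ler_wpM2l => //.
have : M * (n + 1) ^+ 2 = M * n ^+ 2 + M * (1 + 2 * n) by ring.
move=> ->; rewrite addrC lerD2l.
apply: (@le_trans _ _ (1 * (1 + 2 * n))); first by lra.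
by apply: ler_wpM2r => //; lra.
Qed.

(** Absorbs the quadratic factor of [recursive_pmf_approx] into the power, which is why [4 * M]
    replaces [M] in the final error. *)
Lemma sqr_le_expr4 N : (N%:R : R) ^+ 2 <= 4 ^+ N.
Proof.
rewrite -!natrX ler_nat -mulnn; elim: N => // -[|N] // IH.
rewrite expnS; move: IH; set x := (4 ^ _)%N; nia.
Qed.

Variable B : nat.
Hypothesis p_supp : \sum_(s : {ffun I -> 'I_B}) p [ffun i => s i : nat] = 1.

Lemma box_gt0 (i : I) : (0 < B)%N.
Proof.
rewrite lt0n; apply/eqP => B0; move: p_supp; rewrite big1 => [|s _].
  by move/esym/eqP; rewrite oner_eq0.
by have := leq_ltn_trans (leq0n _) (ltn_ord (s i)); rewrite [X in (_ < X)%N]B0.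
Qed.

(** Truncation at [B] keeps the comparison finite and valid over any ordered field; as [B] grows,
    [expsum l a / expsum l 0] tends to a Poisson tail. *)
Definition expsum (l : R) (a : nat) : R := \sum_(j < B | (a <= j)%N) l ^+ j / j`!%:R.

Lemma sum_box_ge (l : I -> R) (a : I -> nat) :
  \sum_(s : {ffun I -> 'I_B} | [forall i, (a i <= s i)%N])
     \prod_i (l i ^+ s i / (s i)`!%:R)
  = \prod_i expsum (l i) (a i).
Proof.
rewrite /expsum bigA_distr_big_dep /=; apply: eq_bigl => s.
by apply/forallP/familyP => h i; have := h i.
Qed.

(** Summed over the whole box, the approximation reads 1 = p0 V up to [delta * E], with V the
    product of the truncated exponentials; this replaces the unknown [p0] by 1 / V. The sum over the
    event has the same error, whence the factor 2. *)
Lemma recursive_pmf_tail (a : I -> nat) :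
  `|\sum_(s : {ffun I -> 'I_B} | [forall i, (a i <= s i)%N]) p [ffun i => s i : nat]
    - \prod_i (expsum (lambda i) (a i) / expsum (lambda i) 0)|
  <= 2 * delta * expsum (4 * M) 0 ^+ #|I|.
Proof.
set bx := fun s : {ffun I -> 'I_B} => [ffun i => s i : nat].
have M0 : 0 <= M by apply: le_trans M_ge1.
have termE (l : I -> R) (s : {ffun I -> 'I_B}) : \prod_i (l i ^+ s i / (s i)`!%:R) = (\prod_j l j ^+ bx s j) / mfact (bx s).
  rewrite /mfact -prodf_div; apply: eq_bigr => i _; by rewrite ffunE.
have p0_le1 : p0 <= 1.
  have [z|z] := eqVneq p0 0; first by rewrite z ler01.
  pose s0 : {ffun I -> 'I_B} := [ffun i => Ordinal (box_gt0 i)].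
  rewrite -p_supp (bigD1 s0) //=.
  have e : bx s0 = [ffun=> 0%N] by apply/ffunP => i; rewrite !ffunE.
  rewrite -[X in p X <= _]e.
  by rewrite lerDl sumr_ge0.
set E := expsum (4 * M) 0 ^+ #|I|.
have approx (A : {pred {ffun I -> 'I_B}}) :
  `|\sum_(s in A) p (bx s) - p0 * \sum_(s in A) \prod_i (lambda i ^+ s i / (s i)`!%:R)|
    <= delta * E.
  rewrite mulr_sumr -sumrB; apply: le_trans (ler_norm_sum _ _ _) _.
  have -> : E = \sum_(s : {ffun I -> 'I_B}) \prod_i ((4 * M) ^+ s i / (s i)`!%:R).
    rewrite (eq_bigl (fun s : {ffun I -> 'I_B} => [forall i, (0 <= s i)%N])); last first.
      by move=> s; apply/esym/forallP.
    by rewrite (sum_box_ge (fun=> 4 * M) (fun=> 0%N)) prodr_const.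
  rewrite mulr_sumr.
  apply: le_trans (_ : _ <= \sum_(s in A) delta * \prod_i ((4 * M) ^+ s i / (s i)`!%:R)) _.
    apply: ler_sum => s _; rewrite !termE; have mf := mfact_gt0 (bx s).
    have -> : p (bx s) = p (bx s) * mfact (bx s) / mfact (bx s) by rewrite mulfK ?gt_eqF.
    rewrite mulrA -mulrBl normrM (gtr0_norm (x := (mfact _)^-1)) ?invr_gt0 //.
    rewrite [leRHS]mulrA; apply: ler_wpM2r; first by rewrite invr_ge0 ltW.
    apply: le_trans (recursive_pmf_approx _) _.
    have -> : \prod_j (4 * M) ^+ bx s j = 4 ^+ total (bx s) * M ^+ total (bx s).
      by rewrite prodrXr exprMn.
    have -> : p0 * delta * (total (bx s))%:R ^+ 2 * M ^+ total (bx s) =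
      p0 * (delta * ((total (bx s))%:R ^+ 2 * M ^+ total (bx s))) by ring.
    apply: le_trans (ler_piMl _ p0_le1) _; rewrite ?mulr_ge0 ?exprn_ge0 //.
    by rewrite ler_wpM2l // ler_wpM2r ?exprn_ge0 // sqr_le_expr4.
  rewrite [leRHS](bigID (mem A)) /= lerDl sumr_ge0 // => s _.
  rewrite mulr_ge0 // prodr_ge0 // => i _.
  by rewrite divr_ge0 // exprn_ge0 // mulr_ge0.
set V := \prod_i expsum (lambda i) 0.
have V_gt0 : 0 < V.
  apply: prodr_gt0 => i _.
  rewrite /expsum (bigD1 (Ordinal (box_gt0 i))) //= expr0 fact0 divr1.
  rewrite ltr_pwDl // sumr_ge0 // => j _.
  by rewrite divr_ge0 // exprn_ge0 //; case/andP: (lambda_itv i).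
have VE : V = \sum_(s : {ffun I -> 'I_B} | [forall i, (0 <= s i)%N])
     \prod_i (lambda i ^+ s i / (s i)`!%:R).
  exact: esym (sum_box_ge lambda (fun=> 0%N)).
have := approx predT; rewrite p_supp.
have -> : \sum_(s in predT : {pred {ffun I -> 'I_B}}) \prod_i (lambda i ^+ s i / (s i)`!%:R) = V.
  rewrite VE; apply: eq_bigl => s.
  by apply/esym/forallP.
move=> h1; have := approx [pred s : {ffun I -> 'I_B} | [forall i, (a i <= s i)%N]].
rewrite (sum_box_ge lambda a) prodf_div -/V.
set pA := \sum_(s | _) _; set vA := \prod_i _ => h2.
have vA0 : 0 <= vA.
  apply: prodr_ge0 => i _; apply: sumr_ge0 => j _.
  by rewrite divr_ge0 // exprn_ge0 //; case/andP: (lambda_itv i).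
have vAV : vA <= V.
  rewrite /vA -(sum_box_ge lambda a) VE.
  rewrite [leRHS](eq_bigl predT); last by move=> s; apply/forallP.
  rewrite [leRHS](bigID (fun s : {ffun I -> 'I_B} => [forall i, (a i <= s i)%N])) /=.
  rewrite lerDl sumr_ge0 // => s _; apply: prodr_ge0 => i _.
  by rewrite divr_ge0 // exprn_ge0 //; case/andP: (lambda_itv i).
(* The first term is the error on the event, the second the error on the total mass with a
   coefficient [vA / V] of at most 1. *)
have -> : pA - vA / V = (pA - p0 * vA) - vA / V * (1 - p0 * V).
  by field; rewrite gt_eqF.
apply: le_trans (ler_normB _ _) _.
have -> : 2 * delta * E = delta * E + delta * E by ring.
apply: lerD => //.
rewrite normrM ger0_norm ?divr_ge0 ?(ltW V_gt0) //.
by apply: le_trans h1; apply: ler_piMl => //; rewrite ler_pdivrMr ?mul1r.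
Qed.
End PoissonComparison.

(** * Edge counts between the sampled vertices *)

Section LinkCounts.
Variables (T : finType) (k : nat) (c : T -> option 'I_k).
Implicit Types (m : {ffun T -> T}) (a b : 'I_k) (r : {ffun 'I_k * 'I_k -> nat}).
Local Notation matchings := (matchings T).
Local Notation links := (links c).

Definition degree a : nat := #|[set e | c e == Some a]|.

(** Every edge is recorded once, at the ordered pair of its ends, and a loop counts as one. In these
    coordinates a switching changes a single entry by one, and the limits are independent Poisson
    variables. *)
Definition edge_counts m : {ffun 'I_k * 'I_k -> nat} :=
  [ffun ab : 'I_k * 'I_k => if (ab.1 < ab.2)%N then links m (Some ab.1) (Some ab.2)
              else if ab.1 == ab.2 then (links m (Some ab.1) (Some ab.2))./2 else 0].

Definition adjacency r a b : nat :=
  if (a < b)%N then r (a, b) else if a == b then (r (a, a)).*2 else r (b, a).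

Lemma links_adjacency m a b : m \in matchings ->
  links m (Some a) (Some b) = adjacency (edge_counts m) a b.
Proof.
move=> mP; rewrite /adjacency !ffunE /= eqxx ltnn.
have [//|ba|/val_inj ->] := ltngtP a b.
  have -> : (a == b) = false by apply/negbTE; rewrite neq_ltn ba orbT.
  by rewrite ?ba links_sym.
by rewrite eqxx even_halfK // links_diag_even.
Qed.

Definition free r a : nat := degree a - \sum_b adjacency r a b.

Lemma links_free m a : m \in matchings ->
  links m (Some a) None = free (edge_counts m) a.
Proof.
move=> mP; rewrite /free /degree -(links_sum c m) (bigD1 None) //=.
rewrite [X in _ + X](_ : _ = \sum_b links m (Some a) (Some b)); last first.
  rewrite (reindex_omap Some id) /=; last by case.
  by apply: eq_bigl => b; rewrite eqxx.
under [X in _ - X]eq_bigr do rewrite -links_adjacency //.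
by rewrite addnK.
Qed.

(** Half-edges outside the sample whose partner is outside too: those with a sampled partner are as
    many as the free half-edges of the sample. *)
Definition outer r : nat := #|T| - \sum_a degree a - \sum_a free r a.

Lemma sum_degree : #|T| = #|[set e | c e == None]| + \sum_a degree a.
Proof.
rewrite -[#|T|]sum1_card (partition_big c xpredT) //= (bigD1 None) //=; congr (_ + _).
  by rewrite sum1_card; apply: eq_card => e; rewrite !inE.
rewrite (reindex_omap Some id) /=; last by case.
apply: eq_big => [b|b _]; first by rewrite eqxx.
by rewrite sum1_card; apply: eq_card => e; rewrite !inE.
Qed.

Lemma links_outer m : m \in matchings -> links m None None = outer (edge_counts m).
Proof.
move=> mP; rewrite /outer sum_degree addnK -(links_sum c m) (bigD1 None) //=.
rewrite [X in _ = _ + X - _](_ : _ = \sum_a free (edge_counts m) a) ?addnK //.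
rewrite (reindex_omap Some id) /=; last by case.
by apply: eq_big => [b|b _]; rewrite ?eqxx // links_sym // links_free.
Qed.

Lemma edge_counts_switch m x u a b : (a <= b)%N -> m \in matchings ->
  c x = Some a -> c (m x) = Some b -> c u = None -> c (m u) = None ->
  edge_counts m = incr (edge_counts (switch m x u)) (a, b).
Proof.
move=> ab mP cx cmx cu cmu; apply/ffunP => -[p q]; rewrite !ffunE /=.
rewrite (links_switch p q mP cx cmx cu cmu) xpair_eqE; case: ifP => [pq|npq].
  suff -> : (p == b) && (q == a) = false by rewrite addn0.
  apply/negbTE/negP => /andP[/eqP pb /eqP qa]; move: pq ab; rewrite pb qa; lia.
case: eqP => [->|/eqP pq].
  (* On the diagonal the two indicators agree: removing a loop lowers the link count by two and the
     edge count by one. *)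
  rewrite [(q == b) && _]andbC -addnA addnn halfD odd_double andbF add0n doubleK //.
suff -> : (p == a) && (q == b) = false by [].
apply/negbTE/negP => /andP[/eqP pa /eqP qb]; move/eqP: pq; case; apply: val_inj.
by move: npq ab; rewrite pa qb /=; lia.
Qed.

Definition counts_class r : {set {ffun T -> T}} :=
  [set m in matchings | edge_counts m == r].

Lemma in_counts_class m r :
  (m \in counts_class r) = (m \in matchings) && (edge_counts m == r).
Proof. by rewrite inE. Qed.

Lemma incr_inj (I : finType) (r r' : {ffun I -> nat}) i : incr r i = incr r' i -> r = r'.
Proof.
move=> h; apply/ffunP => j.
by have := congr1 (fun f : {ffun I -> nat} => f j) h; rewrite !ffunE => /addIn.
Qed.

(** Both factors of the double count in [switch_count] depend on a pairing only through its edge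
    counts. They are constant on a class, so the count becomes a relation between the sizes of two
    classes. *)
Lemma counts_class_recursion r a b : (a <= b)%N ->
  #|counts_class (incr r (a, b))| * (adjacency (incr r (a, b)) a b * outer (incr r (a, b)))
  = #|counts_class r| * (free r a * (free r b - (a == b))).
Proof.
move=> ab; have sub r' : counts_class r' \subset matchings.
  by apply/subsetP => m; rewrite in_counts_class => /andP[].
have := @switch_count T k c (counts_class (incr r (a, b))) (counts_class r) a b
  (sub _) (sub _).
rewrite (eq_bigr (fun=> adjacency (incr r (a, b)) a b * outer (incr r (a, b)))); last first.
  by move=> m; rewrite in_counts_class => /andP[mP /eqP <-]; rewrite links_adjacency // links_outer.
rewrite [X in _ -> _ -> _ = X](eq_bigr (fun=> free r a * (free r b - (a == b)))); last first.
  by move=> m; rewrite in_counts_class => /andP[mP /eqP <-]; rewrite !links_free.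
rewrite !sum_nat_const; apply => [m x u|m x y]; rewrite !in_counts_class => /andP[mP /eqP mr] cx cmx cu cmu.
  rewrite switch_matching //=; apply/eqP/(@incr_inj _ _ _ (a, b)).
  by rewrite -mr; apply/esym/edge_counts_switch.
move=> yx; rewrite switch_matching //=; apply/eqP.
have := @edge_counts_switch (switch m x y) x (m x) a b ab (switch_matching _ _ mP) cx.
by rewrite switch_partner // switch_partner2 // switchK // mr; apply.
Qed.

(** [edge_counts] is zero below the diagonal; with a zero rate there, the recursion holds for all
    index pairs. *)
Lemma counts_class_lower r a b : (b < a)%N -> counts_class (incr r (a, b)) = set0.
Proof.
move=> ba; apply/setP => m; rewrite in_counts_class in_set0; apply/negbTE/negP => /andP[mP /eqP/ffunP/(_ (a, b))].
rewrite !ffunE /= eqxx addn1 ltnNge (ltnW ba) /=.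
by case: eqP => // e; move: ba; rewrite e ltnn.
Qed.

Lemma edge_counts_le m ab : (edge_counts m ab <= #|T|)%N.
Proof.
rewrite ffunE; case: ifP => _; first exact: max_card.
case: ifP => // _; have : (links m (Some ab.1) (Some ab.2) <= #|T|)%N by exact: max_card.
by move: (links _ _ _) => u; have := odd_double_half u; rewrite -addnn; lia.
Qed.

Lemma sum_adjacency_le r a : (\sum_b adjacency r a b <= 2 * total r)%N.
Proof.
rewrite mulSn mul1n; set t := total r.
have tE : t = (\sum_x \sum_y r (x, y))%N.
  by rewrite /t /total pair_bigA; apply: eq_bigr => -[].
have h1 : (\sum_(b < k) (if (a <= b)%N then r (a, b) else 0) <= t)%N.
  rewrite tE [leqRHS](bigD1 a) //=.
  by apply: leq_trans (leq_addr _ _); apply: leq_sum => b _; case: ifP.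
have h2 : (\sum_(b < k) (if (b <= a)%N then r (b, a) else 0) <= t)%N.
  rewrite tE exchange_big /= [leqRHS](bigD1 a) //=.
  by apply: leq_trans (leq_addr _ _); apply: leq_sum => b _; case: ifP.
apply: leq_trans (leq_add h1 h2); rewrite -big_split /=; apply: leq_sum => b _.
rewrite /adjacency; case: (ltngtP a b) => [ab|ba|/val_inj ->].
- by rewrite leq_addr.
- have -> : (a == b) = false by apply/negbTE; rewrite neq_ltn ba orbT.
  by rewrite leq_addl.
- by rewrite eqxx addnn.
Qed.

End LinkCounts.

Local Open Scope ring_scope.

(** * Switching rates at vertices of bounded degree *)

Section PairingEstimate.
Variables (R : realFieldType) (T : finType) (k : nat) (c : T -> option 'I_k).
Variables (s K : R).
Local Notation L := #|T|.
Local Notation degree := (degree c).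
Implicit Types (r : {ffun 'I_k * 'I_k -> nat}) (i : 'I_k * 'I_k).
Hypotheses (s_gt0 : 0 < s) (sE : s ^+ 2 = L%:R) (K_ge1 : 1 <= K).
Hypothesis degree_le : forall a, (degree a)%:R <= K * s.
Hypothesis s_large : 4 * k%:R * K <= s.
Hypothesis matching_exists : (0 < #|matchings T|)%N.

Definition edge_mean (i : 'I_k * 'I_k) : R :=
  if (i.1 < i.2)%N then (degree i.1)%:R * (degree i.2)%:R / L%:R
  else if i.1 == i.2 then (degree i.1)%:R * (degree i.2)%:R / (2 * L%:R) else 0.

Definition edge_counts_pmf (r : {ffun 'I_k * 'I_k -> nat}) : R :=
  #|counts_class c r|%:R / #|matchings T|%:R.

(** The factor left by [counts_class_recursion] after division by [outer]; the 2 on the diagonal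
    comes from [adjacency], where a loop counts twice. *)
Definition switch_rate (i : 'I_k * 'I_k) (r : {ffun 'I_k * 'I_k -> nat}) : R :=
  if (i.1 < i.2)%N then (free c r i.1 * free c r i.2)%:R / (outer c (incr r i))%:R
  else if i.1 == i.2 then (free c r i.1 * (free c r i.1).-1)%:R / (2 * (outer c (incr r i))%:R)
  else 0.

Lemma sum_degree_le : (\sum_a degree a)%:R <= k%:R * K * s.
Proof.
rewrite natr_sum (le_trans (ler_sum _ (fun a _ => degree_le a))) //.
by rewrite sumr_const card_ord -mulrA mulr_natl.
Qed.

Lemma outer_ge r : L%:R - 2 * k%:R * K * s <= (outer c r)%:R.
Proof.
have h : (\sum_a free c r a <= \sum_a degree a)%N by apply: leq_sum => a _; apply: leq_subr.
have := sum_degree_le; rewrite /outer.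
set S := (\sum_a degree a)%N in h *; set E := (\sum_a _)%N in h * => hS.
have : (L <= outer c r + S + S)%N by rewrite /outer -/S -/E; lia.
rewrite -(ler_nat R) !natrD /outer -/S -/E => h3; lra.
Qed.

Lemma outer_le r : (outer c r)%:R <= L%:R :> R.
Proof. by rewrite ler_nat /outer; lia. Qed.

(** The sampled half-edges and their partners number at most [2 * k * K * s], and [s_large] says
    exactly that this is at most half of [s ^+ 2]; hence the constant 4 there. *)
Lemma outer_half r : L%:R / 2 <= (outer c r)%:R :> R.
Proof.
apply: le_trans (outer_ge r); rewrite -sE expr2.
have := ler_wpM2r (ltW s_gt0) s_large; lra.
Qed.

Lemma outer_gt0 r : 0 < (outer c r)%:R :> R.
Proof. by apply: lt_le_trans (outer_half r); rewrite -sE divr_gt0 // exprn_gt0. Qed.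

Lemma edge_counts_pmf_step r i :
  (r i).+1%:R * edge_counts_pmf (incr r i) = switch_rate i r * edge_counts_pmf r.
Proof.
case: i => a b; rewrite /edge_counts_pmf /switch_rate /=.
have Q0 := outer_gt0 (incr r (a, b)).
have M0 : #|matchings T|%:R != 0 :> R by rewrite pnatr_eq0 -lt0n.
have [ba|ab] := ltnP b a.
  rewrite counts_class_lower // cards0 mul0r mulr0 ltnNge (ltnW ba) /=.
  by case: eqP => [e|_]; [move: ba; rewrite e ltnn|rewrite mul0r].
have := counts_class_recursion c r ab; move/(congr1 (fun n => n%:R : R)).
rewrite !natrM; set Q := (outer _ _)%:R in Q0 * => h.
apply: (mulIf M0); rewrite !mulrA mulfVK // mulfVK //.
apply: (mulIf (lt0r_neq0 Q0)).
have [eab|nab] := eqVneq a b.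
  move: h; rewrite /adjacency -eab ltnn eqxx ffunE eqxx addn1 subn1 -muln2 natrM => h.
  apply: (@mulIf _ 2) => //; rewrite ?pnatr_eq0 //.
  rewrite -mulrA (mulrAC _ _ 2) -!mulrA.
  rewrite [LHS](_ : _ = #|counts_class c (incr r (a, a))|%:R * ((r (a, a)).+1%:R * 2 * Q)); last by ring.
  by rewrite h; field; rewrite lt0r_neq0.
have lab : (a < b)%N by rewrite ltn_neqAle nab.
move: h; rewrite /adjacency lab ffunE eqxx addn1 (negbTE nab) subn0 => h.
rewrite [LHS](_ : _ = #|counts_class c (incr r (a, b))|%:R * ((r (a, b)).+1%:R * Q)); last by ring.
by rewrite h; field; rewrite lt0r_neq0.
Qed.

Lemma free_le r a : (free c r a <= degree a)%N.
Proof. exact: leq_subr. Qed.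

Lemma free_ge r a : (degree a <= free c r a + 2 * total r)%N.
Proof.
by rewrite addnC -leq_subLR leq_sub2l //; exact: sum_adjacency_le.
Qed.

Lemma edge_mean_itv i : 0 <= edge_mean i <= 2 * K ^+ 2.
Proof.
have L0 : 0 < L%:R :> R by rewrite -sE exprn_gt0.
have K0 : 0 <= K by apply: le_trans K_ge1.
have h a b : (degree a)%:R * (degree b)%:R / L%:R <= K ^+ 2.
  rewrite ler_pdivrMr // -sE -exprMn expr2; apply: ler_pM => //; exact: degree_le.
rewrite /edge_mean; case: ifP => _.
  rewrite divr_ge0 ?mulr_ge0 //=; apply: le_trans (h _ _) _.
  by rewrite mulr2n mulrDl mul1r lerDl exprn_ge0.
case: ifP => _; last by rewrite lexx mulr_ge0 ?exprn_ge0.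
rewrite divr_ge0 ?mulr_ge0 //=; apply: le_trans (_ : _ <= K ^+ 2) _; last first.
  by rewrite mulr2n mulrDl mul1r lerDl exprn_ge0.
apply: le_trans (h i.1 i.2); apply: ler_wpM2l; first by rewrite mulr_ge0.
by rewrite lef_pV2 ?posrE ?mulr_gt0 // mulr2n mulrDl mul1r lerDl ltW.
Qed.

(** The numerator is at most [K ^+ 2] times the number of half-edges, while [outer] is only known to
    be at least half of that number. This is why the comparison runs with the bound [2 * K ^+ 2]. *)
Lemma switch_rate_le r i : switch_rate i r <= 2 * K ^+ 2.
Proof.
have L0 : 0 < L%:R :> R by rewrite -sE exprn_gt0.
have K0 : 0 <= K by apply: le_trans K_ge1.
have h (x y : nat) q : (x%:R <= K * s) -> (y%:R <= K * s) -> L%:R / 2 <= q ->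
    (x * y)%:R / q <= 2 * K ^+ 2.
  move=> hx hy hq; have q0 : 0 < q by apply: lt_le_trans hq; rewrite divr_gt0.
  rewrite ler_pdivrMr //; apply: le_trans (_ : _ <= 2 * K ^+ 2 * (L%:R / 2)) _.
    rewrite natrM -sE [leRHS](_ : _ = (K * s) * (K * s)); last by field.
    exact: ler_pM.
  by apply: ler_wpM2l; rewrite ?mulr_ge0 ?exprn_ge0.
have fr a : (free c r a)%:R <= K * s.
  by apply: le_trans (degree_le a); rewrite ler_nat free_le.
rewrite /switch_rate; case: ifP => _; first by apply: h => //; exact: outer_half.
case: ifP => _; last by rewrite mulr_ge0 ?exprn_ge0.
apply: h => //; first by apply: le_trans (fr i.1); rewrite ler_nat leq_pred.
apply: le_trans (outer_half (incr r i)) _.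
by rewrite mulr2n mulrDl mul1r lerDl.
Qed.

(** The term in [8 * K] is the cost of replacing free half-edges by degrees in the numerator, the
    term in [4 * k * K ^+ 3] that of replacing [outer] by the number of half-edges in the
    denominator. *)
Definition rate_error : R := (8 * K + 4 * k%:R * K ^+ 3) / s.

Lemma switch_rate_mean r i :
  `|switch_rate i r - edge_mean i| <= rate_error * (1 + (total r)%:R).
Proof.
have L0 : 0 < L%:R :> R by rewrite -sE exprn_gt0.
have K0 : 0 <= K by apply: le_trans K_ge1.
have s0 := ltW s_gt0; have L0' := ltW L0.
set t := (total r)%:R; have t0 : 0 <= t by [].
have err0 : 0 <= rate_error.
  by rewrite /rate_error divr_ge0 ?addr_ge0 ?mulr_ge0 ?exprn_ge0 //.
set Q := (outer c (incr r i))%:R : R.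
have Q0 : 0 < Q := outer_gt0 (incr r i).
have Q0' := ltW Q0.
have Qh : L%:R / 2 <= Q := outer_half (incr r i).
have QL : Q <= L%:R := outer_le (incr r i).
have Qg : L%:R - Q <= 2 * k%:R * K * s by have := outer_ge (incr r i); rewrite -/Q; lra.
(* Here [z] is the product of free counts, [d] that of degrees, and [w] is 1 off the diagonal and 2
   on it. *)
have main (d z w : R) : 0 <= d <= K ^+ 2 * s ^+ 2 -> `|z - d| <= 4 * K * s * (1 + t) ->
    1 <= w -> `|z / (w * Q) - d / (w * L%:R)| <= rate_error * (1 + t).
  move=> /andP[d0 dK] zd w1; have w0 : 0 < w by apply: lt_le_trans w1.
  have w0' := ltW w0.
  have -> : z / (w * Q) - d / (w * L%:R) =
     w^-1 * ((z - d) / Q + d * ((L%:R - Q) / (Q * L%:R))).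
    by field; rewrite !lt0r_neq0.
  rewrite normrM ger0_norm ?invr_ge0 //.
  apply: le_trans (ler_piMl (normr_ge0 _) _) _; first by rewrite invf_le1.
  apply: le_trans (ler_normD _ _) _.
  have h1 : `|(z - d) / Q| <= 8 * K / s * (1 + t).
    rewrite normrM (ger0_norm (x := Q^-1)) ?invr_ge0 //.
    rewrite ler_pdivrMr //; apply: le_trans zd _.
    apply: le_trans (_ : _ <= 8 * K / s * (1 + t) * (s ^+ 2 / 2)) _; last first.
      by apply: ler_wpM2l; rewrite ?sE // !mulr_ge0 ?invr_ge0 ?addr_ge0 //.
    by rewrite le_eqVlt; apply/orP; left; apply/eqP; field; rewrite lt0r_neq0.
  have h2 : `|d * ((L%:R - Q) / (Q * L%:R))| <= 4 * k%:R * K ^+ 3 / s.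
    have LQ : 0 <= L%:R - Q by rewrite subr_ge0.
    rewrite ger0_norm ?mulr_ge0 ?invr_ge0 ?mulr_ge0 //.
    rewrite mulrA ler_pdivrMr ?mulr_gt0 //.
    apply: le_trans (_ : _ <= (K ^+ 2 * s ^+ 2) * (2 * k%:R * K * s)) _.
      by apply: ler_pM.
    apply: le_trans (_ : _ <= 4 * k%:R * K ^+ 3 / s * (s ^+ 2 / 2 * s ^+ 2)) _.
      by rewrite le_eqVlt; apply/orP; left; apply/eqP; field; rewrite lt0r_neq0.
    apply: ler_wpM2l; first by rewrite !mulr_ge0 ?invr_ge0 ?exprn_ge0 //.
    by rewrite sE; apply: ler_wpM2r.
  apply: le_trans (lerD h1 h2) _; rewrite /rate_error [in leRHS]mulrDl [leRHS]mulrDl lerD2l.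
  by apply: ler_peMr; rewrite ?lerDl // !mulr_ge0 ?invr_ge0 ?exprn_ge0 //.
have dd a b : 0 <= ((degree a)%:R * (degree b)%:R : R) <= K ^+ 2 * s ^+ 2.
  rewrite mulr_ge0 //= -exprMn expr2; apply: ler_pM => //; exact: degree_le.
have bounds a : [/\ 0 <= (free c r a)%:R :> R, (free c r a)%:R <= (degree a)%:R :> R,
    (degree a)%:R - (free c r a)%:R <= 2 * t & (degree a)%:R <= K * s].
  split => //; first by rewrite ler_nat free_le.
  by rewrite lerBlDl /t -(natrM _ 2) -natrD ler_nat free_ge.
(* The extra 1 in [2 * t + 1] pays for the predecessor in the diagonal rate. *)
have prod_close (x y d e : R) : 0 <= x -> x <= d -> 0 <= y -> y <= e ->
    d <= K * s -> e <= K * s -> d - x <= 2 * t -> e - y <= 2 * t + 1 ->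
    `|x * y - d * e| <= 4 * K * s * (1 + t).
  move=> x0 xd y0 ye dH eH dx ey; have H0 : 0 <= K * s by rewrite mulr_ge0.
  have -> : x * y - d * e = - (d * (e - y) + y * (d - x)) by ring.
  rewrite normrN ger0_norm; last first.
    by rewrite addr_ge0 // mulr_ge0 ?subr_ge0 //; apply: le_trans xd.
  apply: le_trans (_ : _ <= K * s * (2 * t + 1) + K * s * (2 * t)) _; last first.
    have -> : 4 * K * s * (1 + t) = K * s * (4 * (1 + t)) by ring.
    by rewrite -mulrDr; apply: ler_wpM2l => //; lra.
  apply: lerD; apply: ler_pM => //; rewrite ?subr_ge0 //.
  - exact: le_trans xd.
  - exact: le_trans eH.
rewrite /switch_rate /edge_mean; case: ifP => _.
  have [x0 xd dx dK] := bounds i.1; have [y0 ye ey eK] := bounds i.2.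
  have := main _ (free c r i.1 * free c r i.2)%:R 1 (dd i.1 i.2).
  rewrite !mul1r; apply => //; rewrite natrM; apply: prod_close => //.
  by apply: le_trans ey _; rewrite lerDl.
case: ifP => [/eqP ei|_]; last first.
  by rewrite subrr normr0 mulr_ge0 // addr_ge0.
apply: main => //; last by rewrite ler1n.
rewrite natrM -ei; have [x0 xd dx dK] := bounds i.1; apply: prod_close => //.
  by apply: le_trans xd; rewrite ler_nat leq_pred.
have : (free c r i.1)%:R <= (free c r i.1).-1%:R + 1 :> R.
  by rewrite natr1 ler_nat leqSpred.
by move: dx; set x := (free c r i.1)%:R; set x' := (_.-1)%:R; lra.
Qed.

Lemma edge_counts_tail (B : nat) (a : 'I_k * 'I_k -> nat) : (#|T| < B)%N ->
  `|#|[set m in matchings T | [forall i, (a i <= edge_counts c m i)%N]]|%:R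
      / #|matchings T|%:R
    - \prod_i (expsum B (edge_mean i) (a i) / expsum B (edge_mean i) 0)|
  <= 2 * rate_error * expsum B (4 * (2 * K ^+ 2)) 0 ^+ (k * k).
Proof.
move=> TB; have K0 : 0 <= K by apply: le_trans K_ge1.
have M0 : #|matchings T|%:R != 0 :> R by rewrite pnatr_eq0 -lt0n.
pose box m : {ffun 'I_k * 'I_k -> 'I_B} :=
  [ffun i => Ordinal (leq_ltn_trans (edge_counts_le c m i) TB)].
have sumE (P : pred {ffun 'I_k * 'I_k -> nat}) :
  \sum_(z : {ffun 'I_k * 'I_k -> 'I_B} | P [ffun i => z i : nat])
     edge_counts_pmf [ffun i => z i : nat]
  = #|[set m in matchings T | P (edge_counts c m)]|%:R / #|matchings T|%:R.
  rewrite /edge_counts_pmf -mulr_suml -natr_sum; congr (_%:R / _).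
  rewrite -[RHS]sum1_card (partition_big box (fun z => P [ffun i => z i : nat])) /=.
    apply: eq_bigr => z Ps; rewrite sum1_card; apply: eq_card => m.
    rewrite in_counts_class [RHS]unfold_in /= [X in _ = X && _]in_set; case: (m \in matchings T) => //=.
    have -> : (box m == z) = (edge_counts c m == [ffun i => z i : nat]).
      apply/eqP/eqP => [<-|e]; first by apply/ffunP => i; rewrite [RHS]ffunE [box _ _]ffunE.
      by apply/ffunP => i; rewrite ffunE; apply: val_inj; rewrite /= e ffunE.
    by case: eqP => [->|]; rewrite ?Ps ?andbF.
  move=> m; rewrite inE => /andP[_]; congr (P _).
  by apply/ffunP => i; rewrite [RHS]ffunE [box _ _]ffunE.
have p1 : \sum_(z : {ffun 'I_k * 'I_k -> 'I_B}) edge_counts_pmf [ffun i => z i : nat] = 1.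
  have := sumE predT; rewrite /= => ->; rewrite -[RHS](mulfV M0); congr (_%:R / _).
  by apply: eq_card => m; rewrite !inE andbT.
have err0 : 0 <= rate_error.
  by rewrite /rate_error divr_ge0 ?addr_ge0 ?mulr_ge0 ?exprn_ge0 // ltW.
have := @recursive_pmf_tail R _ edge_counts_pmf (fun i r => switch_rate i r) edge_mean
  (2 * K ^+ 2) rate_error _ edge_counts_pmf_step _ err0 edge_mean_itv
  (fun r i _ => switch_rate_le r i) _ B p1 a.
rewrite (eq_bigl (fun z : {ffun 'I_k * 'I_k -> 'I_B} =>
   [forall i, (a i <= [ffun j => z j : nat] i)%N])); last first.
  by move=> z; apply: eq_forallb => i; rewrite ffunE.
rewrite (sumE (fun r => [forall i, (a i <= r i)%N])) card_prod card_ord; apply.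
- by move=> r; rewrite /edge_counts_pmf divr_ge0.
- have : 1 <= K ^+ 2 by rewrite exprn_ege1.
  lra.
- by move=> r i _; exact: switch_rate_mean.
Qed.

End PairingEstimate.

From mathcomp Require Import all_classical all_reals all_analysis.
From mathcomp Require Import measurable_realfun.

Import numFieldNormedType.Exports.

Local Open Scope classical_set_scope.
Local Open Scope ring_scope.

(** * Poisson tails and the estimate for the configuration model *)

Lemma cvg_prodr (R : realType) (T I : Type) (G : set_system T) (FG : Filter G)
    (r : seq I) (P : pred I) (f : I -> T -> R) (l : I -> R) :
  (forall i, P i -> f i x @[x --> G] --> l i) ->
  \prod_(i <- r | P i) f i x @[x --> G] --> \prod_(i <- r | P i) l i.
Proof.
move=> fl; elim: r => [|i r IH].
  by under eq_fun do rewrite big_nil; rewrite big_nil; exact: cvg_cst.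
under eq_fun do rewrite big_cons; rewrite big_cons.
by case: ifP => // Pi; apply: cvgM => //; exact: fl.
Qed.

Lemma cvg_sumr (R : realType) (T I : Type) (G : set_system T) (FG : Filter G)
    (r : seq I) (Q : pred I) (f : I -> T -> R) (l : I -> R) :
  (forall i, Q i -> f i x @[x --> G] --> l i) ->
  \sum_(i <- r | Q i) f i x @[x --> G] --> \sum_(i <- r | Q i) l i.
Proof.
move=> fl; elim: r => [|i r IH].
  by under eq_fun do rewrite big_nil; rewrite big_nil; exact: cvg_cst.
under eq_fun do rewrite big_cons; rewrite big_cons.
by case: ifP => // Qi; apply: cvgD => //; exact: fl.
Qed.

Section PoissonTail.
Variable R : realType.
Implicit Types (l : R) (a B : nat).

Definition poisson_tail a l : R := 1 - \sum_(r < a) poisson_p r l.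

Lemma expsum0E B l : expsum B l 0 = series (exp_coeff l) B.
Proof. by rewrite /expsum /series /= big_mkord; apply: eq_bigl => i. Qed.

Lemma expsumE B l a : (a <= B)%N ->
  expsum B l a = series (exp_coeff l) B - series (exp_coeff l) a.
Proof.
move=> aB; have -> : expsum B l a = \sum_(a <= j < B) l ^+ j / j`!%:R by rewrite big_geq_mkord.
rewrite seriesEnat /= [in RHS](big_cat_nat (n := a)) //=.
by rewrite addrAC subrr add0r.
Qed.

Lemma cvg_exp_series l : series (exp_coeff l) @ \oo --> expR l.
Proof. exact: is_cvg_series_exp_coeff. Qed.

Lemma poisson_tailE a l : poisson_tail a l = expR (- l) * (expR l - series (exp_coeff l) a).
Proof.
rewrite mulrBr -expRD addNr expR0 /poisson_tail; congr (_ - _).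
rewrite /series /= big_mkord mulr_sumr; apply: eq_bigr => r _.
by rewrite /poisson_p mulrA.
Qed.

Lemma cvg_expsum_ratio l a :
  (expsum B l a / expsum B l 0) @[B --> \oo] --> poisson_tail a l.
Proof.
rewrite poisson_tailE mulrC expRN.
apply: (cvg_trans (G := ((series (exp_coeff l) B - series (exp_coeff l) a)
    / series (exp_coeff l) B) @[B --> \oo])).
  apply: near_eq_cvg; near=> B; rewrite expsum0E expsumE //.
  by near: B; exact: nbhs_infty_ge.
apply: cvgM; first by apply: cvgB; [exact: cvg_exp_series|exact: cvg_cst].
by apply: cvgV; [rewrite gt_eqF ?expR_gt0|exact: cvg_exp_series].
Unshelve. all: by end_near. Qed.

Lemma expsum0_le B l : 0 <= l -> expsum B l 0 <= expR l.
Proof.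
move=> l0; rewrite expsum0E; apply: nondecreasing_cvgn_le; last exact: is_cvg_series_exp_coeff.
by apply: nondecreasing_series => n _ _; rewrite /exp_coeff divr_ge0 ?exprn_ge0.
Qed.

Lemma poisson_tail_itv a l : 0 <= l -> 0 <= poisson_tail a l <= 1.
Proof.
move=> l0; rewrite poisson_tailE mulr_ge0 ?expR_ge0 //=.
  rewrite mulrBr -expRD addNr expR0 lerBlDr lerDl mulr_ge0 ?expR_ge0 //.
  by rewrite -expsum0E /expsum sumr_ge0 // => j _; rewrite divr_ge0 ?exprn_ge0.
by rewrite subr_ge0 -expsum0E expsum0_le.
Qed.

Lemma poisson_tail0 l : poisson_tail 0 l = 1.
Proof. by rewrite /poisson_tail big_ord0 subr0. Qed.

End PoissonTail.

Section PoissonHom.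
Variable R : realType.

(** The limit variables are nonnegative only almost surely, whereas test functions of them must be
    bounded and continuous on the whole space; clipping achieves both. *)
Definition pos (x : R) : R := Num.max 0 x.

Lemma pos_ge0 x : 0 <= pos x.
Proof. by rewrite /pos le_max lexx. Qed.

Lemma pos_id x : 0 <= x -> pos x = x.
Proof. exact: max_r. Qed.

(* The homomorphism density integrand of the limit, at the values z of the
   quantile function; negative arguments are clipped. *)
Definition poisson_hom k (F : 'M[nat]_k) (z : 'I_k -> R) (y : R) : R :=
  \prod_(a < k) \prod_(b < k | (a <= b)%N)
    if a == b then poisson_tail (F a b)./2 (pos y * pos (z a) ^+ 2 / 2)
    else poisson_tail (F a b) (pos y * pos (z a) * pos (z b)).

Lemma poisson_hom_itv k (F : 'M[nat]_k) z y : 0 <= poisson_hom F z y <= 1.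
Proof.
have h a b : 0 <= (if a == b then poisson_tail (F a b)./2 (pos y * pos (z a) ^+ 2 / 2)
    else poisson_tail (F a b) (pos y * pos (z a) * pos (z b))) <= 1.
  by case: ifP => _; apply: poisson_tail_itv; rewrite ?divr_ge0 ?mulr_ge0 ?exprn_ge0 ?pos_ge0.
apply/andP; split; first by apply: prodr_ge0 => a _; apply: prodr_ge0 => b _; case/andP: (h a b).
apply: prodr_ile1 => a _; rewrite prodr_ge0 => [|b _] /=; last by case/andP: (h a b).
by apply: prodr_ile1 => b _; exact: h.
Qed.

End PoissonHom.

(* For a > b the mean is 0 and the threshold is 0, so that the factor is 1. *)
Definition threshold k (F : 'M[nat]_k) (i : 'I_k * 'I_k) : nat :=
  if (i.1 < i.2)%N then F i.1 i.2 else if i.1 == i.2 then (F i.1 i.1)./2 else 0.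

Section Pairing.
Variables (R : realType) (T : finType) (k : nat) (c : T -> option 'I_k).

(** The truncation [B] need only exceed the number of half-edges, so it may tend to infinity: the
    ratios become Poisson tails and the truncated exponential of the error stays below [expR]. *)
Lemma edge_counts_poisson (K : R) (a : 'I_k * 'I_k -> nat) :
  (0 < #|T|)%N -> 1 <= K ->
  (forall b, (degree c b)%:R <= K * Num.sqrt #|T|%:R) ->
  4 * k%:R * K <= Num.sqrt (#|T|%:R : R) -> (0 < #|matchings T|)%N ->
  `|#|[set m in matchings T | [forall i, (a i <= edge_counts c m i)%N]]%SET|%:R
      / #|matchings T|%:R
    - \prod_i poisson_tail (a i) (edge_mean R c i)|
  <= 2 * ((8 * K + 4 * k%:R * K ^+ 3) / Num.sqrt #|T|%:R)
       * expR (4 * (2 * K ^+ 2)) ^+ (k * k).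
Proof.
move=> T0 K1 dK sL M0; set s := Num.sqrt _ in dK sL *.
have s0 : 0 < s by rewrite sqrtr_gt0 ltr0n.
have sE : s ^+ 2 = #|T|%:R by rewrite sqr_sqrtr.
have K0 : 0 <= K by apply: le_trans K1.
set x := _ / _; set E := _ * _ * _.
have cv : `|x - \prod_i (expsum B (edge_mean R c i) (a i) / expsum B (edge_mean R c i) 0)|
    @[B --> \oo] --> `|x - \prod_i poisson_tail (a i) (edge_mean R c i)|.
  apply: cvg_norm; apply: cvgB; first exact: cvg_cst.
  by apply: cvg_prodr => i _; exact: cvg_expsum_ratio.
apply: (cvgr_to_le cv); near=> B.
have TB : (#|T| < B)%N by near: B; exact: nbhs_infty_gt.
apply: le_trans (edge_counts_tail s0 sE K1 dK sL M0 a TB) _.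
have err0 : 0 <= 2 * rate_error k s K.
  by rewrite mulr_ge0 // divr_ge0 ?addr_ge0 ?mulr_ge0 ?exprn_ge0 // ltW.
apply: ler_wpM2l => //; apply: lerXn2r; rewrite ?nnegrE ?expR_ge0 //.
  by rewrite /expsum sumr_ge0 // => j _; rewrite divr_ge0 ?exprn_ge0 ?mulr_ge0 ?exprn_ge0.
by apply: expsum0_le; rewrite !mulr_ge0 ?exprn_ge0.
Unshelve. all: by end_near. Qed.
End Pairing.

(** * Sampled vertices of the configuration model *)

Section ConfigurationModel.
Variables (R : realType) (n k : nat) (d : {ffun 'I_n -> nat}) (s : 'I_k -> 'I_n).
Hypothesis s_inj : injective s.

Definition sample_colour (e : half_edge d) : option 'I_k :=
  [pick a | s a == tag e].

Lemma sample_colour_eq e a : (sample_colour e == Some a) = (tag e == s a).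
Proof.
rewrite /sample_colour; case: pickP => [b /eqP sb|h].
  by rewrite -sb (inj_eq s_inj) (inj_eq Some_inj).
by rewrite [RHS]eq_sym h.
Qed.

Lemma sum_tagged_card : #|{: half_edge d}| = degree_sum d.
Proof.
rewrite /half_edge card_tagged sumnE big_map /degree_sum -[in RHS]big_enum /=.
by apply: eq_bigr => i _; rewrite card_ord.
Qed.

Lemma sample_colour_degree a : degree sample_colour a = d (s a).
Proof.
rewrite /degree -sum1_card (eq_bigl (fun e : half_edge d => tag e == s a)); last first.
  by move=> e; rewrite inE sample_colour_eq.
rewrite (eq_bigl (fun e : half_edge d => (tag e == s a) && true)); last by move=> e; rewrite andbT.
have := @sig_big_dep nat 0%N addn 'I_n (fun i => 'I_(d i)) (fun i => i == s a)
   (fun _ => xpredT) (fun _ _ => 1%N).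
rewrite big_pred1_eq sum1_card card_ord => ->; by apply: eq_bigl => e.
Qed.

Lemma sample_colour_links m a b : m \in pairings d ->
  links sample_colour m (Some a) (Some b) = pairing_mx m (s a) (s b).
Proof.
by move=> _; rewrite mxE; apply: eq_card => e; rewrite !inE !sample_colour_eq.
Qed.

(** The diagonal entries of [F] and of the pairing matrix are both even, so comparing their halves
    loses nothing. *)
Lemma threshold_edge_counts (F : 'M[nat]_k) m : is_multigraph F -> m \in pairings d ->
  [forall i, (threshold F i <= edge_counts sample_colour m i)%N]
  = [forall a : 'I_k, forall b : 'I_k, (a <= b)%N ==> (F a b <= pairing_mx m (s a) (s b))%N].
Proof.
move=> /andP[_ /forallP Fe] mP.
have ev a := links_diag_even sample_colour (Some a) mP.
apply/forallP/forallP => [h a|h [a b]].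
  apply/forallP => b; apply/implyP => ab; have := h (a, b).
  rewrite /threshold /edge_counts ffunE /= -sample_colour_links //.
  case: ifP => // nab; case: eqP => [<-|]; last first.
    move=> nab'; case: nab'; apply: val_inj; apply/eqP; rewrite eqn_leq ab /=.
    by rewrite leqNgt nab.
  have := ev a; have := Fe a; set x := F a a; set y := links _ _ _ _ => ex ey.
  by rewrite -[in X in _ -> X](even_halfK ex) -[in X in _ -> X](even_halfK ey) leq_double.
rewrite /threshold /edge_counts ffunE /=.
have := forallP (h a) b; rewrite -sample_colour_links //.
case: ltngtP => //= [|/val_inj <-]; last first.
  by rewrite eqxx => /half_leq.
by move=> ba _; case: eqP => // e; move: ba; rewrite e ltnn.
Qed.

(** With Y = L / n^2 and Z_a = n d_a / L one has d_a d_b / L = Y Z_a Z_b. *)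
Lemma poisson_hom_edge_mean (F : 'M[nat]_k) : (0 < n)%N -> (0 < degree_sum d)%N ->
  \prod_i poisson_tail (threshold F i) (edge_mean R sample_colour i)
  = poisson_hom F (fun a => rescaled_degree R d (s a)) (edge_density R d).
Proof.
move=> n0 L0; have n0' : n%:R != 0 :> R by rewrite pnatr_eq0 -lt0n.
have L0' : (degree_sum d)%:R != 0 :> R by rewrite pnatr_eq0 -lt0n.
rewrite /poisson_hom -(pair_bigA _ (fun a b => poisson_tail (threshold F (a, b))
  (edge_mean R sample_colour (a, b)))) /=; apply: eq_bigr => a _.
rewrite [LHS](bigID (fun b : 'I_k => (a <= b)%N)) /= [X in _ * X]big1 ?mulr1; last first.
  move=> b; rewrite -ltnNge => ba; rewrite /threshold /edge_mean /= ltnNge (ltnW ba) /=.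
  by case: eqP => [e|_]; [move: ba; rewrite e ltnn|rewrite poisson_tail0].
apply: eq_bigr => b ab; rewrite /threshold /edge_mean /= !sample_colour_degree.
rewrite !pos_id ?divr_ge0 ?mulr_ge0 ?exprn_ge0 // sum_tagged_card.
have [eab|nab] := eqVneq a b.
  rewrite -eab ltnn; congr poisson_tail.
  by rewrite /edge_density /rescaled_degree; field; rewrite n0' L0'.
rewrite ltn_neqAle nab ab; congr poisson_tail.
by rewrite /edge_density /rescaled_degree; field; rewrite n0' L0'.
Qed.

Lemma pairing_tail (F : 'M[nat]_k) (K : R) : is_multigraph F ->
  (0 < n)%N -> (0 < degree_sum d)%N -> 1 <= K ->
  (forall a, (d (s a))%:R <= K * Num.sqrt (degree_sum d)%:R) ->
  4 * k%:R * K <= Num.sqrt ((degree_sum d)%:R : R) -> (0 < #|pairings d|)%N ->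
  `|#|[set m in pairings d |
        [forall a : 'I_k, forall b : 'I_k, (a <= b)%N ==> (F a b <= pairing_mx m (s a) (s b))%N]]%SET|%:R
      / #|pairings d|%:R
    - poisson_hom F (fun a => rescaled_degree R d (s a)) (edge_density R d)|
  <= 2 * ((8 * K + 4 * k%:R * K ^+ 3) / Num.sqrt (degree_sum d)%:R)
       * expR (4 * (2 * K ^+ 2)) ^+ (k * k).
Proof.
move=> FM n0 L0 K1 dK sL M0; rewrite -poisson_hom_edge_mean //.
have -> : [set m in pairings d | [forall a : 'I_k, forall b : 'I_k,
    (a <= b)%N ==> (F a b <= pairing_mx m (s a) (s b))%N]]%SET =
  [set m in pairings d | [forall i, (threshold F i <= edge_counts sample_colour m i)%N]]%SET.
  apply/setP => m; rewrite [LHS]finset.in_set [RHS]finset.in_set; have [mP|//] := boolP (m \in pairings d).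
  by rewrite threshold_edge_counts.
rewrite -sum_tagged_card; apply: edge_counts_poisson => //; rewrite sum_tagged_card //.
by move=> a; rewrite sample_colour_degree.
Qed.

End ConfigurationModel.

(** * Integration over the unit cube *)

Lemma Rintegral_sum d (T : measurableType d) (R : realType)
    (mu : {measure set T -> \bar R}) (D : set T) (I : Type) (s : seq I) (Q : pred I)
    (f : I -> T -> R) : measurable D ->
  (forall i, mu.-integrable D (EFin \o f i)) ->
  \int[mu]_(x in D) (\sum_(i <- s | Q i) f i x)
  = \sum_(i <- s | Q i) \int[mu]_(x in D) f i x.
Proof.
move=> mD fi; rewrite /Rintegral; under eq_integral do rewrite -sumEFin.
rewrite integral_sum // -sum_fine // => i _; apply: (integrable_fin_num mD); exact: fi.
Qed.

Lemma probability_lty d (T : measurableType d) (R : realType) (Q : probability T R) :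
  (Q setT < +oo)%E.
Proof. by rewrite probability_setT ltry. Qed.

Section BoundedIntegral.
Context d (T : measurableType d) (R : realType) (mu : {measure set T -> \bar R}).
Variable D : set T.
Hypotheses (mD : measurable D) (muD : (mu D < +oo)%E).

Lemma bounded_integrable (f : T -> R) (M : R) :
  measurable_fun D f -> (forall x, D x -> `|f x| <= M) ->
  mu.-integrable D (EFin \o f).
Proof.
move=> mf fM; apply: measurable_bounded_integrable => //.
by exists M; split; [exact: num_real|move=> N MN x Dx; apply: le_trans (fM x Dx) (ltW MN)].
Qed.

Lemma Rintegral_bounded_cvg (f_ : nat -> T -> R) (f : T -> R) (M : R) :
  (forall n, measurable_fun D (f_ n)) ->
  (forall n x, D x -> `|f_ n x| <= M) ->
  (forall x, D x -> f_ n x @[n --> \oo] --> f x) ->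
  \int[mu]_(x in D) f_ n x @[n --> \oo] --> \int[mu]_(x in D) f x.
Proof.
move=> mf fM ff.
have mf' : measurable_fun D f by apply: (measurable_fun_cvg mf) => x Dx; exact: ff.
have iM : mu.-integrable D (EFin \o cst M).
  exact: (@bounded_integrable _ `|M|).
have fM' x : D x -> `|f x| <= M.
  move=> Dx; apply: (cvgr_to_le (cvg_norm (ff x Dx))).
  by apply: nearW => n; exact: fM.
have := @dominated_cvg _ T R mu D mD (fun n => EFin \o f_ n) (EFin \o f) (EFin \o cst M).
rewrite /Rintegral => dc; apply: fine_cvg; rewrite fineK; last first.
  by apply: integrable_fin_num => //; exact: (bounded_integrable mf' fM').
apply: dc => //.
- by move=> n; apply/measurable_EFinP.
- by move=> x Dx; apply: cvg_EFin; [exact: nearW|exact: ff].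
Qed.

Lemma Rintegral_bounded (f : T -> R) (a b : R) : measurable_fun D f ->
  (forall x, D x -> a <= f x <= b) ->
  a * fine (mu D) <= \int[mu]_(x in D) f x <= b * fine (mu D).
Proof.
move=> mf fab; have fi : mu.-integrable D (EFin \o f).
  apply: (@bounded_integrable _ (Num.max `|a| `|b|)) => // x Dx.
  have /andP[h1 h2] := fab x Dx; rewrite ler_norml; apply/andP; split.
    rewrite lerNl; apply: le_trans (_ : - a <= _); first by rewrite lerN2.
    by rewrite le_max -normrN ler_norm.
  by apply: le_trans h2 _; rewrite le_max ler_norm orbT.
have ci (c : R) : mu.-integrable D (EFin \o cst c) by apply: (@bounded_integrable _ `|c|).
rewrite -!Rintegral_cst //; apply/andP; split; apply: le_Rintegral => //.
- exact: ci.
- by move=> x /fab /andP[].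
- exact: ci.
- by move=> x /fab /andP[].
Qed.

Lemma Rintegral_finite_range (I : finType) (c : T -> I) (F : I -> R) :
  (forall i, measurable (c @^-1` [set i])) ->
  \int[mu]_(x in D) F (c x) = \sum_i fine (mu (D `&` c @^-1` [set i])) * F i.
Proof.
move=> mc.
have -> : (fun x => F (c x)) = (fun x => \sum_i F i * \1_(c @^-1` [set i]) x).
  apply/funext => x; rewrite (bigD1 (c x)) //= indicE mem_set // mulr1 big1 ?addr0 //.
  move=> i ic; rewrite indicE memNset ?mulr0 // => /= e; by rewrite e eqxx in ic.
have int0 i : mu.-integrable D (EFin \o (fun x => \1_(c @^-1` [set i]) x)).
  apply: (@bounded_integrable _ 1).
    by apply: measurable_funTS; exact: (measurable_indic (mc i)).
  by move=> x _; rewrite indicE; case: (_ \in _); rewrite /= ?normr1 ?normr0 ?lexx ?ler01.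
have int1 i : mu.-integrable D (EFin \o (fun x => F i * \1_(c @^-1` [set i]) x)).
  have := integrableZl mD (F i) (int0 i).
  by apply: eq_integrable => // x _; rewrite /= EFinM.
rewrite Rintegral_sum //; apply: eq_bigr => i _; rewrite RintegralZl //.
rewrite mulrC; congr (_ * _); rewrite /Rintegral; congr fine.
by rewrite integral_indic; [rewrite [X in _ X = _]classical_sets.setIC|exact: mD|exact: mc].
Qed.

End BoundedIntegral.

Section CubeIntegral.
Variable R : realType.
Local Notation mu := (@lebesgue_measure R).
Local Notation I01 := (`[0, 1]%classic : set R).

Lemma lebesgue_I01 : mu I01 = 1%E.
Proof. by rewrite lebesgue_measure_itv /= lte_fin ltr01 oppr0 adde0. Qed.

Lemma lebesgue_I01_lty : (mu I01 < +oo)%E.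
Proof. by rewrite lebesgue_I01 ltry. Qed.

Lemma measurable_I01 : measurable I01.
Proof. exact: measurable_itv. Qed.

Hint Resolve lebesgue_I01_lty measurable_I01 : core.

(** Real-valued counterpart of [cube_integral]; the two agree on bounded measurable integrands. *)
Fixpoint rcube k : (k.-tuple R -> R) -> R :=
  match k with
  | 0 => fun f => f [tuple]
  | k'.+1 => fun f => \int[mu]_(x in I01) rcube (fun v => f [tuple of x :: v])
  end.

Lemma measurable_Rintegral_param d (T : measurableType d) (g : T * R -> R) (M : R) :
  measurable_fun setT g -> (forall z, `|g z| <= M) ->
  measurable_fun setT (fun t => \int[mu]_(x in I01) g (t, x)).
Proof.
(* Tonelli's theorem asks for a nonnegative integrand; the shift by [M] provides one and contributes
   exactly [M] to the integral. *)
move=> mg gM; pose h (z : T * R) : R := (g z + M) * \1_I01 z.2.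
have h0 z : 0 <= h z.
  rewrite /h mulr_ge0 // -lerBlDr sub0r.
  by have := gM z; rewrite ler_norml => /andP[].
have mh : measurable_fun setT h.
  apply: measurable_funM; first exact: measurable_funD.
  by apply: measurableT_comp => //; exact: measurable_indic.
have mF : measurable_fun setT (fubini_F mu (EFin \o h)).
  apply: measurable_fun_fubini_tonelli_F; first exact/measurable_EFinP.
  by move=> z; rewrite /= lee_fin.
have -> : (fun t => \int[mu]_(x in I01) g (t, x)) =
    (fun t => fine (\int[mu]_x (h (t, x))%:E) - M).
  apply/funext => t.
  have mgt : measurable_fun I01 (fun x => g (t, x)).
    by apply: measurable_funTS; apply: measurableT_comp => //; exact: pair1_measurable.
  have -> : fine (\int[mu]_x (h (t, x))%:E) = \int[mu]_(x in I01) (g (t, x) + M).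
    rewrite Rintegral_mkcond /Rintegral; congr fine; apply: eq_integral => x _.
    by rewrite /h /= patchE indicE; case: ifP; rewrite ?mulr1 ?mulr0.
  rewrite RintegralD //; last 2 first.
    by apply: (@bounded_integrable _ _ _ mu I01 _ _ _ M).
  by apply: (@bounded_integrable _ _ _ mu I01 _ _ _ `|M|).
  by rewrite Rintegral_cst // [X in fine X]lebesgue_I01 /= mulr1 addrK.
by apply: measurable_funB => //; exact: measurableT_comp.
Qed.

(** The parameter space changes along the induction: each integration variable becomes part of the
    parameter before the remaining ones are integrated. *)
Lemma measurable_rcube k d (T : measurableType d) (f : T * k.-tuple R -> R) (M : R) :
  measurable_fun setT f -> (forall z, `|f z| <= M) ->
  measurable_fun setT (fun t => rcube (fun v => f (t, v)))
  /\ forall t, `|rcube (fun v => f (t, v))| <= M.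
Proof.
elim: k d T f => [|k IH] d T f mf fM.
  split => //=; apply: (measurableT_comp (f := f)) => //; exact: pair2_measurable.
pose g (z : (T * R) * k.-tuple R) := f (z.1.1, [tuple of z.1.2 :: z.2]).
have mg : measurable_fun setT g.
  apply: measurableT_comp => //; apply: measurable_fun_pair.
    by apply: measurableT_comp.
  by apply: measurable_cons => //; apply: measurableT_comp.
have [m1 b1] := IH _ _ g mg (fun z => fM _).
split; first exact: measurable_Rintegral_param m1 b1.
move=> t /=; have := @Rintegral_bounded _ _ R mu I01 measurable_I01 lebesgue_I01_lty
   (fun x => rcube (fun v => f (t, [tuple of x :: v]))) (- M) M.
rewrite [X in fine X]lebesgue_I01 /= !mulr1 ler_norml; apply.
  apply: measurable_funTS.
  exact: (measurableT_comp m1 (pair1_measurable t)).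
by move=> x _; rewrite -ler_norml; exact: (b1 (t, x)).
Qed.
End CubeIntegral.

Section CubeCalculus.
Variable R : realType.
Local Notation mu := (@lebesgue_measure R).
Local Notation I01 := (`[0, 1]%classic : set R).
Let I01_lty := @lebesgue_I01_lty R.
Let mI01 := @measurable_I01 R.

Definition bmeas k (M : R) (f : k.-tuple R -> R) :=
  measurable_fun setT f /\ forall v, `|f v| <= M.

Lemma bmeas_section k M (f : k.+1.-tuple R -> R) x :
  bmeas M f -> bmeas M (fun v => f [tuple of x :: v]).
Proof.
move=> [mf fM]; split => [|v]; last exact: fM.
by apply: (measurableT_comp mf); apply: measurable_cons.
Qed.

Lemma bmeas_rcube k M (f : k.+1.-tuple R -> R) : bmeas M f ->
  measurable_fun setT (fun x => rcube (fun v => f [tuple of x :: v])) /\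
  forall x, `|rcube (fun v => f [tuple of x :: v])| <= M.
Proof.
move=> [mf fM]; have := @measurable_rcube R k _ (measurableTypeR R)
  (fun z => f [tuple of z.1 :: z.2]) M; apply.
  by apply: (measurableT_comp mf); apply: measurable_cons.
by move=> z; exact: fM.
Qed.

Lemma integrable_rcube k M (f : k.+1.-tuple R -> R) : bmeas M f ->
  mu.-integrable I01 (EFin \o (fun x => rcube (fun v => f [tuple of x :: v]))).
Proof.
move=> /bmeas_rcube[mf fM].
by apply: (@bounded_integrable _ _ _ mu I01 _ _ _ M) => //; exact: measurable_funTS.
Qed.

Lemma cube_integralE k M (f : k.-tuple R -> R) : bmeas M f ->
  cube_integral (fun v => (f v)%:E) = (rcube f)%:E.
Proof.
elim: k f => [//|k IH] f bf /=.
under eq_integral => x _ do rewrite (IH _ (bmeas_section x bf)).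
by rewrite fineK //; apply: integrable_fin_num => //; exact: integrable_rcube bf.
Qed.

Lemma rcubeD k M (f g : k.-tuple R -> R) : bmeas M f -> bmeas M g ->
  rcube (fun v => f v + g v) = rcube f + rcube g.
Proof.
elim: k f g => [//|k IH] f g bf bg /=.
rewrite -RintegralD //; first last.
- exact: integrable_rcube bg.
- exact: integrable_rcube bf.
by apply: eq_Rintegral => x _; apply: IH; exact: bmeas_section.
Qed.

Lemma rcubeZ k M (f : k.-tuple R -> R) (r : R) : bmeas M f ->
  rcube (fun v => r * f v) = r * rcube f.
Proof.
elim: k f => [//|k IH] f bf /=.
rewrite -RintegralZl //; last exact: integrable_rcube bf.
by apply: eq_Rintegral => x _; apply: IH; exact: bmeas_section.
Qed.

Lemma eq_rcube k (f g : k.-tuple R -> R) : f =1 g -> rcube f = rcube g.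
Proof. by move=> /funext ->. Qed.

Lemma le_rcube k M (f g : k.-tuple R -> R) : bmeas M f -> bmeas M g ->
  (forall v, f v <= g v) -> rcube f <= rcube g.
Proof.
elim: k f g => [|k IH] f g bf bg fg /=; first exact: fg.
apply: le_Rintegral => //; try exact: (integrable_rcube (M := M)).
by move=> x _; apply: IH => //; exact: bmeas_section.
Qed.

Lemma rcube_cst k (r : R) : rcube (fun _ : k.-tuple R => r) = r.
Proof.
elim: k => [//|k IH] /=; under eq_Rintegral do rewrite IH.
by rewrite Rintegral_cst // [X in fine X]lebesgue_I01 /= mulr1.
Qed.

Lemma rcube_itv k (f : k.-tuple R -> R) : measurable_fun setT f ->
  (forall v, 0 <= f v <= 1) -> 0 <= rcube f <= 1.
Proof.
move=> mf f01; have bf : bmeas 1 f.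
  by split => // v; have /andP[h0 h1] := f01 v; rewrite ger0_norm.
have b0 : bmeas 1 (fun _ : k.-tuple R => 0 : R) by split => // v; rewrite normr0.
have b1 : bmeas 1 (fun _ : k.-tuple R => 1 : R) by split => // v; rewrite normr1.
rewrite -(rcube_cst k 0) (le_rcube b0 bf) => [|v]; last by case/andP: (f01 v).
by rewrite -[leRHS](rcube_cst k 1) (le_rcube bf b1) => // v; case/andP: (f01 v).
Qed.

Lemma rcube_cvg k M (f_ : nat -> k.-tuple R -> R) (f : k.-tuple R -> R) :
  (forall n, bmeas M (f_ n)) -> (forall v, f_ n v @[n --> \oo] --> f v) ->
  rcube (f_ n) @[n --> \oo] --> rcube f.
Proof.
elim: k f_ f => [|k IH] f_ f bf ff /=; first exact: ff.
apply: (@Rintegral_bounded_cvg _ _ R mu I01 mI01 I01_lty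
  (fun n x => rcube (fun v => f_ n [tuple of x :: v])) _ M).
- by move=> n; apply: measurable_funTS; case: (bmeas_rcube (bf n)).
- by move=> n x _; case: (bmeas_rcube (bf n)).
- by move=> x _; apply: IH => [n|v]; [exact: bmeas_section|exact: ff].
Qed.

(** Each coordinate has to avoid only the finitely many values in [s], a null set, and then joins
    that list. Points with repeated coordinates are thus discarded. *)
Lemma rcube_ae k M (f g : k.-tuple R -> R) (s : seq R) : bmeas M f -> bmeas M g ->
  (forall v : k.-tuple R, uniq v -> all (fun x => x \notin s) v -> f v = g v) ->
  rcube f = rcube g.
Proof.
elim: k f g s => [|k IH] f g s bf bg fg /=; first exact: fg.
have [mf _] := bmeas_rcube bf; have [mg _] := bmeas_rcube bg.
rewrite /Rintegral; congr fine; apply: ae_eq_integral => //.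
- by apply/measurable_EFinP; exact: measurable_funTS.
- by apply/measurable_EFinP; exact: measurable_funTS.
exists [set` s]; split.
- by apply: countable_measurable => //; exact: finite_set_countable (finite_seq s).
- apply: countable_lebesgue_measure0; exact: finite_set_countable (finite_seq s).
move=> x /= h; apply: contrapT => xs; apply: h => _; congr EFin.
apply: (IH _ _ (x :: s)); [exact: bmeas_section|exact: bmeas_section|].
move=> v uv av; apply: fg => /=.
  rewrite uv andbT; apply/negP => xv; move/allP: av => /(_ x xv).
  by rewrite inE eqxx.
apply/andP; split; first exact/negP.
by apply: sub_all av => y; rewrite inE negb_or => /andP[].
Qed.

Lemma rcube_split k l M N (f : ('I_k -> R) -> R) (g : ('I_l -> R) -> R) :
  bmeas M (fun v : k.-tuple R => f (tnth v)) ->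
  bmeas N (fun v : l.-tuple R => g (tnth v)) ->
  rcube (fun v : (k + l).-tuple R =>
    f (fun i => tnth v (lshift l i)) * g (fun i => tnth v (rshift k i)))
  = rcube (fun v : k.-tuple R => f (tnth v)) * rcube (fun v : l.-tuple R => g (tnth v)).
Proof.
elim: k f => [|k IH] f bf bg.
  rewrite -(rcubeZ _ bg); apply: eq_rcube => v; congr (f _ * g _).
    by apply/funext => -[].
  by apply/funext => i; congr tnth; apply: val_inj.
rewrite /= -RintegralZr //; last exact: integrable_rcube bf.
pose fc x (w : 'I_k -> R) : R := f (fun i => if unlift ord0 i is Some j then w j else x).
have consE (n : nat) x (v : n.-tuple R) (i : 'I_n.+1) :
  tnth [tuple of x :: v] i = if unlift ord0 i is Some j then tnth v j else x.
  by case: unliftP => [j ->|->]; rewrite ?tnthS ?tnth0.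
have fcE x : (fun v : k.-tuple R => f (tnth [tuple of x :: v])) = (fun v => fc x (tnth v)).
  apply/funext => v; rewrite /fc; congr f; apply/funext => i; exact: consE.
apply: eq_Rintegral => x _; rewrite fcE -IH //.
  apply: eq_rcube => v; congr (_ * _); rewrite /fc; congr (_ _); apply/funext => i.
    rewrite consE; case: (unliftP ord0 i) => [j ->|->].
      rewrite (_ : lshift l (lift ord0 j) = lift ord0 (lshift l j)) ?liftK //; exact: val_inj.
    rewrite (_ : lshift l ord0 = ord0) ?unlift_none //; exact: val_inj.
  rewrite (_ : rshift k.+1 i = lift ord0 (rshift k i)) ?consE ?liftK //.
  exact: val_inj.
rewrite -fcE; exact: (bmeas_section x bf).
Qed.

Definition fcons (I : finType) k (i : I) (s : {ffun 'I_k -> I}) : {ffun 'I_k.+1 -> I} :=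
  [ffun j => if unlift ord0 j is Some j' then s j' else i].

Lemma sum_fcons (I : finType) k (G : {ffun 'I_k.+1 -> I} -> R) :
  \sum_s G s = \sum_i \sum_s G (fcons i s).
Proof.
rewrite pair_bigA /= (reindex (fun p : I * {ffun 'I_k -> I} => fcons p.1 p.2)) //=.
exists (fun s : {ffun 'I_k.+1 -> I} => (s ord0, [ffun j => s (lift ord0 j)])) => [[i s]|s] _ /=.
  by rewrite ffunE unlift_none; congr (_, _); apply/ffunP => j; rewrite !ffunE liftK.
by apply/ffunP => j; rewrite ffunE; case: unliftP => [j' ->|->] //; rewrite ffunE.
Qed.

(** Serves twice: with [vertex_at] it turns the density of a multigraph into a count of maps, and
    with the rounded quantile function it turns a cube integral into a sum of products of cell
    probabilities. *)
Lemma rcube_finite_range k (I : finType) (c : R -> I) (phi : {ffun 'I_k -> I} -> R) :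
  (forall i, measurable (c @^-1` [set i])) ->
  rcube (fun v : k.-tuple R => phi [ffun j => c (tnth v j)])
  = \sum_s phi s * \prod_j fine (mu (I01 `&` c @^-1` [set (s j)])).
Proof.
move=> mc; elim: k phi => [|k IH] phi.
  rewrite /= (big_pred1 [ffun j => c (tnth [tuple] j)]) ?big_ord0 ?mulr1 // => s.
  by apply/esym/eqP/ffunP => -[].
rewrite /= sum_fcons.
transitivity (\int[mu]_(x in I01) (\sum_s phi (fcons (c x) s) *
    \prod_j fine (mu (I01 `&` c @^-1` [set (s j)])))).
  apply: eq_Rintegral => x _; rewrite -(IH (fun s => phi (fcons (c x) s))).
  apply: eq_rcube => v; congr phi; apply/ffunP => j; rewrite !ffunE.
  by case: unliftP => [j' ->|->]; rewrite ?ffunE ?tnthS ?tnth0.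
rewrite (@Rintegral_finite_range _ _ R mu I01 mI01 I01_lty I c (fun i => \sum_s phi (fcons i s) *
  \prod_j fine (mu (I01 `&` c @^-1` [set (s j)])))) //.
apply: eq_bigr => i _; rewrite mulr_sumr; apply: eq_bigr => s _.
rewrite big_ord_recl ffunE unlift_none mulrCA; congr (_ * (_ * _)).
by apply: eq_bigr => j _; rewrite ffunE liftK.
Qed.

End CubeCalculus.

(** * Kernels on the plane and their densities *)

Lemma measurable_prod_cond d (T : measurableType d) (R : realType) (I : eqType)
    (s : seq I) (Q : pred I) (f : I -> T -> R) :
  (forall i, Q i -> measurable_fun setT (f i)) ->
  measurable_fun setT (fun x => \prod_(i <- s | Q i) f i x).
Proof.
move=> mf; under eq_fun do rewrite big_mkcond; apply: measurable_prod => i _.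
by have [Qi|_] := boolP (Q i); [exact: mf|exact: measurable_cst].
Qed.

Section Kernels.
Variable R : realType.
Local Notation mu := (@lebesgue_measure R).
Local Notation I01 := (`[0, 1]%classic : set R).
Implicit Types (h : mkernel R).

(* A multigraphon all of whose axioms hold on the whole plane. *)
Definition plane_kernel h : Prop :=
  [/\ (forall r, measurable_fun setT (fun z : R * R => h r z.1 z.2)),
      (forall r x y, 0 <= h r x y),
      (forall r x y, h r x y = h r y x),
      (forall x y, series (fun r => h r x y) @ \oo --> (1 : R))
    & (forall r x, h r.*2.+1 x x = 0)].

(** Agrees with [mtail] when the layers sum to 1, and is visibly measurable as a finite sum. *)
Definition ktail h a x y : R := 1 - \sum_(r < a) h r x y.

Lemma plane_kernel_sum_le h a x y : plane_kernel h -> \sum_(r < a) h r x y <= 1.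
Proof.
move=> [_ h0 _ h1 _]; have e : limn (series (fun r => h r x y)) = 1 by apply: cvg_lim.
rewrite -{}e; have -> : \sum_(r < a) h r x y = series (fun r => h r x y) a.
  by rewrite /series /= big_mkord.
apply: nondecreasing_cvgn_le; last by apply/cvg_ex; exists 1; exact: h1.
by apply: nondecreasing_series => n _ _; exact: h0.
Qed.

Lemma plane_kernel_le1 h r x y : plane_kernel h -> h r x y <= 1.
Proof.
move=> ph; have := plane_kernel_sum_le r.+1 x y ph; apply: le_trans.
by rewrite big_ord_recr /= lerDr sumr_ge0 // => i _; case: ph.
Qed.

Lemma ktail_itv h a x y : plane_kernel h -> 0 <= ktail h a x y <= 1.
Proof.
move=> ph; rewrite /ktail subr_ge0 plane_kernel_sum_le //= gerBl sumr_ge0 // => i _.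
by case: ph.
Qed.

Lemma measurable_ktail h a d (T : measurableType d) (f g : T -> R) : plane_kernel h ->
  measurable_fun setT f -> measurable_fun setT g ->
  measurable_fun setT (fun t => ktail h a (f t) (g t)).
Proof.
move=> [mh _ _ _ _] mf mg; apply: measurable_funB => //; apply: measurable_sum => r.
exact: (measurableT_comp (mh r) (measurable_fun_pair mf mg)).
Qed.

Lemma mtailE h a x y : plane_kernel h -> mtail h a x y = ktail h a x y.
Proof.
move=> [_ _ _ h1 _]; rewrite /mtail; apply: cvg_lim => //.
apply: (@cvg_trans _ ((series (fun r => h r x y) m - \sum_(r < a) h r x y) @[m --> \oo])).
  apply: near_eq_cvg; near=> m; have am : (a <= m)%N by near: m; exact: nbhs_infty_ge.
  rewrite seriesEnat /= (big_cat_nat (n := a)) //= big_mkord addrAC subrr add0r //.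
by apply: cvgB; [exact: h1|exact: cvg_cst].
Unshelve. all: by end_near. Qed.

Lemma ktail0 h x y : ktail h 0 x y = 1.
Proof. by rewrite /ktail big_ord0 subr0. Qed.

Lemma ktailS h a x y : ktail h a x y = h a x y + ktail h a.+1 x y.
Proof. by rewrite /ktail big_ord_recr /=; ring. Qed.

Lemma ktail_cvg0 h x y : plane_kernel h -> ktail h a x y @[a --> \oo] --> 0.
Proof.
move=> [_ _ _ h1 _]; rewrite -(subrr 1); apply: cvgB; first exact: cvg_cst.
by under eq_fun do rewrite -(big_mkord xpredT (fun r => h r x y)); exact: h1.
Qed.

Lemma plane_kernel_multigraphon h : plane_kernel h -> is_multigraphon h.
Proof.
move=> ph; have [mh h0 hs h1 hd] := ph; split => //.
- by move=> r x y _ _; rewrite h0 plane_kernel_le1.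
- move=> r; split.
    apply: (@bounded_integrable _ _ R (mu \x mu)%E (I01 `*` I01) _ _
      (fun z => h r z.1 z.2) 1).
    + exact: measurableX.
    + apply: le_lt_trans (_ : (_ <= mu I01 * mu I01)%E) _; last by rewrite lebesgue_I01 mule1 ltry.
      by rewrite le_eqVlt; apply/orP; left; apply/eqP; apply: product_measure1E.
    + apply: measurable_funTS; exact: mh.
    + by move=> z _; rewrite ger0_norm ?plane_kernel_le1.
  apply: (@bounded_integrable _ _ R mu I01 _ _ (fun x => h r x x) 1) => //.
  + exact: lebesgue_I01_lty.
  + apply: measurable_funTS.
    exact: (measurableT_comp (mh r) (measurable_fun_pair (@measurable_id _ _ _) (@measurable_id _ _ _))).
  + by move=> z _; rewrite ger0_norm ?plane_kernel_le1.
Qed.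

Definition hom_integrand k (F : 'M[nat]_k) h (v : 'I_k -> R) : R :=
  \prod_(i < k) \prod_(j < k | (i <= j)%N) ktail h (F i j) (v i) (v j).

Lemma hom_integrand_itv k (F : 'M[nat]_k) h v : plane_kernel h ->
  0 <= hom_integrand F h v <= 1.
Proof.
move=> ph; have kt a x y := ktail_itv a x y ph.
apply/andP; split.
  by apply: prodr_ge0 => i _; apply: prodr_ge0 => j _; case/andP: (kt (F i j) (v i) (v j)).
apply: prodr_ile1 => i _; rewrite prodr_ge0 => [|j _] /=.
  by apply: prodr_ile1 => j _; exact: kt.
by case/andP: (kt (F i j) (v i) (v j)).
Qed.

Lemma measurable_hom_integrand k (F : 'M[nat]_k) h : plane_kernel h ->
  measurable_fun setT (fun v : k.-tuple R => hom_integrand F h (tnth v)).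
Proof.
move=> ph; apply: measurable_prod => i _; apply: measurable_prod_cond => j _.
by apply: measurable_ktail => //; exact: measurable_tnth.
Qed.

Lemma unit_bmeas k (f : k.-tuple R -> R) : measurable_fun setT f ->
  (forall v, 0 <= f v <= 1) -> bmeas 1 f.
Proof.
by move=> mf f01; split => // v; have /andP[f0 f1] := f01 v; rewrite ger0_norm.
Qed.

Lemma bmeas_hom_integrand k (F : 'M[nat]_k) h : plane_kernel h ->
  bmeas 1 (fun v : k.-tuple R => hom_integrand F h (tnth v)).
Proof.
move=> ph; apply: unit_bmeas; first exact: measurable_hom_integrand.
by move=> v; exact: hom_integrand_itv.
Qed.

Lemma t_homE k (F : multigraph k) h : plane_kernel h ->
  t_hom F h = rcube (fun v : k.-tuple R => hom_integrand (val F) h (tnth v)).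
Proof.
move=> ph; rewrite /t_hom -[RHS]/(fine (_)%:E) -(cube_integralE (bmeas_hom_integrand (val F) ph)).
congr (fine (cube_integral _)); apply/funext => v; congr EFin.
by apply: eq_bigr => i _; apply: eq_bigr => j _; rewrite mtailE.
Qed.

Lemma t_hom_itv k (F : multigraph k) h : plane_kernel h -> 0 <= t_hom F h <= 1.
Proof.
move=> ph; rewrite t_homE //; apply: rcube_itv; first exact: measurable_hom_integrand.
by move=> v; exact: hom_integrand_itv.
Qed.

Fact disjoint_union_subproof k l (F : multigraph k) (G : multigraph l) :
  is_multigraph (block_mx (val F) 0 0 (val G)).
Proof.
have [/andP[/eqP sF /forallP dF] /andP[/eqP sG /forallP dG]] := (valP F, valP G).
apply/andP; split; first by rewrite tr_block_mx sF sG !trmx0.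
apply/forallP => i; case: (split_ordP i) => j ->.
  by rewrite block_mxEul.
by rewrite block_mxEdr.
Qed.

Definition disjoint_union k l (F : multigraph k) (G : multigraph l) : multigraph (k + l) :=
  exist _ (block_mx (val F) 0 0 (val G)) (disjoint_union_subproof F G).

(** The off-diagonal blocks ask for at least 0 edges, a factor of 1, so the integrand splits into
    functions of disjoint sets of variables. *)
Lemma t_hom_disjoint_union k l (F : multigraph k) (G : multigraph l) h : plane_kernel h ->
  t_hom (disjoint_union F G) h = t_hom F h * t_hom G h.
Proof.
move=> ph; rewrite !t_homE //.
rewrite -(rcube_split (bmeas_hom_integrand _ ph) (bmeas_hom_integrand _ ph)).
apply: eq_rcube => v; rewrite /hom_integrand big_split_ord /=; congr (_ * _).
  apply: eq_bigr => i _; rewrite big_split_ord /= [X in _ * X]big1 ?mulr1.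
    by apply: eq_bigr => j _; rewrite block_mxEul.
  by move=> j _; rewrite block_mxEur mxE ktail0.
apply: eq_bigr => i _; rewrite big_split_ord /= big_pred0 ?mul1r.
  by apply: eq_big => [j|j _]; rewrite ?leq_add2l // block_mxEdr.
by move=> j; apply/negbTE; rewrite -ltnNge ltn_addr.
Qed.

End Kernels.

(** * Induced densities as differences of tails *)

Definition two_vertex_mx a b r : 'M[nat]_2 :=
  \matrix_(i, j) (if i != j then r else if i == ord0 then a.*2 else b.*2).

Fact two_vertex_subproof a b r : is_multigraph (two_vertex_mx a b r).
Proof.
apply/andP; split.
  by apply/eqP/matrixP => i j; rewrite !mxE eq_sym; case: eqP => //= ->.
by apply/forallP => i; rewrite mxE eqxx /=; case: ifP; rewrite odd_double.
Qed.

(* a loops at the first vertex, b loops at the second one, r edges. *)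
Definition two_vertex a b r : multigraph 2 :=
  exist _ (two_vertex_mx a b r) (two_vertex_subproof a b r).

Lemma alternating4_solve (V : zmodType) (a b c d u : V) :
  a + d = (u + b) + c -> u = a - b - c + d.
Proof. by move=> e; rewrite addrAC [X in X - c]addrAC e addrAC addrK addrK. Qed.

Section InducedDensities.
Variable R : realType.
Implicit Types (h : mkernel R).

Lemma prod_upper2 (f : 'I_2 -> 'I_2 -> R) :
  \prod_(i < 2) \prod_(j < 2 | (i <= j)%N) f i j =
  f ord0 ord0 * f ord0 ord_max * f ord_max ord_max.
Proof.
under eq_bigr do rewrite big_mkcond.
rewrite !big_ord_recl !big_ord0 /= !mulr1 !mul1r.
by rewrite (_ : lift ord0 ord0 = ord_max); last exact: val_inj.
Qed.

Lemma prod_upper1 (f : 'I_1 -> 'I_1 -> R) :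
  \prod_(i < 1) \prod_(j < 1 | (i <= j)%N) f i j = f ord0 ord0.
Proof. by rewrite big_ord1 big_mkcond big_ord1. Qed.

Definition pair_integrand h (A B C : R -> R -> R) (v : 2.-tuple R) : R :=
  let x := tnth v ord0 in let y := tnth v ord_max in A x x * B x y * C y y.

Lemma t_hom_two_vertex a b r h : plane_kernel h ->
  t_hom (two_vertex a b r) h =
  rcube (pair_integrand h (ktail h a.*2) (ktail h r) (ktail h b.*2)).
Proof.
move=> ph; rewrite t_homE //; apply: eq_rcube => v.
by rewrite /hom_integrand prod_upper2 !mxE.
Qed.

Definition unit_kernel (A : R -> R -> R) :=
  measurable_fun setT (fun z : R * R => A z.1 z.2) /\ forall x y, 0 <= A x y <= 1.

Lemma unit_kernel_ktail h a : plane_kernel h -> unit_kernel (ktail h a).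
Proof.
by move=> ph; split; [exact: measurable_ktail|move=> x y; exact: ktail_itv].
Qed.

Lemma unit_kernel_layer h r : plane_kernel h -> unit_kernel (h r).
Proof.
move=> ph; case: (ph) => mh h0 _ _ _; split; first exact: mh.
by move=> x y; rewrite h0 plane_kernel_le1.
Qed.

Lemma bmeas_pair_integrand h A B C :
  unit_kernel A -> unit_kernel B -> unit_kernel C -> bmeas 1 (pair_integrand h A B C).
Proof.
move=> [mA A1] [mB B1] [mC C1]; apply: unit_bmeas => [|v]; last first.
  have /andP[a0 a1] := A1 (tnth v ord0) (tnth v ord0).
  have /andP[b0 b1] := B1 (tnth v ord0) (tnth v ord_max).
  have /andP[c0 c1] := C1 (tnth v ord_max) (tnth v ord_max).
  by rewrite /pair_integrand !mulr_ge0 //= !mulr_ile1 ?mulr_ge0.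
pose p (i j : 'I_2) (v : 2.-tuple R) := (tnth v i, tnth v j).
have mp i j : measurable_fun setT (p i j).
  by apply: measurable_fun_pair; exact: measurable_tnth.
apply: measurable_funM; first apply: measurable_funM.
- exact: (measurableT_comp mA (mp ord0 ord0)).
- exact: (measurableT_comp mB (mp ord0 ord_max)).
- exact: (measurableT_comp mC (mp ord_max ord_max)).
Qed.

(** The density of two loopless vertices joined by at least r edges. It links the two kinds of
    densities: it is a combination of homomorphism densities, and its successive differences are the
    induced densities of [K2]. *)
Definition simple_tail h r : R := rcube (pair_integrand h (h 0%N) (ktail h r) (h 0%N)).

Lemma layer0_diag h x : plane_kernel h -> ktail h 0 x x = h 0%N x x + ktail h 2 x x.
Proof.
by move=> [_ _ _ _ /(_ 0%N) hd]; rewrite (ktailS h 0) (ktailS h 1) hd add0r.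
Qed.

Lemma simple_tailE h r : plane_kernel h ->
  simple_tail h r = t_hom (two_vertex 0 0 r) h - t_hom (two_vertex 1 0 r) h
    - t_hom (two_vertex 0 1 r) h + t_hom (two_vertex 1 1 r) h.
Proof.
move=> ph; rewrite !t_hom_two_vertex //.
have kt a := unit_kernel_ktail a ph; have k0 := unit_kernel_layer 0 ph.
set f := fun a b => pair_integrand h (ktail h a.*2) (ktail h r) (ktail h b.*2).
pose g := pair_integrand h (h 0%N) (ktail h r) (h 0%N).
have bf a b : bmeas 1 (f a b) by apply: bmeas_pair_integrand.
have bg : bmeas 1 g by apply: bmeas_pair_integrand.
have bD k M N (u w : k.-tuple R -> R) : bmeas M u -> bmeas N w -> bmeas (M + N) (fun v => u v + w v).
  move=> [mu uM] [mw wN]; split; first exact: measurable_funD.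
  by move=> v; apply: le_trans (ler_normD _ _) _; apply: lerD.
have weaken k M N (u : k.-tuple R -> R) : M <= N -> bmeas M u -> bmeas N u.
  by move=> MN [mu uM]; split => // v; apply: le_trans MN.
suff : rcube (f 0 0)%N + rcube (f 1 1)%N = (simple_tail h r + rcube (f 1 0)%N) + rcube (f 0 1)%N.
  exact: alternating4_solve.
rewrite -(rcubeD (bf 0 0)%N (bf 1 1)%N) -(rcubeD bg (bf 1 0)%N).
have b2 : bmeas (1 + 1) (fun v => g v + f 1%N 0%N v) by apply: bD.
rewrite -(rcubeD b2); last by apply: weaken (bf 0 1)%N; rewrite lerDl.
apply: eq_rcube => v; rewrite /f /g /pair_integrand /=.
by rewrite !(layer0_diag _ ph); ring.
Qed.

Lemma t_ind_K2 r h : plane_kernel h ->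
  t_ind (K2 r) h = rcube (pair_integrand h (h 0%N) (h r) (h 0%N)).
Proof.
move=> ph; have kl a := unit_kernel_layer a ph.
rewrite /t_ind -[RHS]/(fine (_)%:E) -(cube_integralE (bmeas_pair_integrand h (kl 0%N) (kl r) (kl 0%N))).
congr (fine (cube_integral _)); apply/funext => v; congr EFin.
by rewrite prod_upper2 !mxE.
Qed.

Lemma t_ind_K2_tail r h : plane_kernel h ->
  t_ind (K2 r) h = simple_tail h r - simple_tail h r.+1.
Proof.
move=> ph; rewrite t_ind_K2 // /simple_tail; apply/eqP; rewrite eq_sym subr_eq; apply/eqP.
have kl a := unit_kernel_layer a ph; have kt a := unit_kernel_ktail a ph.
rewrite -(@rcubeD _ _ 1); [|exact: bmeas_pair_integrand|exact: bmeas_pair_integrand].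
by apply: eq_rcube => v; rewrite /pair_integrand (ktailS h r); ring.
Qed.

Lemma t_ind_K2_ge0 r h : plane_kernel h -> 0 <= t_ind (K2 r) h.
Proof.
move=> ph; rewrite t_ind_K2 //; have kl a := unit_kernel_layer a ph.
have [mf _] := bmeas_pair_integrand h (kl 0%N) (kl r) (kl 0%N).
rewrite -(rcube_cst 2 0); apply: (@le_rcube _ _ 1) => [||v].
- by split => // v; rewrite normr0.
- exact: bmeas_pair_integrand.
- by case: ph => _ h0 _ _ _; rewrite !mulr_ge0.
Qed.

Lemma simple_tail_ge0 r h : plane_kernel h -> 0 <= simple_tail h r.
Proof.
move=> ph; have kl a := unit_kernel_layer a ph; have kt a := unit_kernel_ktail a ph.
rewrite -(rcube_cst 2 0); apply: (@le_rcube _ _ 1) => [||v].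
- by split => // v; rewrite normr0.
- exact: bmeas_pair_integrand.
- case: (ph) => _ h0 _ _ _; rewrite !mulr_ge0 //.
  by case/andP: (ktail_itv r (tnth v ord0) (tnth v ord_max) ph).
Qed.

Lemma simple_tail_cvg0 h : plane_kernel h -> simple_tail h r @[r --> \oo] --> 0.
Proof.
move=> ph; have kl a := unit_kernel_layer a ph; have kt a := unit_kernel_ktail a ph.
rewrite -(rcube_cst 2 0); apply: (@rcube_cvg _ _ 1) => [n|v].
  exact: bmeas_pair_integrand.
rewrite /pair_integrand -[X in _ --> X](mul0r (h 0%N (tnth v ord_max) (tnth v ord_max))).
apply: cvgM; last exact: cvg_cst.
rewrite -[X in _ --> X](mulr0 (h 0%N (tnth v ord0) (tnth v ord0))).
by apply: cvgM; [exact: cvg_cst|exact: ktail_cvg0].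
Qed.

Lemma t_hom_loops r h : plane_kernel h ->
  t_hom (loops r) h = rcube (fun v : 1.-tuple R => ktail h r.*2 (tnth v ord0) (tnth v ord0)).
Proof.
by move=> ph; rewrite t_homE //; apply: eq_rcube => v; rewrite /hom_integrand prod_upper1 mxE.
Qed.

Lemma bmeas_diag A : unit_kernel A ->
  bmeas 1 (fun v : 1.-tuple R => A (tnth v ord0) (tnth v ord0)).
Proof.
move=> [mA A1]; apply: unit_bmeas => // .
have mp : measurable_fun setT (fun v : 1.-tuple R => (tnth v ord0, tnth v ord0)).
  by apply: measurable_fun_pair; exact: measurable_tnth.
exact: (measurableT_comp mA mp).
Qed.

Lemma t_ind_loops r h : plane_kernel h ->
  t_ind (loops r) h = rcube (fun v : 1.-tuple R => h r.*2 (tnth v ord0) (tnth v ord0)).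
Proof.
move=> ph; rewrite /t_ind -[RHS]/(fine (_)%:E).
rewrite -(cube_integralE (bmeas_diag (unit_kernel_layer r.*2 ph))).
congr (fine (cube_integral _)); apply/funext => v; congr EFin.
by rewrite prod_upper1 !mxE.
Qed.

Lemma t_ind_loops_tail r h : plane_kernel h ->
  t_ind (loops r) h = t_hom (loops r) h - t_hom (loops r.+1) h.
Proof.
move=> ph; rewrite t_ind_loops // !t_hom_loops //; apply/eqP; rewrite eq_sym subr_eq; apply/eqP.
have kl a := bmeas_diag (unit_kernel_layer a ph); have kt a := bmeas_diag (unit_kernel_ktail a ph).
rewrite -(rcubeD (kl _) (kt _)); apply: eq_rcube => v.
by case: ph => _ _ _ _ hd; rewrite doubleS (ktailS h r.*2) (ktailS h r.*2.+1) hd add0r.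
Qed.

Lemma t_ind_loops_ge0 r h : plane_kernel h -> 0 <= t_ind (loops r) h.
Proof.
move=> ph; rewrite t_ind_loops // -(rcube_cst 1 0); apply: (@le_rcube _ _ 1) => [||v].
- by split => // v; rewrite normr0.
- exact: bmeas_diag (unit_kernel_layer _ _).
- by case: ph.
Qed.

Lemma t_hom_loops_cvg0 h : plane_kernel h -> t_hom (loops r) h @[r --> \oo] --> 0.
Proof.
move=> ph; under eq_fun do rewrite t_hom_loops //.
rewrite -(rcube_cst 1 0); apply: (@rcube_cvg _ _ 1) => [n|v].
  exact: bmeas_diag (unit_kernel_ktail _ _).
apply: (@squeeze_cvgr _ _ _ _ (fun=> 0) (fun a => ktail h a (tnth v ord0) (tnth v ord0))).
- apply: nearW => a; case/andP: (ktail_itv a.*2 (tnth v ord0) (tnth v ord0) ph) => -> _ /=.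
  rewrite /ktail lerD2l lerN2 -!(big_mkord xpredT (fun r => h r _ _)).
  rewrite [leRHS](big_cat_nat (n := a)) //= -?addnn ?leq_addr // lerDl.
  by apply: sumr_ge0 => r _; case: ph.
- exact: cvg_cst.
- exact: ktail_cvg0.
Qed.

End InducedDensities.

(** * Continuous functions of homomorphism densities *)

Lemma sum5_ltn (a b c d e n : nat) : (a + b + c + d + e < n)%N ->
  [/\ (a < n)%N, (b < n)%N, (c < n)%N, (d < n)%N & (e < n)%N].
Proof. by move=> h; split; lia. Qed.

Lemma alternating4_close (R : realDomainType) (a1 a2 a3 a4 b1 b2 b3 b4 delta : R) :
  `|a1 - b1| <= delta -> `|a2 - b2| <= delta -> `|a3 - b3| <= delta ->
  `|a4 - b4| <= delta ->
  `|(a1 - a2 - a3 + a4) - (b1 - b2 - b3 + b4)| <= 4 * delta.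
Proof.
move=> c1 c2 c3 c4.
have -> : (a1 - a2 - a3 + a4) - (b1 - b2 - b3 + b4) =
  (a1 - b1) - (a2 - b2) - (a3 - b3) + (a4 - b4) by ring.
have -> : 4 * delta = delta + delta + delta + delta by ring.
apply: le_trans (ler_normD _ _) (lerD _ c4).
apply: le_trans (ler_normB _ _) (lerD _ c3).
exact: le_trans (ler_normB _ _) (lerD c1 c2).
Qed.

Section Continuity.
Variable R : realType.
Implicit Types (h : mkernel R).

Lemma nneseries_le (a : nat -> R) (c : R) : (forall i, 0 <= a i) ->
  (forall n, \sum_(i < n) a i <= c) -> (\sum_(0 <= i <oo) (a i)%:E <= c%:E)%E.
Proof.
move=> a0 ac; apply: lime_le.
  by apply: is_cvg_nneseries => n _ _; rewrite lee_fin.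
by apply: nearW => n; rewrite big_mkord sumEFin lee_fin.
Qed.

(* Scheffe: the differences of two nonnegative nonincreasing sequences are
   close in l^1 as soon as their first terms are close and one tail is small. *)
Lemma telescope_l1_le (U U' : nat -> R) (r n : nat) (eta : R) :
  (forall i, U i.+1 <= U i) -> (forall i, U' i.+1 <= U' i) ->
  (forall i, 0 <= U i) -> (forall i, 0 <= U' i) ->
  (forall i, (i <= r)%N -> `|U i - U' i| <= eta) ->
  \sum_(i < n) `|(U i - U i.+1) - (U' i - U' i.+1)| <= (2 * r%:R + 1) * eta + 2 * U r.
Proof.
move=> dU dU' U0 U0' close.
pose a i := `|(U i - U i.+1) - (U' i - U' i.+1)|.
rewrite -[X in X <= _]/(\sum_(i < n) a i).
have a0 i : 0 <= a i by exact: normr_ge0.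
have tel (V : nat -> R) m : \sum_(r <= i < r + m) (V i - V i.+1) = V r - V (r + m)%N.
  elim: m => [|m IH]; first by rewrite addn0 big_geq // subrr.
  by rewrite addnS big_nat_recr ?leq_addr //= IH; ring.
apply: (@le_trans _ _ (\sum_(0 <= i < r + n) a i)).
  rewrite -(big_mkord xpredT a) [leRHS](big_cat_nat (n := n)) ?leq_addl //= lerDl.
  exact: sumr_ge0.
rewrite (big_cat_nat (n := r)) ?leq_addr //=.
have h1 : \sum_(0 <= i < r) a i <= 2 * r%:R * eta.
  rewrite big_mkord; apply: (@le_trans _ _ (\sum_(i < r) (2 * eta))); last first.
    by rewrite sumr_const card_ord -[leLHS]mulr_natr mulrAC.
  apply: ler_sum => i _; rewrite /a (_ : U i - U i.+1 - (U' i - U' i.+1) =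
    (U i - U' i) - (U i.+1 - U' i.+1)); last by ring.
  apply: le_trans (ler_normB _ _) _; rewrite mulr2n mulrDl mul1r.
  by apply: lerD; apply: close; [exact: ltnW|].
have h2 : \sum_(r <= i < r + n) a i <= U r + U' r.
  apply: (@le_trans _ _ (\sum_(r <= i < r + n) ((U i - U i.+1) + (U' i - U' i.+1)))).
    apply: ler_sum => i _; apply: le_trans (ler_normB _ _) _.
    by rewrite !ger0_norm ?subr_ge0.
  by rewrite big_split /= !tel; apply: lerD; rewrite gerBl.
have := close r (leqnn r); rewrite ler_distlC => /andP[_ h3].
apply: le_trans (lerD h1 h2) _; lra.
Qed.

Lemma geometric_half (m n : nat) (a : nat -> R) : (forall i, 0 <= a i <= 1) ->
  \sum_(m <= i < m + n) 2^-1 ^+ i.+1 * a i <= 2^-1 ^+ m.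
Proof.
move=> a1; have two : (0 : R) < 2^-1 by [].
apply: (@le_trans _ _ (2^-1 ^+ m - 2^-1 ^+ (m + n))); last first.
  by rewrite gerBl exprn_ge0 // ltW.
elim: n => [|n IH]; first by rewrite addn0 big_geq // subrr.
rewrite addnS big_nat_recr ?leq_addr //=; apply: le_trans (lerD IH (lexx _)) _.
have /andP[_ h1] := a1 (m + n)%N.
have : 2^-1 ^+ (m + n).+1 * a (m + n)%N <= 2^-1 ^+ (m + n).+1.
  by apply: ler_piMr => //; rewrite exprn_ge0 // ltW.
by rewrite exprS; set x := _ ^+ (m + n); lra.
Qed.

Variable F : nat -> any_multigraph.
Hypothesis F_enum : bijective F.

(** The geometric weights cut the first sum of [d_ms] to finitely many terms. The other two
    telescope, and [telescope_l1_le] needs closeness only up to an index [r] beyond which the tails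
    of [h] are small; nothing is asked of the tails of [h']. *)
Lemma t_hom_close_dms h (e : R) : plane_kernel h -> 0 < e ->
  exists N : nat, exists2 delta : R, 0 < delta & forall h', plane_kernel h' ->
   (forall i, (i < N)%N -> `|t_hom (projT2 (F i)) h - t_hom (projT2 (F i)) h'| < delta) ->
   (d_ms F h h' < e%:E)%E.
Proof.
move=> ph e0.
have e80 : 0 < e / 16 by rewrite divr_gt0.
have [r Ur Vr] : exists2 r, simple_tail h r < e / 16 & t_hom (loops r) h < e / 16.
  have [r1 _ h1] := @cvgr_lt _ _ _ _ _ _ (simple_tail_cvg0 ph) _ e80.
  have [r2 _ h2] := @cvgr_lt _ _ _ _ _ _ (t_hom_loops_cvg0 ph) _ e80.
  by exists (r1 + r2)%N; [apply: h1; rewrite /= leq_addr|apply: h2; rewrite /= leq_addl].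
have [g Fg] : exists g : any_multigraph -> nat, forall M, F (g M) = M.
  by case: F_enum => g _ FG; exists g.
have [N0 _ hN0] : \forall n \near \oo, (2^-1 : R) ^+ n < e / 16.
  have : (2^-1 : R) ^+ n @[n --> \oo] --> 0.
    by apply: cvg_expr; rewrite ger0_norm // invf_lt1 // ltr1n.
  by move=> /cvgr_lt; exact.
pose ix k (M : multigraph k.+1) := g (existT _ k M).
(* A sum serves as a crude maximum: [N] exceeds [N0] and the indices of all the multigraphs needed
   up to [r]. *)
pose N := (N0 + \sum_(i < r.+1) (ix _ (two_vertex 0 0 i) + ix _ (two_vertex 1 0 i)
  + ix _ (two_vertex 0 1 i) + ix _ (two_vertex 1 1 i) + ix _ (loops i)).+1)%N.
(* The three sums are together at most [(10 * r + 6) * delta + 5 * (e / 16)], that is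
   [6 * (e / 16)]. *)
pose delta := e / 16 / (10 * r%:R + 6).
have d0 : 0 < delta by rewrite divr_gt0 // ltr_wpDl // mulr_ge0.
exists N, delta => // h' ph' close.
have closeM k (M : multigraph k.+1) : (ix _ M < N)%N -> `|t_hom M h - t_hom M h'| <= delta.
  by move=> /close; rewrite /ix Fg => /ltW.
have ixN i : (i <= r)%N -> (ix _ (two_vertex 0 0 i) + ix _ (two_vertex 1 0 i)
  + ix _ (two_vertex 0 1 i) + ix _ (two_vertex 1 1 i) + ix _ (loops i) < N)%N.
  move=> ir; have ir' : (i < r.+1)%N by [].
  rewrite /N (bigD1 (Ordinal ir')) //=; set x := (_ + ix _ (loops i))%N; lia.
have closeU i : (i <= r)%N -> `|simple_tail h i - simple_tail h' i| <= 4 * delta.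
  move=> /ixN/sum5_ltn[i1 i2 i3 i4 _]; rewrite !simple_tailE //.
  have c1 : `|t_hom (two_vertex 0 0 i) h - t_hom (two_vertex 0 0 i) h'| <= delta by exact: closeM.
  have c2 : `|t_hom (two_vertex 1 0 i) h - t_hom (two_vertex 1 0 i) h'| <= delta by exact: closeM.
  have c3 : `|t_hom (two_vertex 0 1 i) h - t_hom (two_vertex 0 1 i) h'| <= delta by exact: closeM.
  have c4 : `|t_hom (two_vertex 1 1 i) h - t_hom (two_vertex 1 1 i) h'| <= delta by exact: closeM.
  exact: (alternating4_close c1 c2 c3 c4).
have closeV i : (i <= r)%N -> `|t_hom (loops i) h - t_hom (loops i) h'| <= delta.
  by move=> /ixN/sum5_ltn[_ _ _ _ i5]; exact: closeM.
have S1 : (\sum_(0 <= i <oo)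
    (2^-1 ^+ i.+1 * `|t_hom (projT2 (F i)) h - t_hom (projT2 (F i)) h'|)%:E
    <= (delta + e / 16)%:E)%E.
  apply: nneseries_le => [i|n]; first by rewrite mulr_ge0 ?exprn_ge0.
  set a := fun i => `|t_hom (projT2 (F i)) h - t_hom (projT2 (F i)) h'|.
  have a1 i : 0 <= a i <= 1.
    rewrite normr_ge0 /=; have /andP[x0 x1] := t_hom_itv (projT2 (F i)) ph.
    have /andP[y0 y1] := t_hom_itv (projT2 (F i)) ph'.
    by rewrite /a ler_norml; apply/andP; split; lra.
  apply: (@le_trans _ _ (\sum_(0 <= i < N + n) 2^-1 ^+ i.+1 * a i)).
    rewrite -(big_mkord xpredT (fun i => 2^-1 ^+ i.+1 * a i)).
    rewrite [leRHS](big_cat_nat (n := n)) ?leq_addl //= lerDl.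
    apply: sumr_ge0 => i _; apply: mulr_ge0; [exact: exprn_ge0|by case/andP: (a1 i)].
  rewrite (big_cat_nat (n := N)) ?leq_addr //=; apply: lerD.
    apply: (@le_trans _ _ (\sum_(0 <= i < 0 + N) 2^-1 ^+ i.+1 * 1 * delta)).
      rewrite add0n big_nat_cond [leRHS]big_nat_cond; apply: ler_sum => i /andP[/andP[_ iN] _].
      by rewrite mulr1 ler_wpM2l ?exprn_ge0 // ltW // close.
    rewrite -mulr_suml; apply: ler_piMl; first exact: ltW.
    by rewrite -(expr0 (2^-1 : R)); apply: geometric_half => i; rewrite ler01 lexx.
  apply: le_trans (geometric_half _ _ a1) _; apply: ltW; apply: hN0.
  by rewrite /= /N leq_addr.
have S2 : (\sum_(0 <= r <oo) (`|t_ind (K2 r) h - t_ind (K2 r) h'|)%:E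
    <= ((2 * r%:R + 1) * (4 * delta) + 2 * (e / 16))%:E)%E.
  apply: nneseries_le => // n; under eq_bigr do rewrite !t_ind_K2_tail //.
  have dec h1 i : plane_kernel h1 -> simple_tail h1 i.+1 <= simple_tail h1 i.
    by move=> p1; rewrite -subr_ge0 -t_ind_K2_tail // t_ind_K2_ge0.
  apply: le_trans (telescope_l1_le _ (fun i => dec h i ph) (fun i => dec h' i ph')
    (fun i => simple_tail_ge0 i ph) (fun i => simple_tail_ge0 i ph') closeU) _.
  by rewrite lerD2l ler_wpM2l // ltW.
have S3 : (\sum_(0 <= r <oo) (`|t_ind (loops r) h - t_ind (loops r) h'|)%:E
    <= ((2 * r%:R + 1) * delta + 2 * (e / 16))%:E)%E.
  apply: nneseries_le => // n; under eq_bigr do rewrite !t_ind_loops_tail //.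
  have dec h1 i : plane_kernel h1 -> t_hom (loops i.+1) h1 <= t_hom (loops i) h1.
    by move=> p1; rewrite -subr_ge0 -t_ind_loops_tail // t_ind_loops_ge0.
  have pos h1 i : plane_kernel h1 -> 0 <= t_hom (loops i) h1.
    by move=> p1; case/andP: (t_hom_itv (loops i) p1).
  apply: le_trans (telescope_l1_le _ (fun i => dec h i ph) (fun i => dec h' i ph')
    (fun i => pos h i ph) (fun i => pos h' i ph') closeV) _.
  by rewrite lerD2l ler_wpM2l // ltW.
apply: le_lt_trans (leeD (leeD S1 S2) S3) _; rewrite -!EFinD lte_fin.
have : delta * (10 * r%:R + 6) = e / 16.
  by rewrite /delta mulfVK // gt_eqF // ltr_wpDl // mulr_ge0.
lra.
Qed.

Lemma ms_test_continuous f h (e : R) : ms_test F f -> plane_kernel h -> 0 < e ->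
  exists N : nat, exists2 delta : R, 0 < delta & forall h', plane_kernel h' ->
   (forall i, (i < N)%N -> `|t_hom (projT2 (F i)) h - t_hom (projT2 (F i)) h'| < delta) ->
   `|f h - f h'| < e.
Proof.
move=> [_ _ fc] ph e0; have [d1 d10 hd] := fc h (plane_kernel_multigraphon ph) e e0.
have [N [delta d0 hN]] := t_hom_close_dms ph d10.
exists N, delta => // h' ph' close; apply: hd; first exact: plane_kernel_multigraphon.
exact: hN.
Qed.

End Continuity.

(** * Bernstein polynomials *)

Section Bernstein.
Variable R : realFieldType.
Implicit Types (x : R) (g : nat -> R) (N : nat).

Definition bernstein N x (i : nat) : R := 'C(N, i)%:R * x ^+ i * (1 - x) ^+ (N - i).

Definition bernstein_sum N x g : R := \sum_(i < N.+1) bernstein N x i * g i.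

Lemma bernstein_ge0 N x i : 0 <= x <= 1 -> 0 <= bernstein N x i.
Proof.
move=> /andP[x0 x1]; rewrite /bernstein !mulr_ge0 // ?exprn_ge0 // subr_ge0 //.
Qed.

Lemma bernsteinS N x i : (i <= N)%N ->
  bernstein N.+1 x i.+1 = (1 - x) * bernstein N x i.+1 + x * bernstein N x i.
Proof.
move=> iN; rewrite /bernstein binS natrD subSS.
have -> : (1 - x) * ('C(N, i.+1)%:R * x ^+ i.+1 * (1 - x) ^+ (N - i.+1)) =
  'C(N, i.+1)%:R * x ^+ i.+1 * (1 - x) ^+ (N - i).
  move: iN; rewrite leq_eqVlt => /predU1P[->|iN]; first by rewrite bin_small // !mul0r mulr0.
  by rewrite -(subnSK iN) [(1 - x) ^+ _.+1]exprS mulrCA.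
rewrite exprS; move: (x ^+ i) ((1 - x) ^+ (N - i)) => p q.
by move: ('C(N, i)%:R) ('C(N, i.+1)%:R) => a b; ring.
Qed.

(** Splits off one of N + 1 independent trials of success probability [x]; the moments of order 0, 1
    and 2 follow by induction on the number of trials. *)
Lemma bernstein_sumS N x g : bernstein_sum N.+1 x g =
  (1 - x) * bernstein_sum N x g + x * bernstein_sum N x (fun i => g i.+1).
Proof.
rewrite /bernstein_sum big_ord_recl /=.
have -> : \sum_(i < N.+1) bernstein N.+1 x (bump 0 i) * g (bump 0 i) =
  \sum_(i < N.+1) ((1 - x) * (bernstein N x i.+1 * g i.+1) + x * (bernstein N x i * g i.+1)).
  apply: eq_bigr => i _; rewrite /bump /= add1n bernsteinS; last exact: (ltn_ord i).
  by rewrite mulrDl !mulrA.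
rewrite big_split /= -!mulr_sumr addrA; congr (_ + _).
rewrite [in RHS]big_ord_recl /= mulrDr; congr (_ + _).
  by rewrite /bernstein !bin0 !expr0 !subn0 exprS; ring.
congr (_ * _); rewrite big_ord_recr /= [X in _ + X](_ : _ = 0) ?addr0.
  by apply: eq_bigr => i _; rewrite /bump /= add1n.
by rewrite /bernstein bin_small // !mul0r.
Qed.

Lemma bernstein_sumD N x g g' :
  bernstein_sum N x (fun i => g i + g' i) = bernstein_sum N x g + bernstein_sum N x g'.
Proof. by rewrite -big_split; apply: eq_bigr => i _; rewrite mulrDr. Qed.

Lemma bernstein_sumZ N x a g :
  bernstein_sum N x (fun i => a * g i) = a * bernstein_sum N x g.
Proof. by rewrite mulr_sumr; apply: eq_bigr => i _; rewrite mulrCA. Qed.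

Lemma eq_bernstein_sum N x g g' : g =1 g' -> bernstein_sum N x g = bernstein_sum N x g'.
Proof. by move=> e; apply: eq_bigr => i _; rewrite e. Qed.

Lemma bernstein_sum1 N x : bernstein_sum N x (fun=> 1) = 1.
Proof.
elim: N => [|N IH]; last by rewrite bernstein_sumS !IH; ring.
by rewrite /bernstein_sum big_ord1 /bernstein bin0 !expr0 !mulr1.
Qed.

Lemma bernstein_mean N x : bernstein_sum N x (fun i => i%:R - N%:R * x) = 0.
Proof.
elim: N => [|N IH].
  by rewrite /bernstein_sum big_ord1 mul0r subrr mulr0.
have shift (a : R) : bernstein_sum N x (fun i => i%:R - N%:R * x + a * 1) = a.
  by rewrite bernstein_sumD bernstein_sumZ IH bernstein_sum1 add0r mulr1.
have e1 : bernstein_sum N x (fun i => i%:R - N.+1%:R * x) = - x.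
  by rewrite -[RHS]shift; apply: eq_bernstein_sum => i; rewrite -natr1; ring.
have e2 : bernstein_sum N x (fun i => i.+1%:R - N.+1%:R * x) = 1 - x.
  by rewrite -[RHS]shift; apply: eq_bernstein_sum => i; rewrite -!natr1; ring.
by rewrite bernstein_sumS e1 e2; ring.
Qed.

Lemma bernstein_variance N x :
  bernstein_sum N x (fun i => (i%:R - N%:R * x) ^+ 2) = N%:R * x * (1 - x).
Proof.
elim: N => [|N IH].
  by rewrite /bernstein_sum big_ord1 /= !mul0r subrr expr0n mulr0.
have expand (c : R) : bernstein_sum N x (fun i => (i%:R - N%:R * x + c) ^+ 2) =
    N%:R * x * (1 - x) + c ^+ 2.
  rewrite (eq_bernstein_sum N x (g' := fun i => ((i%:R - N%:R * x) ^+ 2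
    + (2 * c) * (i%:R - N%:R * x)) + c ^+ 2 * 1)); last by move=> i; ring.
  by rewrite !bernstein_sumD !bernstein_sumZ IH bernstein_mean bernstein_sum1; ring.
have e1 : bernstein_sum N x (fun i => (i%:R - N.+1%:R * x) ^+ 2) =
    N%:R * x * (1 - x) + (- x) ^+ 2.
  by rewrite -expand; apply: eq_bernstein_sum => i; rewrite -natr1; ring.
have e2 : bernstein_sum N x (fun i => (i.+1%:R - N.+1%:R * x) ^+ 2) =
    N%:R * x * (1 - x) + (1 - x) ^+ 2.
  by rewrite -expand; apply: eq_bernstein_sum => i; rewrite -!natr1; ring.
by rewrite bernstein_sumS e1 e2 -natr1; ring.
Qed.

(** For u >= 0 one has u <= eta + u^2 / eta, and the frequency of successes in N + 1 trials has
    variance x (1 - x) / (N + 1). *)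
Lemma bernstein_abs_dev N x (eta : R) : 0 <= x <= 1 -> 0 < eta ->
  bernstein_sum N.+1 x (fun i => `|i%:R / N.+1%:R - x|) <= eta + eta^-1 / N.+1%:R.
Proof.
move=> x01 e0; have /andP[x0 x1] := x01; have n0 : 0 < N.+1%:R :> R by rewrite ltr0n.
apply: (@le_trans _ _ (bernstein_sum N.+1 x
  (fun i => eta * 1 + (eta^-1 / N.+1%:R ^+ 2) * (i%:R - N.+1%:R * x) ^+ 2))).
  apply: ler_sum => i _; apply: ler_wpM2l; first exact: bernstein_ge0.
  set u := `|_|; have u0 : 0 <= u by exact: normr_ge0.
  have -> : (eta^-1 / N.+1%:R ^+ 2) * (i%:R - N.+1%:R * x) ^+ 2 = eta^-1 * u ^+ 2.
    by rewrite /u real_normK ?num_real //; field; rewrite !gt_eqF.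
  rewrite mulr1; have [ue|eu] := leP u eta.
    by apply: le_trans ue _; rewrite lerDl mulr_ge0 ?invr_ge0 ?exprn_ge0 // ltW.
  apply: (@le_trans _ _ (eta^-1 * u ^+ 2)); last by rewrite lerDr ltW.
  by rewrite expr2 mulrA ler_peMl // ler_pdivlMl // mulr1 ltW.
rewrite bernstein_sumD !bernstein_sumZ bernstein_sum1 bernstein_variance mulr1 lerD2l.
have -> : eta^-1 / N.+1%:R ^+ 2 * (N.+1%:R * x * (1 - x)) = (x * (1 - x)) * (eta^-1 / N.+1%:R).
  by field; rewrite !gt_eqF.
apply: ler_piMl; first by rewrite divr_ge0 ?invr_ge0 // ltW.
by rewrite mulr_ile1 ?subr_ge0 // gerBl.
Qed.

Lemma bernstein_marginal m N (x : 'I_m -> R) (i : 'I_m) (u : nat -> R) :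
  \sum_(c : {ffun 'I_m -> 'I_N.+1}) (\prod_j bernstein N (x j) (c j)) * u (c i)
  = bernstein_sum N (x i) u.
Proof.
have -> : bernstein_sum N (x i) u =
   \prod_j bernstein_sum N (x j) (fun k => if j == i then u k else 1).
  rewrite (bigD1 i) //= eqxx big1 ?mulr1 // => j /negbTE ->; exact: bernstein_sum1.
rewrite /bernstein_sum bigA_distr_bigA /=; apply: eq_bigr => c _.
rewrite [RHS]big_split /=; congr (_ * _).
by rewrite (bigD1 i) //= eqxx big1 ?mulr1 // => j /negbTE ->.
Qed.

Lemma bernstein_total m N (x : 'I_m -> R) :
  \sum_(c : {ffun 'I_m -> 'I_N.+1}) (\prod_j bernstein N (x j) (c j)) = 1.
Proof.
rewrite -(bigA_distr_bigA (fun j (i : 'I_N.+1) => bernstein N (x j) i)) big1 // => j _.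
rewrite -[RHS](bernstein_sum1 N (x j)); apply: eq_bigr => i _; by rewrite mulr1.
Qed.

(** A Lipschitz bound in the l^1 distance reduces the error to the mean deviations of the m
    marginals of the product law. *)
Lemma bernstein_lipschitz m N (phi : ('I_m -> R) -> R) (K eta : R) (x : 'I_m -> R) :
  0 <= K -> 0 < eta ->
  (forall y z, `|phi y - phi z| <= K * \sum_i `|y i - z i|) ->
  (forall i, 0 <= x i <= 1) ->
  `|phi x - \sum_(c : {ffun 'I_m -> 'I_N.+2})
      phi (fun i => (c i)%:R / N.+1%:R) * \prod_j bernstein N.+1 (x j) (c j)|
  <= K * m%:R * (eta + eta^-1 / N.+1%:R).
Proof.
move=> K0 e0 lip x01; set b := fun c : {ffun 'I_m -> 'I_N.+2} => \prod_j bernstein N.+1 (x j) (c j).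
have b0 c : 0 <= b c by apply: prodr_ge0 => j _; exact: bernstein_ge0.
have -> : phi x = \sum_(c : {ffun 'I_m -> 'I_N.+2}) phi x * b c.
  by rewrite -mulr_sumr bernstein_total mulr1.
rewrite -sumrB; apply: le_trans (ler_norm_sum _ _ _) _.
apply: (@le_trans _ _ (\sum_(c : {ffun 'I_m -> 'I_N.+2}) \sum_i
   K * (b c * `|(c i)%:R / N.+1%:R - x i|))).
  apply: ler_sum => c _; rewrite -mulrBl normrM (ger0_norm (b0 c)).
  rewrite -mulr_sumr -mulr_sumr mulrCA mulrC; apply: ler_wpM2l => //.
  by apply: le_trans (lip _ _) _; under eq_bigr do rewrite distrC.
rewrite exchange_big /=.
apply: (@le_trans _ _ (\sum_(i < m) K * (eta + eta^-1 / N.+1%:R))); last first.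
  by rewrite sumr_const card_ord -[leLHS]mulr_natr mulrAC.
apply: ler_sum => i _; rewrite -mulr_sumr; apply: ler_wpM2l => //.
rewrite (bernstein_marginal _ _ _ (fun k => `|k%:R / N.+1%:R - x i|)).
exact: bernstein_abs_dev.
Qed.

End Bernstein.

(** * The algebra spanned by homomorphism densities *)

Section HomSpan.
Variable R : realType.
Implicit Types (h : mkernel R) (u : mkernel R -> R).

Definition t_of (M : any_multigraph) h : R := t_hom (projT2 M) h.

Definition any_union (M N : any_multigraph) : any_multigraph :=
  existT (fun k => multigraph k.+1) (projT1 M + (projT1 N).+1)%N
    (disjoint_union (projT2 M) (projT2 N)).

Lemma t_of_union M N h : plane_kernel h -> t_of (any_union M N) h = t_of M h * t_of N h.
Proof. by move=> ph; rewrite /t_of -(t_hom_disjoint_union _ _ ph). Qed.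

Definition hom_span u : Prop := exists s : seq (R * any_multigraph),
  forall h, plane_kernel h -> u h = \sum_(p <- s) p.1 * t_of p.2 h.

Lemma hom_span_t M : hom_span (t_of M).
Proof. by exists [:: (1, M)] => h _; rewrite big_seq1 mul1r. Qed.

Lemma hom_spanD u w : hom_span u -> hom_span w -> hom_span (fun h => u h + w h).
Proof. by move=> [s hs] [t ht]; exists (s ++ t) => h ph; rewrite big_cat hs // ht. Qed.

Lemma hom_spanM u w : hom_span u -> hom_span w -> hom_span (fun h => u h * w h).
Proof.
move=> [s hs] [t ht].
exists [seq (p.1 * q.1, any_union p.2 q.2) | p <- s, q <- t] => h ph.
rewrite hs // ht // big_allpairs_dep mulr_suml; apply: eq_bigr => p _.
rewrite mulr_sumr; apply: eq_bigr => q _.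
by rewrite /= t_of_union //; ring.
Qed.

Lemma hom_span_cst (a : R) : hom_span (fun=> a).
Proof.
exists [:: (a, existT (fun k => multigraph k.+1) 0%N (loops 0))] => h ph.
rewrite big_seq1 /t_of /= t_hom_loops //.
have -> : (fun v : 1.-tuple R => ktail h 0.*2 (tnth v ord0) (tnth v ord0)) = (fun=> 1).
  by apply/funext => v; exact: ktail0.
by rewrite rcube_cst mulr1.
Qed.

Lemma hom_span_sum (I : Type) (s : seq I) (f : I -> mkernel R -> R) :
  (forall i, hom_span (f i)) -> hom_span (fun h => \sum_(i <- s) f i h).
Proof.
move=> hf; elim: s => [|i s IH].
  by have [t ht] := hom_span_cst 0; exists t => h ph; rewrite big_nil; exact: ht.
have [t ht] := hom_spanD (hf i) IH; exists t => h ph; rewrite big_cons; exact: ht.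
Qed.

Lemma hom_span_prod (I : Type) (s : seq I) (f : I -> mkernel R -> R) :
  (forall i, hom_span (f i)) -> hom_span (fun h => \prod_(i <- s) f i h).
Proof.
move=> hf; elim: s => [|i s IH].
  by have [t ht] := hom_span_cst 1; exists t => h ph; rewrite big_nil; exact: ht.
have [t ht] := hom_spanM (hf i) IH; exists t => h ph; rewrite big_cons; exact: ht.
Qed.

Lemma hom_spanX u n : hom_span u -> hom_span (fun h => u h ^+ n).
Proof.
move=> hu; elim: n => [|n IH]; first by have [t ht] := hom_span_cst 1; exists t.
have [t ht] := hom_spanM hu IH; exists t => h ph; rewrite exprS; exact: ht.
Qed.

Lemma hom_span_bernstein N u i : hom_span u -> hom_span (fun h => bernstein N (u h) i).
Proof.
move=> hu; apply: hom_spanM; first apply: hom_spanM.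
- exact: hom_span_cst.
- exact: hom_spanX.
- apply: hom_spanX; apply: hom_spanD; first exact: hom_span_cst.
  have [t ht] := hom_spanM (hom_span_cst (-1)) hu.
  by exists t => h ph; rewrite -ht // mulN1r.
Qed.

End HomSpan.

Lemma separation_bound (R : realDomainType) (B x y u v e : R) :
  2 * B <= x -> x <= y -> 0 < e -> - B <= v -> u <= B -> u - e <= v + y.
Proof. lra. Qed.

(** * Weak convergence from convergence of expected densities *)

Section WeakConvergence.
Context (R : realType) d (Omega : measurableType d) (P : probability Omega R)
  d' (Omega' : measurableType d') (P' : probability Omega' R).
Variables (X : nat -> Omega -> mkernel R) (X' : Omega' -> mkernel R).
Hypotheses (X_plane : forall n w, plane_kernel (X n w))
           (X'_plane : forall w, plane_kernel (X' w)).
Hypothesis X_meas : forall M n, measurable_fun setT (fun w => t_of M (X n w)).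
Hypothesis X'_meas : forall M, measurable_fun setT (fun w => t_of M (X' w)).
Hypothesis t_cvg : forall M,
  \int[P]_w t_of M (X n w) @[n --> \oo] --> \int[P']_w t_of M (X' w).

Lemma t_of_itv M (h : mkernel R) : plane_kernel h -> 0 <= t_of M h <= 1.
Proof. by move=> ph; exact: (t_hom_itv (projT2 M) ph). Qed.

Lemma hom_span_bounded (u : mkernel R -> R) : hom_span u ->
  exists B, forall h, plane_kernel h -> `|u h| <= B.
Proof.
move=> [s hs]; exists (\sum_(p <- s) `|p.1|) => h ph; rewrite hs //.
apply: le_trans (ler_norm_sum _ _ _) _; apply: ler_sum => p _.
rewrite normrM; have /andP[t0 t1] := t_of_itv p.2 ph.
by apply: ler_piMr => //; rewrite ger0_norm.
Qed.

Lemma hom_span_measurable (u : mkernel R -> R) d0 (T0 : measurableType d0)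
    (Z : T0 -> mkernel R) : hom_span u -> (forall w, plane_kernel (Z w)) ->
  (forall M, measurable_fun setT (fun w => t_of M (Z w))) ->
  measurable_fun setT (fun w => u (Z w)).
Proof.
move=> [s hs] pZ mZ; under eq_fun do rewrite hs //.
by apply: measurable_sum => p; apply: measurable_funM.
Qed.

Lemma integrable_t_of d0 (T0 : measurableType d0) (Q : probability T0 R)
    (Z : T0 -> mkernel R) M : (forall w, plane_kernel (Z w)) ->
  (forall M, measurable_fun setT (fun w => t_of M (Z w))) ->
  Q.-integrable setT (EFin \o (fun w => t_of M (Z w))).
Proof.
move=> pZ mZ; apply: (bounded_integrable measurableT (probability_lty Q) (M := 1) (mZ M)) => w _.
by have /andP[t0 t1] := t_of_itv M (pZ w); rewrite ger0_norm.
Qed.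

Lemma hom_span_expectation (u : mkernel R -> R) (s : seq (R * any_multigraph))
    d0 (T0 : measurableType d0) (Q : probability T0 R)
    (Z : T0 -> mkernel R) :
  (forall h, plane_kernel h -> u h = \sum_(p <- s) p.1 * t_of p.2 h) ->
  (forall w, plane_kernel (Z w)) ->
  (forall M, measurable_fun setT (fun w => t_of M (Z w))) ->
  \int[Q]_w u (Z w) = \sum_(p <- s) p.1 * \int[Q]_w t_of p.2 (Z w).
Proof.
move=> hs pZ mZ.
transitivity (\int[Q]_w (\sum_(p <- s) p.1 * t_of p.2 (Z w))).
  by apply: eq_Rintegral => w _; exact: hs.
have it M := integrable_t_of Q M pZ mZ.
rewrite Rintegral_sum //.
  by apply: eq_bigr => p _; rewrite RintegralZl.
move=> p; have := integrableZl measurableT p.1 (it p.2).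
by apply: eq_integrable => // w _; rewrite /= EFinM.
Qed.

Lemma hom_span_cvg (u : mkernel R -> R) : hom_span u ->
  \int[P]_w u (X n w) @[n --> \oo] --> \int[P']_w u (X' w).
Proof.
move=> [s hs]; rewrite (hom_span_expectation P' hs X'_plane X'_meas).
rewrite [X in X @ _](_ : _ = fun n => \sum_(p <- s) p.1 * \int[P]_w t_of p.2 (X n w)).
  by apply: cvg_sumr => p _; apply: cvgM; [exact: cvg_cst|exact: t_cvg].
by apply/funext => n; exact: (hom_span_expectation P hs (X_plane n) (X_meas^~ n)).
Qed.

Definition hom_approx (u : mkernel R -> R) := forall e, 0 < e ->
  exists2 w, hom_span w & forall h, plane_kernel h -> `|u h - w h| <= e.

Lemma hom_approx_measurable (u : mkernel R -> R) d0 (T0 : measurableType d0)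
    (Z : T0 -> mkernel R) : hom_approx u -> (forall w, plane_kernel (Z w)) ->
  (forall M, measurable_fun setT (fun w => t_of M (Z w))) ->
  measurable_fun setT (fun w => u (Z w)).
Proof.
move=> hu pZ mZ.
have /choice[w hw] : forall k : nat, exists w, hom_span w /\
    forall h, plane_kernel h -> `|u h - w h| <= k.+1%:R^-1.
  by move=> k; have [|w w1 w2] := hu k.+1%:R^-1; [rewrite invr_gt0|exists w].
apply: (@measurable_fun_cvg _ _ _ _ (fun k x => w k (Z x))).
  by move=> k; apply: hom_span_measurable => //; case: (hw k).
move=> x _; apply/cvgrPdist_le => e e0; near=> k.
case: (hw k) => _ /(_ _ (pZ x)) /le_trans; apply.
by near: k; exact: (cvgr_le _ (@cvg_harmonic R) _ e0).
Unshelve. all: by end_near. Qed.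

Lemma hom_approx_bounded (u : mkernel R -> R) : hom_approx u ->
  exists B, forall h, plane_kernel h -> `|u h| <= B.
Proof.
move=> /(_ 1 ltr01)[w /hom_span_bounded[B hB] uw]; exists (1 + B) => h ph.
rewrite -(subrK (w h) (u h)); apply: le_trans (ler_normD _ _) _.
by apply: lerD; [exact: uw|exact: hB].
Qed.

Lemma hom_approx_cvg (u : mkernel R -> R) : hom_approx u ->
  \int[P]_w u (X n w) @[n --> \oo] --> \int[P']_w u (X' w).
Proof.
move=> hu; have [B hB] := hom_approx_bounded hu.
have close d0 (T0 : measurableType d0) (Q : probability T0 R) (Z : T0 -> mkernel R) v e :
    (forall w, plane_kernel (Z w)) ->
    (forall M, measurable_fun setT (fun w => t_of M (Z w))) ->
    hom_span v -> (forall h, plane_kernel h -> `|u h - v h| <= e) ->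
    `|\int[Q]_w u (Z w) - \int[Q]_w v (Z w)| <= e.
  move=> pZ mZ hv uv; have [C hC] := hom_span_bounded hv.
  have mu := hom_approx_measurable hu pZ mZ.
  have mv := hom_span_measurable hv pZ mZ.
  rewrite -RintegralB //.
  - have := Rintegral_bounded measurableT (probability_lty Q) (f := fun w => u (Z w) - v (Z w)) (a := - e) (b := e).
    rewrite [X in fine X]probability_setT /= !mulr1 -ler_norml; apply.
      exact: measurable_funB.
    by move=> w _; rewrite -ler_norml; exact: uv.
  - exact: (bounded_integrable measurableT (probability_lty Q) mu (fun w _ => hB _ (pZ w))).
  - exact: (bounded_integrable measurableT (probability_lty Q) mv (fun w _ => hC _ (pZ w))).
apply/cvgrPdist_lt => e e0; have e30 : 0 < e / 4 by rewrite divr_gt0.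
have [v hv uv] := hu _ e30.
have := hom_span_cvg hv; move/cvgrPdist_lt => /(_ _ e30) hn; near=> n.
have c1 := close _ _ P' X' v _ X'_plane X'_meas hv uv.
have c2 := close _ _ P (X n) v _ (X_plane n) (X_meas^~ n) hv uv.
have c3 : `|\int[P']_w v (X' w) - \int[P]_w v (X n w)| < e / 4 by near: n.
move: c1 c2 c3; set a := \int[P']_w u _; set b := \int[P]_w u _.
set a' := \int[P']_w v _; set b' := \int[P]_w v _ => c1 c2 c3.
have -> : a - b = (a - a') + (a' - b') - (b - b') by ring.
apply: le_lt_trans (ler_normB _ _) _.
apply: le_lt_trans (lerD (ler_normD _ _) (lexx _)) _; lra.
Unshelve. all: by end_near. Qed.

Variable F : nat -> any_multigraph.
Hypothesis F_enum : bijective F.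

Lemma lipschitz_hom_approx m (phi : ('I_m -> R) -> R) (K : R) : 0 <= K ->
  (forall y z, `|phi y - phi z| <= K * \sum_i `|y i - z i|) ->
  hom_approx (fun h => phi (fun i => t_of (F i) h)).
Proof.
move=> K0 lip e e0.
(* The Bernstein error is at most [A * (eta + eta) = e] as soon as N + 1 >= eta^-2; the added 1
   keeps [A] positive. *)
pose A := K * m%:R + 1; have A0 : 0 < A by rewrite ltr_wpDl // mulr_ge0.
pose eta := e / (2 * A); have eta0 : 0 < eta by rewrite divr_gt0 // mulr_gt0.
have [N hN] : exists N : nat, eta^-1 / N.+1%:R <= eta.
  have : N.+1%:R^-1 @[N --> \oo] --> (0 : R) by exact: cvg_harmonic.
  move=> /cvgr_le /(_ (eta ^+ 2)); rewrite exprn_gt0 // => /(_ isT)[N _ hN].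
  exists N; have := hN N (leqnn N); rewrite expr2 /= => h.
  by rewrite ler_pdivrMl.
exists (fun h => \sum_(c : {ffun 'I_m -> 'I_N.+2})
   phi (fun i => (c i)%:R / N.+1%:R) * \prod_(j < m) bernstein N.+1 (t_of (F j) h) (c j)).
  apply: hom_span_sum => c; apply: hom_spanM; first exact: hom_span_cst.
  by apply: hom_span_prod => j; apply: hom_span_bernstein; exact: hom_span_t.
move=> h ph; apply: le_trans (bernstein_lipschitz _ K0 eta0 lip _) _.
  by move=> i; exact: t_of_itv.
apply: (@le_trans _ _ (A * (eta + eta))).
  have eta0' := ltW eta0.
  apply: ler_pM; [exact: mulr_ge0| | by rewrite /A lerDl | by rewrite lerD2l].
  by rewrite addr_ge0 // divr_ge0 // invr_ge0.
rewrite -mulr2n -[eta *+ 2]mulr_natr /eta le_eqVlt; apply/orP; left; apply/eqP.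
by field; rewrite gt_eqF.
Qed.

Section Regularisation.
Variables (f : mkernel R -> R) (B : R).
Hypothesis f_test : ms_test F f.
Hypothesis f_bound : forall h, plane_kernel h -> `|f h| <= B.
Variable h0 : mkernel R.
Hypothesis h0_plane : plane_kernel h0.

(* Lipschitz regularisation of f in the first m homomorphism densities. *)
Definition reg_set m (x : 'I_m -> R) : set R :=
  [set f h + m%:R * \sum_i `|x i - t_of (F i) h| | h in plane_kernel (R := R)].

Definition reg m (x : 'I_m -> R) : R := inf (reg_set x).

Lemma reg_has_inf m (x : 'I_m -> R) : has_inf (reg_set x).
Proof.
split; first by exists (f h0 + m%:R * \sum_i `|x i - t_of (F i) h0|), h0.
exists (- B) => _ [h ph <-]; apply: (@le_trans _ _ (f h)).
  by have := f_bound ph; rewrite ler_norml => /andP[].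
by rewrite lerDl mulr_ge0 // sumr_ge0.
Qed.

Lemma reg_le m (x : 'I_m -> R) h : plane_kernel h ->
  reg x <= f h + m%:R * \sum_i `|x i - t_of (F i) h|.
Proof. by move=> ph; apply: ge_inf; [case: (reg_has_inf x)|exists h]. Qed.

Lemma reg_ge m (x : 'I_m -> R) (c : R) :
  (forall h, plane_kernel h -> c <= f h + m%:R * \sum_i `|x i - t_of (F i) h|) ->
  c <= reg x.
Proof.
by move=> hc; apply: lb_le_inf; [case: (reg_has_inf x)|move=> _ [h ph <-]; exact: hc].
Qed.

Lemma reg_lipschitz m (x y : 'I_m -> R) :
  `|reg x - reg y| <= m%:R * \sum_i `|x i - y i|.
Proof.
have one (u v : 'I_m -> R) : reg u - m%:R * \sum_i `|u i - v i| <= reg v.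
  apply: reg_ge => h ph; rewrite lerBlDr; apply: le_trans (reg_le u ph) _.
  rewrite -addrA lerD2l -mulrDr ler_wpM2l // -big_split /=; apply: ler_sum => i _.
  by rewrite -(subrKA (v i)) addrC ler_normD.
rewrite ler_distl; apply/andP; split.
  by have := one y x; under eq_bigr do rewrite distrC.
by have := one x y; rewrite lerBlDr.
Qed.

Lemma reg_le_test m h : plane_kernel h -> reg (fun i : 'I_m => t_of (F i) h) <= f h.
Proof.
move=> ph; apply: le_trans (reg_le _ ph) _.
by rewrite big1 ?mulr0 ?addr0 // => i _; rewrite subrr normr0.
Qed.

Lemma reg_bounded m h : plane_kernel h -> `|reg (fun i : 'I_m => t_of (F i) h)| <= B.
Proof.
move=> ph; rewrite ler_norml; apply/andP; split; last first.
  by apply: le_trans (reg_le_test m ph) _; have := f_bound ph; rewrite ler_norml => /andP[].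
apply: reg_ge => h' ph'; apply: (@le_trans _ _ (f h')).
  by have := f_bound ph'; rewrite ler_norml => /andP[].
by rewrite lerDl mulr_ge0 // sumr_ge0.
Qed.

(** A competitor [h'] that is close to [h] in the first [N] densities has [f h'] within [e] of
    [f h]; any other one pays a penalty of at least [m * delta], which for large m exceeds the
    oscillation [2 * B] of [f]. *)
Lemma reg_cvg h : plane_kernel h ->
  reg (fun i : 'I_m => t_of (F i) h) @[m --> \oo] --> f h.
Proof.
move=> ph; apply/cvgrPdist_le => e e0.
have [N [delta d0 hN]] := ms_test_continuous F_enum f_test ph e0.
have B0 : 0 <= B by apply: le_trans (f_bound ph).
near=> m.
have Nm : (N <= m)%N by near: m; exact: nbhs_infty_ge.
have md : 2 * B <= m%:R * delta.
  rewrite -ler_pdivrMr //; near: m; exact: nbhs_infty_ger.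
rewrite ler_distlC; apply/andP; split; last first.
  by apply: le_trans (reg_le_test m ph) _; rewrite lerDl ltW.
apply: reg_ge => h' ph'; set S := \sum_i _.
have [close|far] := pselect (forall i, (i < N)%N -> `|t_of (F i) h - t_of (F i) h'| < delta).
  have := hN h' ph' close; rewrite ltr_norml => /andP[_ h1].
  have : 0 <= m%:R * S by rewrite mulr_ge0 // sumr_ge0.
  lra.
have [i iN hi] : exists2 i, (i < N)%N & delta <= `|t_of (F i) h - t_of (F i) h'|.
  apply: contrapT => no; apply: far => i iN; rewrite ltNge; apply/negP => hi.
  by apply: no; exists i.
have dS : delta <= S.
  rewrite /S (bigD1 (Ordinal (leq_trans iN Nm))) //=.
  by apply: le_trans hi _; rewrite lerDl sumr_ge0.
have mS : m%:R * delta <= m%:R * S by rewrite ler_wpM2l.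
have := f_bound ph; have := f_bound ph'; rewrite !ler_norml => /andP[a1 _] /andP[_ b2].
exact: (separation_bound md mS e0 a1 b2).
Unshelve. all: by end_near. Qed.

(** Kernels carry no sigma-algebra, so continuity of [f] alone says nothing about its composition
    with a random kernel. The regularisations are functions of finitely many measurable densities,
    and [f] is their pointwise limit. *)
Lemma test_measurable d0 (T0 : measurableType d0) (Z : T0 -> mkernel R) :
  (forall w, plane_kernel (Z w)) ->
  (forall M, measurable_fun setT (fun w => t_of M (Z w))) ->
  measurable_fun setT (fun w => f (Z w)).
Proof.
move=> pZ mZ.
apply: (@measurable_fun_cvg _ _ _ _ (fun m w => reg (fun i : 'I_m => t_of (F i) (Z w)))).
  move=> m; apply: (@hom_approx_measurable (fun h => reg (fun i : 'I_m => t_of (F i) h))) => //.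
  by apply: (@lipschitz_hom_approx m _ m%:R) => // y z; exact: reg_lipschitz.
by move=> w _; exact: reg_cvg.
Qed.

Lemma test_liminf (e : R) : 0 < e ->
  \forall n \near \oo, \int[P']_w f (X' w) - e <= \int[P]_w f (X n w).
Proof.
move=> e0; have e20 : 0 < e / 2 by rewrite divr_gt0.
have mf' := test_measurable X'_plane X'_meas.
have apx m : hom_approx (fun h => reg (fun i : 'I_m => t_of (F i) h)).
  by apply: (@lipschitz_hom_approx m _ m%:R) => // y z; exact: reg_lipschitz.
have c1 : \int[P']_w reg (fun i : 'I_m => t_of (F i) (X' w)) @[m --> \oo] -->
    \int[P']_w f (X' w).
  apply: (@Rintegral_bounded_cvg _ _ R P' setT measurableT (probability_lty P')
    (fun m w => reg (fun i : 'I_m => t_of (F i) (X' w))) _ B).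
  - by move=> m; exact: (hom_approx_measurable (apx m)).
  - by move=> m w _; exact: reg_bounded.
  - by move=> w _; exact: reg_cvg.
have [m _ /(_ m (leqnn m)) /= hm] := cvgr_ge _ c1 _ (ltac:(by rewrite ltrBlDr ltrDl; exact: e20)
   : \int[P']_w f (X' w) - e / 2 < \int[P']_w f (X' w)).
have c2 := hom_approx_cvg (apx m).
have lt2 : \int[P']_w reg (fun i : 'I_m => t_of (F i) (X' w)) - e / 2 <
   \int[P']_w reg (fun i : 'I_m => t_of (F i) (X' w)) by rewrite ltrBlDr ltrDl.
apply: (filterS _ (cvgr_ge _ c2 _ lt2)) => n /= hn.
apply: (@le_trans _ _ (\int[P]_w reg (fun i : 'I_m => t_of (F i) (X n w)))); first by lra.
have mf := test_measurable (X_plane n) (X_meas^~ n).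
apply: le_Rintegral => //.
- apply: (bounded_integrable measurableT (probability_lty P) (M := B)) => [|w _]; last exact: reg_bounded.
  exact: (hom_approx_measurable (apx m)).
- by apply: (bounded_integrable measurableT (probability_lty P) (M := B)) => // w _; exact: f_bound.
- by move=> w _; exact: reg_le_test.
Qed.

End Regularisation.

Lemma ms_test_cvg f : ms_test F f ->
  \int[P]_w f (X n w) @[n --> \oo] --> \int[P']_w f (X' w).
Proof.
move=> ft; have [fq [B hB] fc] := ft.
have fB h : plane_kernel h -> `|f h| <= B by move=> ph; apply/hB/plane_kernel_multigraphon.
have nft : ms_test F (fun h => - f h).
  split=> [h h' mh mh' hh'|| h mh e e0]; first by rewrite (fq _ _ mh mh' hh').
    by exists B => h mh; rewrite normrN; exact: hB.
  have [delta d0 hd] := fc h mh e e0; exists delta => // h' mh' dh.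
  by rewrite -opprD normrN; exact: hd.
have nfB h : plane_kernel h -> `|- f h| <= B by move=> ph; rewrite normrN; exact: fB.
(* A probability space has an outcome, which supplies the kernel that makes [reg_set] nonempty. *)
have [w0] : exists w : Omega', True.
  apply: contrapT => no; have : P' setT = 0%E.
    rewrite (_ : setT = set0) ?measure0 //; apply/seteqP; split => // w _.
    by apply: no; exists w.
  by rewrite probability_setT => /eqP; rewrite onee_eq0.
move=> _; have p0 := X'_plane w0.
have opp d0 (T0 : measurableType d0) (Q : probability T0 R) (Z : T0 -> mkernel R) :
    (forall w, plane_kernel (Z w)) ->
    (forall M, measurable_fun setT (fun w => t_of M (Z w))) ->
    \int[Q]_w (- f (Z w)) = - \int[Q]_w f (Z w).
  move=> pZ mZ; under eq_Rintegral do rewrite -mulN1r.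
  rewrite RintegralZl ?mulN1r //.
  apply: (bounded_integrable measurableT (probability_lty Q) (M := B)) => [|w _].
    exact: (test_measurable ft fB p0).
  exact: fB.
apply/cvgrPdist_le => e e0; near=> n.
have l1 : \int[P']_w f (X' w) - e <= \int[P]_w f (X n w).
  by near: n; exact: (test_liminf ft fB p0 e0).
have : \int[P']_w (- f (X' w)) - e <= \int[P]_w (- f (X n w)).
  by near: n; exact: (test_liminf nft nfB p0 e0).
rewrite (opp _ _ _ _ X'_plane X'_meas) (opp _ _ _ _ (X_plane n) (X_meas^~ n)) => l2.
by rewrite ler_distlC; apply/andP; split; lra.
Unshelve. all: by end_near. Qed.

End WeakConvergence.

(** * The Poisson kernel *)

Section PoissonHomRegularity.
Variable R : realType.

Lemma continuous_poisson_p r : continuous (@poisson_p R r).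
Proof.
move=> l; rewrite /poisson_p; apply: cvgM; last exact: cvg_cst.
apply: cvgM; last exact: exprn_continuous.
by apply: continuous_comp; [exact: opp_continuous|exact: continuous_expR].
Qed.

Lemma continuous_poisson_tail a : continuous (@poisson_tail R a).
Proof.
move=> l; rewrite /poisson_tail; apply: cvgB; first exact: cvg_cst.
by apply: cvg_sumr => i _; exact: continuous_poisson_p.
Qed.

Lemma continuous_pos : continuous (@pos R).
Proof.
by move=> x; rewrite /pos; apply: continuous_max; [exact: cvg_cst|exact: cvg_id].
Qed.

Lemma cvg_poisson_hom (T : Type) (G : set_system T) (FG : Filter G) k (F : 'M[nat]_k)
    (z_ : T -> 'I_k -> R) (z : 'I_k -> R) (y_ : T -> R) (y : R) :
  (forall a, pos (z_ t a) @[t --> G] --> pos (z a)) ->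
  pos (y_ t) @[t --> G] --> pos y ->
  poisson_hom F (z_ t) (y_ t) @[t --> G] --> poisson_hom F z y.
Proof.
move=> zz yy; apply: cvg_prodr => a _; apply: cvg_prodr => b _.
case: (a == b).
  apply: continuous_cvg; first exact: continuous_poisson_tail.
  apply: cvgM; last exact: cvg_cst.
  by apply: cvgM => //; rewrite expr2; under eq_fun do rewrite expr2; exact: cvgM.
apply: continuous_cvg; first exact: continuous_poisson_tail.
by apply: cvgM => //; exact: cvgM.
Qed.

Lemma measurable_poisson_hom d (T : measurableType d) k (F : 'M[nat]_k)
    (z : T -> 'I_k -> R) (y : T -> R) :
  (forall a, measurable_fun setT (fun t => pos (z t a))) ->
  measurable_fun setT (fun t => pos (y t)) ->
  measurable_fun setT (fun t => poisson_hom F (z t) (y t)).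
Proof.
move=> mz my; apply: measurable_prod => a _; apply: measurable_prod_cond => b _.
have mt n : measurable_fun setT (@poisson_tail R n).
  by apply: continuous_measurable_fun; exact: continuous_poisson_tail.
case: (a == b); apply: (measurableT_comp (mt _)).
  by apply: measurable_funM => //; apply: measurable_funM => //; exact: measurable_funX.
by apply: measurable_funM => //; exact: measurable_funM.
Qed.

Lemma measurable_pos d (T : measurableType d) (z : T -> R) :
  measurable_fun setT z -> measurable_fun setT (fun t => pos (z t)).
Proof.
move=> mz; apply: (measurableT_comp (f := @pos R)) => //.
by apply: continuous_measurable_fun; exact: continuous_pos.
Qed.

End PoissonHomRegularity.

Section PoissonKernel.
Variable R : realType.
Implicit Types (y : R) (q : R -> R).

(* cm_limit with the density and the quantile function clipped at 0. *)
Definition poisson_kernel y q : mkernel R := fun r a b =>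
  if a != b then poisson_p r (pos y * pos (q a) * pos (q b))
  else if ~~ odd r then poisson_p r./2 (pos y * pos (q a) ^+ 2 / 2) else 0.

Lemma poisson_p_ge0 r (l : R) : 0 <= l -> 0 <= poisson_p r l.
Proof. by move=> l0; rewrite /poisson_p divr_ge0 // mulr_ge0 ?expR_ge0 ?exprn_ge0. Qed.

Lemma poisson_series_cvg (l : R) : series (fun r => poisson_p r l) @ \oo --> (1 : R).
Proof.
have -> : series (fun r => poisson_p r l) = fun n => expR (- l) * series (exp_coeff l) n.
  by apply/funext => n; rewrite /series /= mulr_sumr; apply: eq_bigr => r _; rewrite /poisson_p mulrA.
rewrite -(expR0 R) -(addNr l) expRD; apply: cvgM; [exact: cvg_cst|exact: cvg_exp_series].
Qed.

Lemma sum_even_layers (p : nat -> R) m :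
  \sum_(r < m) (if ~~ odd r then p r./2 else 0) = \sum_(r < uphalf m) p r.
Proof.
elim: m => [|m IH]; first by rewrite !big_ord0.
rewrite big_ord_recr /= IH uphalf_half.
by case: ifP => [/negbTE ->|/negbFE ->]; rewrite ?add0n ?add1n ?big_ord_recr //= addr0.
Qed.

Lemma poisson_kernel_diag y q r x : poisson_kernel y q r x x =
  if ~~ odd r then poisson_p r./2 (pos y * pos (q x) ^+ 2 / 2) else 0.
Proof. by rewrite /poisson_kernel eqxx. Qed.

Lemma ktail_poisson_kernel y q a u v : u != v ->
  ktail (poisson_kernel y q) a u v = poisson_tail a (pos y * pos (q u) * pos (q v)).
Proof.
by move=> uv; rewrite /ktail /poisson_tail; congr (_ - _); apply: eq_bigr => r _;
  rewrite /poisson_kernel uv.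
Qed.

Lemma ktail_poisson_kernel_diag y q a u : ~~ odd a ->
  ktail (poisson_kernel y q) a u u = poisson_tail a./2 (pos y * pos (q u) ^+ 2 / 2).
Proof.
move=> ea; rewrite /ktail /poisson_tail; congr (_ - _).
under eq_bigr do rewrite poisson_kernel_diag.
rewrite (sum_even_layers (fun r => poisson_p r (pos y * pos (q u) ^+ 2 / 2))).
by rewrite uphalf_half (negbTE ea).
Qed.

Lemma poisson_kernel_plane y q : measurable_fun setT (fun x => pos (q x)) ->
  plane_kernel (poisson_kernel y q).
Proof.
move=> mq; have mp r : measurable_fun setT (@poisson_p R r).
  by apply: continuous_measurable_fun; exact: continuous_poisson_p.
have off0 u v : 0 <= pos y * pos (q u) * pos (q v) by rewrite !mulr_ge0 ?pos_ge0.
have diag0 u : 0 <= pos y * pos (q u) ^+ 2 / 2 by rewrite !mulr_ge0 ?exprn_ge0 ?pos_ge0.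
split.
- move=> r.
  pose A (z : R * R) := poisson_p r (pos y * pos (q z.1) * pos (q z.2)).
  pose B (z : R * R) := if ~~ odd r then poisson_p r./2 (pos y * pos (q z.1) ^+ 2 / 2) else 0.
  (* The kernel is the off-diagonal formula corrected on the diagonal, a measurable set as the zero
     set of a difference. *)
  pose Delta := (fun z : R * R => z.1 - z.2) @^-1` [set 0].
  have mDelta : measurable Delta.
    by rewrite -[Delta]setTI; apply: measurable_funB.
  have mq1 : measurable_fun setT (fun z : R * R => pos (q z.1)).
    exact: (measurableT_comp mq).
  have mq2 : measurable_fun setT (fun z : R * R => pos (q z.2)).
    exact: (measurableT_comp mq).
  have mA : measurable_fun setT A.
    by apply: (measurableT_comp (mp r)); apply: measurable_funM => //; exact: measurable_funM.
  have mB : measurable_fun setT B.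
    rewrite /B; case: (~~ odd r) => //; apply: (measurableT_comp (mp r./2)).
    by apply: measurable_funM => //; apply: measurable_funM => //; exact: measurable_funX.
  have -> : (fun z : R * R => poisson_kernel y q r z.1 z.2) =
      (fun z => A z + (B z - A z) * \1_Delta z).
    apply/funext => -[u v]; rewrite /poisson_kernel /= indicE.
    have [<-|uv] := eqVneq u v.
      by rewrite mem_set /Delta /= ?subrr // mulr1 addrC subrK.
    rewrite memNset ?mulr0 ?addr0 // /Delta /= => /eqP; by rewrite subr_eq0 (negbTE uv).
  apply: measurable_funD => //; apply: measurable_funM; first exact: measurable_funB.
  exact: measurable_indic.
- move=> r u v; rewrite /poisson_kernel; case: ifP => _; first exact: poisson_p_ge0.
  by case: ifP => _ //; exact: poisson_p_ge0.
- move=> r u v; rewrite /poisson_kernel [v == u]eq_sym; case: eqP => [->|_] //=.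
  by rewrite mulrAC.
- move=> u v; have [<-|uv] := eqVneq u v; last first.
    have -> : (fun r => poisson_kernel y q r u v) =
      (fun r => poisson_p r (pos y * pos (q u) * pos (q v))).
      by apply/funext => r; rewrite /poisson_kernel uv.
    exact: poisson_series_cvg.
  (* On the diagonal only even layers contribute, so among the first m layers exactly [uphalf m]
     Poisson weights are present. *)
  have -> : series (fun r => poisson_kernel y q r u u) =
      series (fun r => poisson_p r (pos y * pos (q u) ^+ 2 / 2)) \o uphalf.
    apply/funext => m; rewrite /series /= !big_mkord.
    under eq_bigr do rewrite poisson_kernel_diag.
    exact: (sum_even_layers (fun r => poisson_p r (pos y * pos (q u) ^+ 2 / 2))).
  apply: cvg_comp (poisson_series_cvg _).
  move=> A [N _ hN]; exists N.*2 => // m /= Nm; apply: hN => /=.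
  by rewrite -(doubleK N) uphalf_half; apply: leq_trans (leq_addl _ _); exact: half_leq.
- by move=> r u; rewrite poisson_kernel_diag /= odd_double.
Qed.

(** [poisson_hom] tells loops from edges by equality of indices, the kernel by equality of points.
    The two agree at points with distinct coordinates, hence almost everywhere. *)
Lemma t_hom_poisson_kernel k (F : multigraph k) y q :
  measurable_fun setT (fun x => pos (q x)) ->
  t_hom F (poisson_kernel y q) =
  rcube (fun v : k.-tuple R => poisson_hom (val F) (fun a => q (tnth v a)) y).
Proof.
move=> mq; have ph := poisson_kernel_plane y mq; rewrite t_homE //.
apply: (@rcube_ae _ _ 1 _ _ [::]); first exact: bmeas_hom_integrand.
  apply: unit_bmeas => [|v]; last exact: poisson_hom_itv.
  apply: measurable_poisson_hom => // a.
  by apply: (measurableT_comp mq); exact: measurable_tnth.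
move=> v uv _; rewrite /hom_integrand /poisson_hom.
apply: eq_bigr => i _; apply: eq_bigr => j _.
have [<-|ij] := eqVneq i j.
  by rewrite ktail_poisson_kernel_diag //; case/andP: (valP F) => _ /forallP/(_ i).
rewrite ktail_poisson_kernel //; apply: contra ij => /eqP e.
by apply/eqP/(tuple_uniqP _ uv).
Qed.

End PoissonKernel.

(** * The quantile function of a distribution function *)

Section Quantile.
Variables (R : realType) (Psi : cumulativeBounded (0 : R) (1 : R)).

Lemma quantile_le (x t : R) : 0 < x < 1 -> (quantile Psi x <= t) = (x <= Psi t).
Proof.
move=> /andP[x0 x1]; set S := [set y | x <= Psi y].
have ndP := cumulative_is_nondecreasing Psi.
have Slb : has_lbound S.
  have [M [_ hM]] := cvgr_lt _ (cumulativeNy Psi) _ x0.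
  exists (M - 1) => y Sy; rewrite leNgt; apply/negP => yM.
  have := hM (M - 1); rewrite ltrBlDr ltrDl ltr01 => /(_ isT).
  by apply/negP; rewrite -leNgt; apply: le_trans Sy _; apply: ndP; exact: ltW.
have Sne : S !=set0.
  have [M [_ hM]] := cvgr_gt _ (cumulativey Psi) _ x1.
  by exists (M + 1); apply/ltW/hM; rewrite ltrDl.
apply/idP/idP => [qt|xt]; last exact: ge_inf.
apply: (cvgr_to_ge (cumulative_is_right_continuous Psi t)).
near=> u; have tu : t < u by [].
have [v Sv vu] : exists2 v, S v & v < u.
  by have [v Sv vu] := @inf_adherent _ S (u - inf S) (ltac:(by rewrite subr_gt0; exact: le_lt_trans tu)) (conj Sne Slb); exists v => //; move: vu; rewrite addrC subrK.
by apply: le_trans Sv _; apply: ndP; exact: ltW.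
Unshelve. all: by end_near. Qed.

Lemma cumulativeBounded_itv y : 0 <= Psi y <= 1.
Proof.
apply/andP; split.
  apply: (cvgr_to_le (cumulativeNy Psi)); near=> u.
  apply: cumulative_is_nondecreasing; near: u; exact: nbhs_ninfty_le.
apply: (cvgr_to_ge (cumulativey Psi)); near=> u.
apply: cumulative_is_nondecreasing; near: u; exact: nbhs_pinfty_ge.
Unshelve. all: by end_near. Qed.

(** On ]0, 1[ the superlevel set of r is the part above [Psi r], by [quantile_le]. For x <= 0 the
    set has no lower bound and for x > 1 it is empty, so [inf] takes its default value 0; the point
    1 is a single value. *)
Lemma measurable_quantile : measurable_fun setT (quantile Psi).
Proof.
have P01 := cumulativeBounded_itv.
have low x : x <= 0 -> quantile Psi x = 0.
  move=> x0; rewrite /quantile (_ : [set y | _] = setT) ?inf_out //.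
    by move=> [_ [b hb]]; have := hb (b - 1) I; rewrite lerBrDr gerDl ler10.
  apply/seteqP; split => // y _ /=; apply: le_trans x0 _; by case/andP: (P01 y).
have high x : 1 < x -> quantile Psi x = 0.
  move=> x1; rewrite /quantile (_ : [set y | _] = set0) ?inf0 //.
  apply/seteqP; split => // y /= xy; move: x1; rewrite ltNge.
  by rewrite (le_trans xy) //; case/andP: (P01 y).
have -> : [set: R] = `]-oo, 0] `|` `]0, 1[ `|` ([set 1] `|` `]1, +oo[).
  apply/seteqP; split => // x _ /=; rewrite !in_itv /= andbT.
  have [x0|x0] := leP x 0; first by left; left.
  have [x1|x1|->] := ltgtP x 1; [by left; right|by right; right|by right; left].
apply/measurable_funU => //; first exact: measurableU.
  exact: measurableU.
split; apply/measurable_funU => //; split.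
- apply: (@eq_measurable_fun _ _ _ _ _ (cst 0 : R -> R)) => // x; rewrite inE /= in_itv /= => x0; by rewrite low.
- apply: (measurability (@RGenOInfty.G R)) => [|/= _ [_] [r] -> <-].
    exact: RGenOInfty.measurableE.
  rewrite (_ : _ `&` _ = `]0, 1[ `&` `]Psi r, +oo[) //; last first.
    have e x : 0 < x < 1 -> (r < quantile Psi x) = (Psi r < x).
      by move=> x01; rewrite !ltNge quantile_le.
    apply/seteqP; split => x /=; rewrite !in_itv /= !andbT => -[x01 h]; split => //.
      by rewrite -e.
    by rewrite e.
  exact: measurableI.
- exact: measurable_fun_set1.
- apply: (@eq_measurable_fun _ _ _ _ _ (cst 0 : R -> R)) => // x; rewrite inE /= in_itv /= andbT => x0; by rewrite high.
Qed.

(** Inverse transform sampling: by [quantile_le] the sublevel set is the interval [0, Psi t] up to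
    the endpoints 0 and 1, a null set. *)
Lemma quantile_sublevel_measure (t : R) :
  fine (lebesgue_measure (`[0, 1] `&` [set x | quantile Psi x <= t])) = Psi t.
Proof.
have P01 : 0 <= Psi t <= 1 by exact: cumulativeBounded_itv.
have mA : measurable (`[0, 1]%classic `&` [set x | quantile Psi x <= t] : set R).
  apply: measurableI => //; rewrite -[X in measurable X]setTI.
  rewrite (_ : [set x | _] = quantile Psi @^-1` `]-oo, t]); last first.
    by apply/seteqP; split => x /=; rewrite in_itv.
  exact: measurable_quantile.
have m2 : measurable ([set 0; 1] : set R) by exact: measurableU.
have null2 : lebesgue_measure ([set 0; 1] : set R) = 0%E.
  by apply: countable_lebesgue_measure0; exact: finite_set_countable.
have m0P : lebesgue_measure (`[0, Psi t]%classic : set R) = (Psi t)%:E.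
  case/andP: P01 => P0 P1; rewrite lebesgue_measure_itv /= lte_fin oppr0 adde0.
  by case: ltP => // Pt; apply/esym/eqP; rewrite eqe eq_le Pt.
suff -> : lebesgue_measure (`[0, 1] `&` [set x | quantile Psi x <= t]) =
   lebesgue_measure (`[0, Psi t]%classic : set R) by rewrite m0P.
have sub1 : `[0, 1] `&` [set x | quantile Psi x <= t] `<=` `[0, Psi t] `|` [set 0; 1].
  move=> x /=; rewrite !in_itv /= => -[/andP[x0 x1] xt].
  have [->|xn0] := eqVneq x 0; first by right; left.
  have [->|xn1] := eqVneq x 1; first by right; right.
  left; rewrite x0 /= -quantile_le // lt_neqAle eq_sym xn0 x0 /=.
  by rewrite lt_neqAle xn1.
have sub2 : `[0, Psi t] `<=` (`[0, 1] `&` [set x | quantile Psi x <= t]) `|` [set 0; 1].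
  move=> x /=; rewrite !in_itv /= => /andP[x0 xt].
  have x1 : x <= 1 by apply: le_trans xt _; case/andP: P01.
  have [->|xn0] := eqVneq x 0; first by right; left.
  have [->|xn1] := eqVneq x 1; first by right; right.
  left; rewrite x0 x1; split => //; rewrite quantile_le // lt_neqAle eq_sym xn0 x0 /=.
  by rewrite lt_neqAle xn1.
have le_mod (A B : set R) : measurable A -> measurable B -> A `<=` B `|` [set 0; 1] ->
    (lebesgue_measure A <= lebesgue_measure B)%E.
  move=> mA' mB AB; apply: (@le_trans _ _ (lebesgue_measure (B `|` [set 0; 1]))).
    by apply: le_measure => //; rewrite inE //; exact: measurableU.
  apply: (@le_trans _ _ (lebesgue_measure B + lebesgue_measure [set 0%R; 1%R])%E).
    exact: measureU2.
  by rewrite [X in (_ + X)%E]null2 adde0.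
by apply/eqP; rewrite eq_le; apply/andP; split; apply: le_mod.
Qed.

End Quantile.

(** * Conditional independence given the density *)

Lemma measurable_finite_range d (T : measurableType d) (R : realType) (I : finType)
    (c : T -> I) (f : I -> R) : (forall i, measurable (c @^-1` [set i])) ->
  measurable_fun setT (fun x => f (c x)).
Proof.
move=> mc; have -> : (fun x => f (c x)) = (fun x => \sum_i f i * \1_(c @^-1` [set i]) x).
  apply/funext => x; rewrite (bigD1 (c x)) //= indicE mem_set // mulr1 big1 ?addr0 //.
  by move=> i ic; rewrite indicE memNset ?mulr0 // => /= e; rewrite e eqxx in ic.
apply: measurable_sum => i; exact: measurable_funM.
Qed.

Lemma Rintegral_finite_partition d (T : measurableType d) (R : realType)
    (P : probability T R) (I : finType) (c : T -> I) (f : I -> R) (h : T -> R) (M : R) :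
  (forall i, measurable (c @^-1` [set i])) -> measurable_fun setT h ->
  (forall x, `|h x| <= M) ->
  \int[P]_x (f (c x) * h x) = \sum_i f i * \int[P]_(x in c @^-1` [set i]) h x.
Proof.
move=> mc mh hM.
have -> : (fun x => f (c x) * h x) =
    (fun x => \sum_i f i * (h \_ (c @^-1` [set i])) x).
  apply/funext => x; rewrite (bigD1 (c x)) //= patchE mem_set // big1 ?addr0 //.
  by move=> i ic; rewrite patchE memNset ?mulr0 // => /= e; rewrite e eqxx in ic.
have it i : P.-integrable setT (EFin \o (h \_ (c @^-1` [set i]))).
  apply: (bounded_integrable measurableT (probability_lty P) (M := `|M|)).
    by apply/measurable_restrict => //; rewrite setTI; exact: measurable_funTS.
  move=> x _; rewrite patchE; case: ifP => _; last by rewrite normr0.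
  by apply: le_trans (hM x) _; exact: ler_norm.
rewrite Rintegral_sum //; last first.
  move=> i; have := integrableZl measurableT (f i) (it i).
  by apply: eq_integrable => // x _; rewrite /= EFinM.
by apply: eq_bigr => i _; rewrite RintegralZl // -Rintegral_mkcond.
Qed.

(** * Rounding to a finite grid *)

Section Cells.
Variable R : realType.
Implicit Types (N : nat) (z : R).

(* Upper rounding to the grid {j / (N + 1) : j <= (N + 1)^2}. *)
Definition cell N z : 'I_(N.+1 * N.+1).+1 :=
  inord (minn (N.+1 * N.+1) `|Num.ceil (N.+1%:R * pos z)|).

Definition cell_value N (i : 'I_(N.+1 * N.+1).+1) : R := i%:R / N.+1%:R.

Lemma cellE N z : cell N z = minn (N.+1 * N.+1) `|Num.ceil (N.+1%:R * pos z)| :> nat.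
Proof. by rewrite inordK // ltnS geq_minl. Qed.

Lemma ceil_pos_abs N z : (`|Num.ceil (N.+1%:R * pos z)|%N)%:Z = Num.ceil (N.+1%:R * pos z).
Proof.
by rewrite gez0_abs // ceil_ge0; apply: lt_le_trans (_ : 0 <= _); rewrite ?mulr_ge0 ?pos_ge0 // ltrN10.
Qed.

(** Rounding up makes the event that the cell is at most j a closed half-line in z, whose
    conditional probability is a value of the distribution function. The last cell is excluded, as
    it collects all larger values. *)
Lemma cell_le N z (j : nat) : (j < N.+1 * N.+1)%N ->
  (cell N z <= j)%N = (z <= j%:R / N.+1%:R).
Proof.
move=> jM; rewrite cellE geq_min leqNgt jM /= -lez_nat ceil_pos_abs ceil_le_int.
rewrite ler_pdivlMr // mulrC; have j0 : 0 <= j%:R / N.+1%:R :> R by rewrite divr_ge0.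
by rewrite -!ler_pdivlMr // /pos ge_max j0.
Qed.

Lemma cell_top N z (j : nat) : (N.+1 * N.+1 <= j)%N -> (cell N z <= j)%N.
Proof. by move=> jM; apply: leq_trans jM; rewrite -ltnS. Qed.

(** The grid becomes finer and at the same time reaches up to N + 1, so the cap eventually lies
    above any fixed z. *)
Lemma cell_value_cvg z : pos (cell_value (cell N z)) @[N --> \oo] --> pos z.
Proof.
apply/cvgrPdist_le => e e0; near=> N.
have N0 : 0 < N.+1%:R :> R by rewrite ltr0n.
rewrite [pos (cell_value _)]pos_id ?divr_ge0 // /cell_value cellE.
have zN : pos z <= N.+1%:R.
  by apply: (@le_trans _ _ N%:R); [near: N; exact: nbhs_infty_ger|rewrite ler_nat].
have -> : minn (N.+1 * N.+1) `|Num.ceil (N.+1%:R * pos z)| = `|Num.ceil (N.+1%:R * pos z)|%N.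
  apply/minn_idPr; rewrite -lez_nat ceil_pos_abs ceil_le_int.
  by rewrite -[(_ * _)%N%:Z%:~R]/((N.+1 * N.+1)%:R) natrM ler_pM2l.
have -> : (`|Num.ceil (N.+1%:R * pos z)|%N)%:R = (Num.ceil (N.+1%:R * pos z))%:~R :> R.
  by rewrite -ceil_pos_abs.
have /andP[c1 c2] := ceil_itv (N.+1%:R * pos z).
have h : N.+1%:R^-1 <= e by near: N; exact: (cvgr_le _ (@cvg_harmonic R) _ e0).
rewrite ler_distlC; apply/andP; split.
  rewrite ler_pdivlMr // mulrC mulrBr; apply: le_trans c2; rewrite gerBl.
  by rewrite mulr_ge0 // ltW.
rewrite ler_pdivrMr // mulrDl; move: c1; rewrite intrB ltrBlDr => /ltW /le_trans; apply.
rewrite [pos z * _]mulrC lerD2l; move: h; rewrite -(ler_pM2r N0) mulVf // gt_eqF //.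
Unshelve. all: by end_near. Qed.

Lemma measurable_cell_le N (j : nat) : measurable [set z : R | (cell N z <= j)%N].
Proof.
have [jM|jM] := ltnP j (N.+1 * N.+1).
  rewrite (_ : [set z | _] = `]-oo, j%:R / N.+1%:R]%classic) //.
  by apply/seteqP; split => z /=; rewrite in_itv /= cell_le.
rewrite (_ : [set z | _] = setT) //; apply/seteqP; split => // z _ /=.
exact: cell_top.
Qed.

Lemma cell_eq_setD N (i : 'I_(N.+1 * N.+1).+1) : cell N @^-1` [set i] =
  if (i == 0 :> nat)%N then [set z | (cell N z <= i)%N]
  else [set z | (cell N z <= i)%N] `\` [set z | (cell N z <= i.-1)%N].
Proof.
case: eqP => i0; apply/seteqP; split => z /=.
- by move=> ->.
- by rewrite i0 leqn0 => /eqP ci; apply: val_inj; rewrite /= ci i0.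
- by move=> ->; split => //; apply/negP; rewrite -ltnNge ltn_predL lt0n; apply/eqP.
- move=> [c1 /negP]; rewrite -ltnNge => c2; apply: val_inj => /=; lia.
Qed.

Lemma measurable_cell N i : measurable (@cell N @^-1` [set i]).
Proof.
rewrite cell_eq_setD; case: ifP => _; first exact: measurable_cell_le.
by apply: measurableD; exact: measurable_cell_le.
Qed.

End Cells.

Section CellProbabilities.
Variable R : realType.

(* The law of the cell of a random variable with distribution function Psi. *)
Definition cell_cdf N (Psi : R -> R) (j : nat) : R :=
  if (j < N.+1 * N.+1)%N then Psi (j%:R / N.+1%:R) else 1.

Definition cell_pmf N (Psi : R -> R) (i : 'I_(N.+1 * N.+1).+1) : R :=
  if (i == 0 :> nat)%N then cell_cdf N Psi i else cell_cdf N Psi i - cell_cdf N Psi i.-1.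

Lemma cell_cdf_itv N (Psi : cumulativeBounded (0 : R) (1 : R)) j : 0 <= cell_cdf N Psi j <= 1.
Proof. by rewrite /cell_cdf; case: ifP => _; [exact: cumulativeBounded_itv|rewrite ler01 lexx]. Qed.

Lemma cell_pmf_le1 N (Psi : cumulativeBounded (0 : R) (1 : R)) i : `|cell_pmf (N := N) Psi i| <= 1.
Proof.
rewrite /cell_pmf; have /andP[a0 a1] := cell_cdf_itv N Psi i.
have /andP[b0 b1] := cell_cdf_itv N Psi i.-1.
by case: ifP => _; rewrite ler_norml; apply/andP; split; lra.
Qed.

Lemma quantile_cell_measure N (Psi : cumulativeBounded (0 : R) (1 : R)) i :
  fine (lebesgue_measure (`[0, 1]%classic `&` (fun x => @cell R N (quantile Psi x)) @^-1` [set i]))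
  = cell_pmf Psi i.
Proof.
have cdf_measure j : fine (lebesgue_measure (`[0, 1]%classic `&`
    [set x | (cell N (quantile Psi x) <= j)%N])) = cell_cdf N Psi j.
  rewrite /cell_cdf; case: ltnP => jM.
    rewrite -quantile_sublevel_measure; congr (fine (lebesgue_measure (_ `&` _))).
    by apply/seteqP; split => x /=; rewrite cell_le.
  rewrite (_ : _ `&` _ = `[0, 1]%classic) ?lebesgue_I01 //; apply/seteqP; split => x /=.
    by case.
  by split => //; exact: cell_top.
have mle j : measurable [set x : R | (cell N (quantile Psi x) <= j)%N].
  have := measurable_quantile Psi measurableT (@measurable_cell_le R N j).
  by rewrite setTI.
rewrite -[_ @^-1` _]/(quantile Psi @^-1` (cell N @^-1` [set i])) cell_eq_setD /cell_pmf.
case: ifP => _; first exact: cdf_measure.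
rewrite -!cdf_measure.
set A := [set x | (cell N (quantile Psi x) <= i)%N].
set B := [set x | (cell N (quantile Psi x) <= i.-1)%N].
have -> : quantile Psi @^-1` ([set z | (cell N z <= i)%N] `\` [set z | (cell N z <= i.-1)%N]) = A `\` B by [].
have BA : B `<=` A by move=> x /= /leq_trans; apply; exact: leq_pred.
have fin (C : set R) : measurable C -> (lebesgue_measure (`[0%R, 1%R]%classic `&` C) < +oo)%E.
  move=> mC; apply: le_lt_trans (lebesgue_I01_lty R); apply: le_measure; rewrite ?inE //.
  exact: measurableI.
have -> : `[0, 1]%classic `&` (A `\` B) = (`[0, 1]%classic `&` A) `\` (`[0, 1]%classic `&` B).
  apply/seteqP; split => x /=; first by move=> [x01 [Ax Bx]]; split => // -[].
  by move=> [[x01 Ax] Bx]; split => //; split => // Bx'; exact: Bx.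
have mIA : measurable (`[0, 1]%classic `&` A) by apply: measurableI => //; exact: mle.
have mIB : measurable (`[0, 1]%classic `&` B) by apply: measurableI => //; exact: mle.
rewrite measureD //; last exact: (fin A (mle _)).
have -> : (`[0, 1]%classic `&` A) `&` (`[0, 1]%classic `&` B) = `[0, 1]%classic `&` B.
  by apply/seteqP; split => x /=; [case=> _|move=> [x01 Bx]; split => //; split => //; exact: BA].
rewrite fineB ?ge0_fin_numE //; first exact: (fin A (mle _)).
exact: (fin B (mle _)).
Qed.

End CellProbabilities.

Section ConditionalProbability.
Context (R : realType) d (Omega : measurableType d) (P : probability Omega R).
Variable Y : Omega -> R.
Hypothesis Y_meas : measurable_fun setT Y.

Lemma measurable_preimage_setT (f : Omega -> R) (B : set R) :
  measurable_fun setT f -> measurable B -> measurable (f @^-1` B).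
Proof. by move=> mf mB; rewrite -[X in measurable X]setTI; exact: mf. Qed.

Lemma probability_lty_set (A : set Omega) : measurable A -> (P A < +oo)%E.
Proof. by move=> mA; apply: le_lt_trans (probability_le1 P mA) _; rewrite ltry. Qed.

Lemma bounded_integrable_comp (g : R -> R) (A : set Omega) (M : R) : measurable A ->
  measurable_fun setT g -> (forall y, `|g y| <= M) ->
  P.-integrable A (EFin \o (fun w => g (Y w))).
Proof.
move=> mA mg gM; apply: (bounded_integrable mA (probability_lty_set mA) (M := M)) => //.
by apply: measurable_funTS; exact: (measurableT_comp mg).
Qed.

Lemma is_cond_prob_setD (E E' : set Omega) (g g' : R -> R) :
  measurable E -> measurable E' -> E' `<=` E ->
  (forall y, `|g y| <= 1) -> (forall y, `|g' y| <= 1) ->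
  is_cond_prob P Y E g -> is_cond_prob P Y E' g' ->
  is_cond_prob P Y (E `\` E') (fun y => g y - g' y).
Proof.
move=> mE mE' E'E g1 g'1 [mg hg] [mg' hg']; split; first exact: measurable_funB.
move=> B mB; have mYB := measurable_preimage_setT Y_meas mB.
have -> : (E `\` E') `&` Y @^-1` B = (E `&` Y @^-1` B) `\` (E' `&` Y @^-1` B).
  apply/seteqP; split => w /=; first by move=> [[Ew E'w] Bw]; split => // -[].
  by move=> [[Ew Bw] h]; split => //; split => // E'w; apply: h.
have mEB : measurable (E `&` Y @^-1` B) by exact: measurableI.
have mE'B : measurable (E' `&` Y @^-1` B) by exact: measurableI.
rewrite measureD //; last exact: probability_lty_set.
have -> : (E `&` Y @^-1` B) `&` (E' `&` Y @^-1` B) = E' `&` Y @^-1` B.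
  by apply/seteqP; split => w /=; [case=> _|move=> [E'w Bw]; split => //; split => //; exact: E'E].
rewrite [X in (X - _)%E](hg B mB) [X in (_ - X)%E](hg' B mB).
by rewrite -integralB_EFin //; exact: (bounded_integrable_comp (M := 1)).
Qed.

Lemma is_cond_prob_setT : is_cond_prob P Y setT (fun=> 1).
Proof.
split => // B mB; have mYB := measurable_preimage_setT Y_meas mB.
by rewrite setTI integral_cst // mul1e.
Qed.

Variables (Psi : R -> cumulativeBounded (0 : R) (1 : R)) (k : nat) (Z : 'I_k.+1 -> Omega -> R).
Hypothesis Z_meas : forall j, measurable_fun setT (Z j).
Hypothesis Z_indep : cond_independent P Y Z.
Hypothesis Z_cdf : forall j, cond_cdf P Y (Z j) (fun y => Psi y).

(** [cond_independent] is to be applied to explicit versions of the conditional probabilities;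
    differences of values of [Psi] provide one for each cell. *)
Lemma is_cond_prob_cell N j (i : 'I_(N.+1 * N.+1).+1) :
  is_cond_prob P Y (Z j @^-1` (@cell R N @^-1` [set i])) (fun y => cell_pmf (Psi y) i).
Proof.
have le_cp m : is_cond_prob P Y (Z j @^-1` [set z | (cell N z <= m)%N])
    (fun y => cell_cdf N (Psi y) m).
  rewrite /cell_cdf; case: ltnP => mM.
    rewrite (_ : _ @^-1` _ = [set w | Z j w <= m%:R / N.+1%:R]); last first.
      by apply/seteqP; split => w /=; rewrite cell_le.
    exact: Z_cdf.
  rewrite (_ : _ @^-1` _ = setT); last first.
    by apply/seteqP; split => // w _; exact: cell_top.
  exact: is_cond_prob_setT.
have bd m y : `|cell_cdf N (Psi y) m| <= 1.
  by have /andP[h0 h1] := cell_cdf_itv N (Psi y) m; rewrite ger0_norm.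
rewrite cell_eq_setD /cell_pmf; case: (i == 0 :> nat)%N; first exact: le_cp.
apply: is_cond_prob_setD => //.
- by apply: measurable_preimage_setT => //; exact: measurable_cell_le.
- by apply: measurable_preimage_setT => //; exact: measurable_cell_le.
- by move=> w /= /leq_trans; apply; exact: leq_pred.
- exact: le_cp.
- exact: le_cp.
Qed.

Variable F : 'M[nat]_k.+1.

Lemma measurable_cell_pmf N i : measurable_fun setT (fun y => cell_pmf (N := N) (Psi y) i).
Proof.
have m j : measurable_fun setT (fun y => cell_cdf N (Psi y) j).
  rewrite /cell_cdf; case: (j < _)%N => //.
  by case: (Z_cdf ord0 (j%:R / N.+1%:R)).
by rewrite /cell_pmf; case: (i == 0 :> nat)%N => //; exact: measurable_funB.
Qed.

Definition cell_pair N (w : Omega) :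
    {ffun 'I_k.+1 -> 'I_(N.+1 * N.+1).+1} * 'I_(N.+1 * N.+1).+1 :=
  ([ffun j => cell N (Z j w)], cell N (Y w)).

Definition cell_hom N (p : {ffun 'I_k.+1 -> 'I_(N.+1 * N.+1).+1} * 'I_(N.+1 * N.+1).+1) : R :=
  poisson_hom F (fun j => cell_value R (p.1 j)) (cell_value R p.2).

Definition cell_weight N (s : {ffun 'I_k.+1 -> 'I_(N.+1 * N.+1).+1}) (y : R) : R :=
  \prod_j cell_pmf (Psi y) (s j).

Lemma cell_weight_le1 N (s : {ffun 'I_k.+1 -> 'I_(N.+1 * N.+1).+1}) y :
  `|cell_weight s y| <= 1.
Proof.
rewrite /cell_weight normr_prod; apply: prodr_ile1 => j _.
by rewrite normr_ge0 cell_pmf_le1.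
Qed.

Lemma measurable_cell_weight N (s : {ffun 'I_k.+1 -> 'I_(N.+1 * N.+1).+1}) :
  measurable_fun setT (cell_weight s).
Proof. by apply: measurable_prod => j _; exact: measurable_cell_pmf. Qed.

Lemma measurable_cell_Y N i : measurable ((fun w => cell N (Y w)) @^-1` [set i]).
Proof.
exact: (measurable_preimage_setT Y_meas (@measurable_cell R N i)).
Qed.

Lemma cell_pair_preimage N p : cell_pair N @^-1` [set p] =
  [set w | forall j, (@cell R N @^-1` [set p.1 j]) (Z j w)] `&` Y @^-1` (@cell R N @^-1` [set p.2]).
Proof.
apply/seteqP; split => w /=; first by move=> <-; split => // j; rewrite /= ffunE.
case: p => s t /= [h1 h2]; congr (_, _) => //.
by apply/ffunP => j; rewrite ffunE; exact: h1.
Qed.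

Lemma measurable_cell_pair N p : measurable (cell_pair N @^-1` [set p]).
Proof.
rewrite cell_pair_preimage; apply: measurableI; last exact: measurable_cell_Y.
rewrite (_ : [set w | _] = \bigcap_(j in [set: 'I_k.+1])
    (Z j @^-1` (@cell R N @^-1` [set p.1 j]))).
  apply: fin_bigcap_measurable; first exact: finite_finset.
  by move=> j _; apply: measurable_preimage_setT => //; exact: measurable_cell.
by apply/seteqP; split => w /= h j; [move=> _; exact: h|exact: h].
Qed.

Lemma cell_pair_probability N p : fine (P (cell_pair N @^-1` [set p])) =
  \int[P]_(w in (fun w => cell N (Y w)) @^-1` [set p.2]) cell_weight p.1 (Y w).
Proof.
rewrite cell_pair_preimage /Rintegral.
have [_ h] := Z_indep (fun j => measurable_cell (p.1 j)) (fun j => is_cond_prob_cell j (p.1 j)).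
by rewrite [X in fine X = _](h _ (measurable_cell p.2)).
Qed.

Lemma rcube_cell_hom N w : rcube (fun v : k.+1.-tuple R =>
    poisson_hom F (fun j => cell_value R (cell N (quantile (Psi (Y w)) (tnth v j))))
      (cell_value R (cell N (Y w)))) =
  \sum_s cell_hom (s, cell N (Y w)) * cell_weight s (Y w).
Proof.
transitivity (rcube (fun v : k.+1.-tuple R =>
    cell_hom ([ffun j => cell N (quantile (Psi (Y w)) (tnth v j))], cell N (Y w)))).
  apply: eq_rcube => v.
  have e : (fun j => cell_value R ([ffun j => cell N (quantile (Psi (Y w)) (tnth v j))] j)) =
    (fun j => cell_value R (cell N (quantile (Psi (Y w)) (tnth v j)))).
    by apply/funext => j; rewrite ffunE.
  exact: (congr1 (fun z => poisson_hom F z (cell_value R (cell N (Y w)))) (esym e)).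
rewrite (@rcube_finite_range R k.+1 _ (fun x => cell N (quantile (Psi (Y w)) x))
    (fun s => cell_hom (s, cell N (Y w)))) => [|i].
  apply: eq_bigr => s _; congr (_ * _); apply: eq_bigr => j _.
  by rewrite quantile_cell_measure.
have := measurable_quantile (Psi (Y w)) measurableT (measurable_cell i).
by rewrite setTI.
Qed.

(** Both sides are the same finite sum over the cells of the sample and of [Y]. On the left the
    weights come from conditional independence; on the right from the quantile function, whose cells
    have Lebesgue measure [cell_pmf]. *)
Lemma cell_expectation N :
  \int[P]_w cell_hom (cell_pair N w) =
  \int[P]_w rcube (fun v : k.+1.-tuple R =>
    poisson_hom F (fun j => cell_value R (cell N (quantile (Psi (Y w)) (tnth v j))))
      (cell_value R (cell N (Y w)))).
Proof.
rewrite (Rintegral_finite_range measurableT (probability_lty P) (@cell_hom N)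
  (measurable_cell_pair (N := N))).
transitivity (\int[P]_w \sum_s cell_hom (s, cell N (Y w)) * cell_weight s (Y w)); last first.
  by apply: eq_Rintegral => w _; exact: esym (rcube_cell_hom _ _).
have mw s : measurable_fun setT (fun w => @cell_weight N s (Y w)).
  exact: (measurableT_comp (measurable_cell_weight s)).
rewrite Rintegral_sum //; last first.
  move=> s; apply: (bounded_integrable measurableT (probability_lty P) (M := 1)).
    apply: measurable_funM => //.
    apply: (measurable_finite_range (fun t => cell_hom (s, t))); exact: measurable_cell_Y.
  move=> w _; rewrite normrM mulr_ile1 ?cell_weight_le1 //.
  by have /andP[h0 h1] := poisson_hom_itv F (fun j => cell_value R (s j))
     (cell_value R (cell N (Y w))); rewrite /cell_hom /= ger0_norm.
under [RHS]eq_bigr => s _ do rewrite (Rintegral_finite_partition P (fun t => cell_hom (s, t))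
  (@measurable_cell_Y N) (mw s) (fun w => cell_weight_le1 s (Y w))).
rewrite pair_bigA /=; apply: eq_bigr => -[s t] _.
by rewrite setTI cell_pair_probability mulrC.
Qed.

Lemma cell_limit_measurable N : measurable_fun setT (fun w => rcube (fun v : k.+1.-tuple R =>
    poisson_hom F (fun j => cell_value R (cell N (quantile (Psi (Y w)) (tnth v j))))
      (cell_value R (cell N (Y w))))).
Proof.
have -> : (fun w => rcube (fun v : k.+1.-tuple R =>
    poisson_hom F (fun j => cell_value R (cell N (quantile (Psi (Y w)) (tnth v j))))
      (cell_value R (cell N (Y w))))) =
   (fun w => \sum_s cell_hom (s, cell N (Y w)) * cell_weight s (Y w)).
  by apply/funext => w; exact: rcube_cell_hom.
apply: measurable_sum => s; apply: measurable_funM.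
  apply: (measurable_finite_range (fun t => cell_hom (s, t))); exact: measurable_cell_Y.
exact: (measurableT_comp (measurable_cell_weight s)).
Qed.

Let limit_density w := rcube (fun v : k.+1.-tuple R =>
  poisson_hom F (fun j => quantile (Psi (Y w)) (tnth v j)) (Y w)).

Lemma measurable_cell_integrand N w : measurable_fun setT (fun v : k.+1.-tuple R =>
  poisson_hom F (fun j => cell_value R (cell N (quantile (Psi (Y w)) (tnth v j))))
    (cell_value R (cell N (Y w)))).
Proof.
apply: measurable_poisson_hom => [a|]; last exact: measurable_cst.
pose c (v : k.+1.-tuple R) := cell N (quantile (Psi (Y w)) (tnth v a)).
have mq : measurable_fun setT (fun v : k.+1.-tuple R => quantile (Psi (Y w)) (tnth v a)).
  exact: (measurableT_comp (measurable_quantile _) (measurable_tnth a)).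
have mc i : measurable (c @^-1` [set i]).
  by have := mq measurableT _ (measurable_cell i); rewrite setTI.
exact: measurable_pos (measurable_finite_range (@cell_value R N) mc).
Qed.

Lemma cell_limit_cvg w : rcube (fun v : k.+1.-tuple R =>
    poisson_hom F (fun j => cell_value R (cell N (quantile (Psi (Y w)) (tnth v j))))
      (cell_value R (cell N (Y w)))) @[N --> \oo] --> limit_density w.
Proof.
apply: (@rcube_cvg _ _ 1) => [N|v].
  by apply: unit_bmeas => [|v]; [exact: measurable_cell_integrand|exact: poisson_hom_itv].
by apply: cvg_poisson_hom => [a|]; exact: cell_value_cvg.
Qed.

Lemma measurable_limit_density : measurable_fun setT limit_density.
Proof.
apply: (@measurable_fun_cvg _ _ _ _ (fun N w => rcube (fun v : k.+1.-tuple R =>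
    poisson_hom F (fun j => cell_value R (cell N (quantile (Psi (Y w)) (tnth v j))))
      (cell_value R (cell N (Y w)))))) => [N|w _].
  exact: cell_limit_measurable.
exact: cell_limit_cvg.
Qed.

(** Conditional independence is given for events only. For rounded variables the identity is
    [cell_expectation], and bounded convergence removes the rounding on both sides. *)
Lemma poisson_hom_expectation :
  \int[P]_w poisson_hom F (fun j => Z j w) (Y w) = \int[P]_w limit_density w.
Proof.
have c1 : \int[P]_w cell_hom (cell_pair N w) @[N --> \oo] -->
    \int[P]_w poisson_hom F (fun j => Z j w) (Y w).
  apply: (@Rintegral_bounded_cvg _ _ R P setT measurableT (probability_lty P)
    (fun N w => cell_hom (cell_pair N w)) _ 1) => [N|N w _|w _].
  - apply: (measurable_finite_range (@cell_hom N)); exact: measurable_cell_pair.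
  - by have /andP[h0 h1] := poisson_hom_itv F (fun j => cell_value R ((cell_pair N w).1 j))
      (cell_value R (cell_pair N w).2); rewrite /cell_hom ger0_norm.
  - apply: cvg_poisson_hom => [a|]; last exact: cell_value_cvg.
    by under eq_fun do rewrite ffunE; exact: cell_value_cvg.
have c2 : \int[P]_w cell_hom (cell_pair N w) @[N --> \oo] --> \int[P]_w limit_density w.
  under eq_fun do rewrite cell_expectation.
  apply: (@Rintegral_bounded_cvg _ _ R P setT measurableT (probability_lty P)
    (fun N w => rcube (fun v : k.+1.-tuple R =>
    poisson_hom F (fun j => cell_value R (cell N (quantile (Psi (Y w)) (tnth v j))))
      (cell_value R (cell N (Y w))))) _ 1) => [N|N w _|w _].
  - exact: cell_limit_measurable.
  - have /andP[h0 h1] := @rcube_itv R k.+1 (fun v : k.+1.-tuple R =>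
      poisson_hom F (fun j => cell_value R (cell N (quantile (Psi (Y w)) (tnth v j))))
      (cell_value R (cell N (Y w)))) (measurable_cell_integrand N w) (fun v => poisson_hom_itv _ _ _).
    by rewrite ger0_norm.
  - exact: cell_limit_cvg.
exact: (cvg_unique _ c1 c2).
Qed.

End ConditionalProbability.

(** * The kernel of a multigraph *)

Section GraphonOfMultigraph.
Variables (R : realType) (n : nat).
Local Notation mu := (@lebesgue_measure R).

Lemma measurable_ceil_preimage (A : set int) : measurable [set x : R | A (Num.ceil x)].
Proof.
rewrite (_ : [set x | _] = \bigcup_(m in A) `](m%:~R - 1), m%:~R]%classic).
  rewrite bigcup_mkcond; apply: countable_bigcupT_measurable; first exact: countableP.
  by move=> m; case: ifP.
apply/seteqP; split => x /=.
  move=> Ax; exists (Num.ceil x) => //=; rewrite in_itv /=.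
  by have := ceil_itv x; rewrite intrB.
move=> [m Am]; rewrite /= in_itv /= => h; suff -> : Num.ceil x = m by [].
by apply: ceil_def; rewrite intrB.
Qed.

Lemma measurable_vertex_at (i : 'I_n.+1) : measurable (@vertex_at R n @^-1` [set i]).
Proof.
have m1 : measurable_fun setT (fun x : R => n.+1%:R * x) by apply: measurable_funM.
have := m1 measurableT _ (measurable_ceil_preimage [set m | inord `|m|%N.-1 = i]).
by rewrite setTI.
Qed.

(** Vertices are numbered from 0 while the ceiling of a positive number starts at 1, so vertex i
    owns an interval that is open on the left. The point 0 is left out: its ceiling 0 gives vertex 0
    as well. *)
Lemma vertex_at_itv (i : 'I_n.+1) (x : R) : 0 < x <= 1 ->
  (vertex_at n x == i) = (i%:R / n.+1%:R < x <= i.+1%:R / n.+1%:R).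
Proof.
move=> /andP[x0 x1]; have n0 : 0 < n.+1%:R :> R by rewrite ltr0n.
set m := Num.ceil (n.+1%:R * x); have m0 : 0 < m by rewrite ceil_gt0 mulr_gt0.
have mn : m <= n.+1%:Z.
  by rewrite ceil_le_int -[_%:~R]/(n.+1%:R) -[leRHS]mulr1 ler_wpM2l.
rewrite -(inj_eq val_inj) /= inordK; last by rewrite -/m; lia.
have -> : (`|m|%N.-1 == i) = (m == i.+1%:Z) by lia.
rewrite /m ceil_eq intrB -[i.+1%:Z%:~R]/(i.+1%:R) -natr1 addrK.
by rewrite ltr_pdivrMr // ler_pdivlMr // mulrC.
Qed.

Lemma vertex_at_measure (i : 'I_n.+1) :
  fine (mu (`[0, 1]%classic `&` @vertex_at R n @^-1` [set i])) = n.+1%:R^-1.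
Proof.
have n0 : 0 < n.+1%:R :> R by rewrite ltr0n.
set A := `[0, 1] `&` _; set B := (`]i%:R / n.+1%:R, i.+1%:R / n.+1%:R]%classic : set R).
have mB : mu B = (n.+1%:R^-1)%:E.
  rewrite /B lebesgue_measure_itv /= lte_fin ltr_pM2r ?invr_gt0 // ltr_nat leqnn.
  by rewrite -EFinB -mulrBl -natr1 addrAC subrr add0r mul1r.
have mA : measurable A by apply: measurableI => //; exact: measurable_vertex_at.
have measB : measurable B by exact: measurable_itv.
have null0 : mu ([set 0] : set R) = 0%E by exact: lebesgue_measure_set1.
have le_mod (C E : set R) : measurable C -> measurable E -> C `<=` E `|` [set 0] ->
    (mu C <= mu E)%E.
  move=> mC mE CE; apply: (@le_trans _ _ (mu (E `|` [set 0]))).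
    by apply: le_measure => //; rewrite inE //; exact: measurableU.
  apply: (@le_trans _ _ (mu E + mu [set 0%R])%E); first exact: measureU2.
  by rewrite [X in (_ + X)%E]null0 adde0.
suff -> : mu A = mu B by rewrite mB.
have i1 : i.+1%:R / n.+1%:R <= 1 :> R by rewrite ler_pdivrMr // mul1r ler_nat.
apply/eqP; rewrite eq_le; apply/andP; split; apply: le_mod => //.
  move=> x [x01 xi]; move: x01 xi; rewrite /= in_itv /= => /andP[x0 x1] xi.
  have [->|xn0] := eqVneq x 0; [by right|left].
  by rewrite /B /= in_itv /= -vertex_at_itv ?xi ?eqxx // lt_neqAle eq_sym xn0 x0.
move=> x; rewrite /B /= in_itv /= => h; left; have /andP[h1 h2] := h.
have x0 : 0 < x by apply: le_lt_trans h1; rewrite divr_ge0.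
have x1 : x <= 1 by apply: le_trans i1.
split; first by rewrite /= in_itv /= ltW.
suff : vertex_at n x == i by move/eqP.
by rewrite vertex_at_itv ?x0 ?x1.
Qed.

Variable G : multigraph n.+1.

Lemma graphon_of_sum a x y :
  \sum_(r < a) graphon_of R G r x y = ((val G (vertex_at n x) (vertex_at n y) < a)%N)%:R.
Proof.
rewrite /graphon_of; set z := val G _ _; elim: a => [|a IH]; first by rewrite big_ord0.
rewrite big_ord_recr /= IH -natrD; congr (_%:R).
by rewrite ltnS; case: ltngtP.
Qed.

Lemma graphon_of_plane : plane_kernel (graphon_of R G).
Proof.
have /andP[/eqP sG /forallP dG] := valP G.
split.
- move=> r; pose c (z : R * R) := (vertex_at n z.1, vertex_at n z.2).
  apply: (measurable_finite_range (c := c)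
    (fun p => (val G p.1 p.2 == r)%:R : R)) => -[i j].
  rewrite (_ : c @^-1` _ = (@vertex_at R n @^-1` [set i]) `*` (@vertex_at R n @^-1` [set j])).
    by apply: measurableX; exact: measurable_vertex_at.
  by apply/seteqP; split => -[x y] /=; [case|case=> /= e1 e2; rewrite /c /= e1 e2].
- by move=> r x y; rewrite /graphon_of.
- by move=> r x y; rewrite /graphon_of -{1}sG mxE.
- move=> x y; apply: cvg_near_cst; near=> a.
  rewrite /series /= big_mkord graphon_of_sum (_ : (_ < a)%N) //.
  by near: a; exact: nbhs_infty_gt.
- move=> r x; rewrite /graphon_of; case: eqP => // e.
  by have := dG (vertex_at n x); rewrite e /= odd_double.
Unshelve. all: by end_near. Qed.

Lemma ktail_graphon_of a x y :
  ktail (graphon_of R G) a x y = (a <= val G (vertex_at n x) (vertex_at n y))%N%:R.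
Proof. by rewrite /ktail graphon_of_sum; case: ltnP => _; rewrite ?mulr1n ?mulr0n ?subrr ?subr0. Qed.

Definition embeds k (F : 'M[nat]_k) (z : 'M[nat]_n.+1) (s : 'I_k -> 'I_n.+1) : bool :=
  [forall i : 'I_k, forall j : 'I_k, (i <= j)%N ==> (F i j <= z (s i) (s j))%N].

Lemma prod_embeds k (F : 'M[nat]_k) (z : 'M[nat]_n.+1) (s : 'I_k -> 'I_n.+1) :
  \prod_(i < k) \prod_(j < k | (i <= j)%N) ((F i j <= z (s i) (s j))%N%:R : R)
  = (embeds F z s)%:R.
Proof.
have prodb (I : finType) (Q b : pred I) :
    \prod_(i | Q i) ((b i)%:R : R) = [forall i, Q i ==> b i]%:R.
  have [/forallP h|] := boolP [forall i, Q i ==> b i].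
    by rewrite big1 // => i Qi; have := h i; rewrite Qi /= => ->.
  rewrite negb_forall => /existsP[i]; rewrite negb_imply => /andP[Qi /negbTE bi].
  by rewrite (bigD1 i) //= bi mul0r.
under eq_bigr do rewrite prodb.
rewrite (prodb _ predT (fun i : 'I_k => [forall j : 'I_k, (i <= j)%N ==> (F i j <= z (s i) (s j))%N])).
by [].
Qed.

(** All maps are counted, injective or not, because several coordinates may fall into the interval
    of one vertex; the difference with a sample without replacement is bounded through
    [collision_error]. *)
Lemma t_hom_graphon_of k (F : multigraph k) :
  t_hom F (graphon_of R G) =
  (\sum_(s : {ffun 'I_k -> 'I_n.+1}) (embeds (val F) (val G) s)%:R) / n.+1%:R ^+ k.
Proof.
rewrite t_homE; last exact: graphon_of_plane.
rewrite (eq_rcube (g := fun v : k.-tuple R =>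
   (fun s : {ffun 'I_k -> 'I_n.+1} => (embeds (val F) (val G) s)%:R)
     [ffun j => vertex_at n (tnth v j)])); last first.
  move=> v; rewrite -prod_embeds; apply: eq_bigr => i _; apply: eq_bigr => j _.
  by rewrite ktail_graphon_of !ffunE.
rewrite (rcube_finite_range (fun s : {ffun 'I_k -> 'I_n.+1} => (embeds (val F) (val G) s)%:R)
  (fun i => measurable_vertex_at i)).
rewrite mulr_suml; apply: eq_bigr => s _; congr (_ * _).
under eq_bigr do rewrite vertex_at_measure.
by rewrite prodr_const card_ord exprVn.
Qed.

End GraphonOfMultigraph.

(** * Averaging over the degree sequence *)

Section DiscreteConditioning.
Context (R : realType) d (Omega : measurableType d) (P : probability Omega R).

Lemma Rintegral_indicator (E A : set Omega) : measurable E -> measurable A ->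
  \int[P]_(w in E) (\1_A w : R) = fine (P (E `&` A)).
Proof.
move=> mE mA; rewrite /Rintegral; congr fine.
by rewrite integral_indic //; rewrite [X in P X = _]classical_sets.setIC.
Qed.

(** The law is known only through the masses of points, and [V] may range over an uncountable set.
    The masses of the points [v x] already exhaust [P E], so the other values form a null event
    within [E]. *)
Lemma finite_law_integral (E : set Omega) (B : eqType) (V : Omega -> B) (W : finType)
    (A : {set W}) (v : W -> B) (psi : B -> R) (M : R) :
  measurable E -> (forall b, measurable [set w | V w = b]) -> (0 < #|A|)%N ->
  (forall b, P (E `&` [set w | V w = b]) =
     (P E * (#|[set x in A | v x == b]%SET|%:R / #|A|%:R)%:E)%E) ->
  measurable_fun setT (fun w => psi (V w)) -> (forall b, `|psi b| <= M) ->
  \int[P]_(w in E) psi (V w) = fine (P E) * ((\sum_(x in A) psi (v x)) / #|A|%:R).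
Proof.
move=> mE mV A0 law mpsi psiM.
have A0' : #|A|%:R != 0 :> R by rewrite pnatr_eq0 -lt0n.
pose S := undup [seq v x | x in A].
have PEfin := probability_lty_set P mE.
have split_sum (g : B -> R) : \sum_(x in A) g (v x) =
    \sum_(b <- S) g b * #|[set x in A | v x == b]%SET|%:R.
  transitivity (\sum_(x in A) \sum_(b <- S) g b * (v x == b)%:R).
    apply: eq_bigr => x xA; have vS : v x \in S by rewrite mem_undup; exact: fintype.image_f.
    rewrite (bigD1_seq (v x)) ?undup_uniq //= eqxx mulr1 big1 ?addr0 // => b.
    by rewrite eq_sym => /negbTE ->; rewrite mulr0.
  rewrite exchange_big /=; apply: eq_bigr => b _; rewrite -mulr_sumr; congr (_ * _).
  rewrite -sum1_card natr_sum [RHS]big_mkcond [LHS]big_mkcond /=.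
  by apply: eq_bigr => x _; rewrite inE; case: (x \in A) => //=; case: eqP.
have int_ind (g : B -> R) : \int[P]_(w in E) (\sum_(b <- S) g b * \1_[set w | V w = b] w) =
    fine (P E) * ((\sum_(x in A) g (v x)) / #|A|%:R).
  have it b : P.-integrable E (EFin \o (\1_[set w | V w = b] : Omega -> R)).
    apply: (bounded_integrable mE PEfin (M := 1)).
      by apply: measurable_funTS; exact: (measurable_indic (mV b)).
    by move=> w _; rewrite indicE; case: (_ \in _); rewrite /= ?normr1 ?normr0 ?lexx ?ler01.
  rewrite Rintegral_sum //; last first.
    move=> b; have := integrableZl mE (g b) (it b).
    by apply: eq_integrable => // w _; rewrite /= EFinM.
  rewrite split_sum mulr_suml mulr_sumr; apply: eq_bigr => b _.
  rewrite RintegralZl // Rintegral_indicator // law fineM //; last by rewrite ge0_fin_numE.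
  by rewrite /= -!mulrA mulrCA.
pose u w := \sum_(b <- S) (1 : R) * \1_[set w | V w = b] w.
pose h w := \sum_(b <- S) psi b * \1_[set w | V w = b] w.
have uhE w : if V w \in S then (u w = 1) /\ (h w = psi (V w)) else (u w = 0) /\ (h w = 0).
  have ind b : \1_[set w | V w = b] w = (V w == b)%:R :> R.
    by rewrite indicE; congr ((nat_of_bool _)%:R); apply/idP/eqP; rewrite inE.
  case: ifP => vS.
    split; rewrite /u /h (bigD1_seq (V w)) ?undup_uniq //= ind eqxx !mulr1 big1 ?addr0 // => b;
      by rewrite eq_sym ind => /negbTE ->; rewrite mulr0.
  split; rewrite /u /h big_seq big1 // => b bS; rewrite ind; case: eqP => [e|]; rewrite ?mulr0 //;
    by rewrite e bS in vS.
have mS (g : B -> R) : measurable_fun setT (fun w => \sum_(b <- S) g b * \1_[set w | V w = b] w).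
  apply: measurable_sum => b; apply: measurable_funM => //; exact: (measurable_indic (mV b)).
have M0 : 0 <= M by have [x _] := card_gt0P A0; apply: le_trans (psiM (v x)).
have bpsi : P.-integrable E (EFin \o (fun w => psi (V w))).
  by apply: (bounded_integrable mE PEfin (M := M)) => //; exact: measurable_funTS.
have bh : P.-integrable E (EFin \o h).
  apply: (bounded_integrable mE PEfin (M := M)); first by apply: measurable_funTS; exact: mS.
  by move=> w _; have := uhE w; case: ifP => _ [_ ->] //; rewrite normr0.
have bu : P.-integrable E (EFin \o (fun w => 1 - u w)).
  apply: (bounded_integrable mE PEfin (M := 1)).
    by apply: measurable_funTS; apply: measurable_funB => //; exact: (mS (fun=> 1)).
  by move=> w _; have := uhE w; case: ifP => _ [-> _]; rewrite ?subrr ?subr0 ?normr0 ?normr1.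
have u1 : \int[P]_(w in E) (1 - u w) = 0.
  rewrite RintegralB //; last 2 first.
  - by apply: (bounded_integrable mE PEfin (M := 1)) => // w _; rewrite normr1.
  - apply: (bounded_integrable mE PEfin (M := 1)).
      by apply: measurable_funTS; exact: (mS (fun=> 1)).
    by move=> w _; have := uhE w; case: ifP => _ [-> _]; rewrite ?normr0 ?normr1.
  rewrite Rintegral_cst // (int_ind (fun=> 1)) sumr_const mul1r.
  by rewrite divff // mulr1 subrr.
(* [psi (V w)] and [h w] differ only where [V w] lies outside [S]; there the difference is at most
   [M * (1 - u w)], whose integral is zero. *)
rewrite -(int_ind psi) -/h; apply/eqP; rewrite -subr_eq0 -RintegralB // -normr_eq0.
rewrite eq_le normr_ge0 andbT.
have bd : P.-integrable E (EFin \o (fun w => psi (V w) - h w)).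
  by have := integrableB mE bpsi bh; apply: eq_integrable => // w _; rewrite /= EFinB.
apply: le_trans (le_normr_Rintegral mE bd) _.
have <- : M * \int[P]_(w in E) (1 - u w) = 0 by rewrite u1 mulr0.
rewrite -RintegralZl //; apply: le_Rintegral => //.
- have := integrable_norm bd; apply: eq_integrable => // .
- have := integrableZl mE M bu; apply: eq_integrable => // w _; by rewrite /= EFinM.
- move=> w _; have := uhE w; case: ifP => _ [-> ->].
    by rewrite !subrr normr0 mulr0.
  by rewrite !subr0 mulr1.
Qed.

(** Countable additivity along [pickle]; it carries an inequality from each value of the degree
    sequence over to expectations. *)
Lemma countable_partition_le0 (C : countType) (X : Omega -> C) (f : Omega -> R) (M : R) :
  (forall c, measurable [set w | X w = c]) -> measurable_fun setT f ->
  (forall w, `|f w| <= M) ->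
  (forall c, \int[P]_(w in [set w | X w = c]) f w <= 0) -> \int[P]_w f w <= 0.
Proof.
move=> mX mf fM f0.
pose Fs (i : nat) := [set w | pickle (X w) = i].
have FsE i : Fs i = if (unpickle i : option C) is Some c then
    (if pickle c == i then [set w | X w = c] else set0) else set0.
  apply/seteqP; split => w; rewrite /Fs /=.
    by move=> <-; rewrite pickleK eqxx.
  case e : (unpickle i : option C) => [c|] //; by case: eqP => [pc /= ->|].
have mFs i : measurable (Fs i).
  by rewrite FsE; case: (unpickle i : option C) => // c; case: ifP.
have bi (A : set Omega) : measurable A -> P.-integrable A (EFin \o f).
  move=> mA; apply: (bounded_integrable mA (probability_lty_set P mA) (M := M)) => //.
  exact: measurable_funTS.
have UF : \bigcup_i Fs i = setT.
  by apply/seteqP; split => // w _; exists (pickle (X w)).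
have tF : trivIset setT Fs.
  by apply/trivIsetP => i j _ _ ij; apply/seteqP; split => // w [e1 e2];
    move: ij; rewrite -(e1 : pickle (X w) = i) -(e2 : pickle (X w) = j) eqxx.
rewrite /Rintegral -UF; have -> : (\int[P]_(w in \bigcup_i Fs i) (f w)%:E =
    \sum_(i <oo) \int[P]_(w in Fs i) (f w)%:E)%E.
  by apply: integral_bigcup => //; apply: bi; exact: bigcup_measurable.
have le0 i : (\int[P]_(w in Fs i) (f w)%:E <= 0)%E.
  have fin : (\int[P]_(w in Fs i) (f w)%:E)%E \is a fin_num.
    exact: (integrable_fin_num (mFs i) (bi _ (mFs i))).
  rewrite -(fineK fin) lee_fin; rewrite FsE; case: (unpickle i : option C) => [c|].
    by case: ifP => _; [exact: f0|rewrite integral_set0].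
  by rewrite integral_set0.
rewrite fine_le0 //; apply: lime_le.
  by apply: is_cvg_npeseries => i _ _; exact: le0.
by apply: nearW => n; apply: sume_le0 => i _; exact: le0.
Qed.

End DiscreteConditioning.

Lemma average_compare (R : realFieldType) (S : finType) (A : {set S}) (p q x : S -> R) (e : R) :
  (0 < #|A|)%N -> (forall s, 0 <= p s <= 1) ->
  (forall s, s \in A -> `|p s - q s| <= e + x s) ->
  `|(\sum_s p s) / #|S|%:R - (\sum_(s in A) q s) / #|A|%:R|
  <= (1 - #|A|%:R / #|S|%:R) + e + (\sum_(s in A) x s) / #|A|%:R.
Proof.
move=> A0 p01 pq; have a0 : 0 < #|A|%:R :> R by rewrite ltr0n.
have AS : #|A|%:R <= #|S|%:R :> R by rewrite ler_nat max_card.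
have s0 : 0 < #|S|%:R :> R by apply: lt_le_trans AS.
set a := #|A|%:R in a0 AS *; set b := #|S|%:R in AS s0 *.
set X := \sum_(s in A) x s; set Q := \sum_(s in A) q s.
pose PA := \sum_(s in A) p s; pose PC := \sum_(s | s \notin A) p s.
have -> : \sum_s p s = PA + PC by rewrite (bigID (mem A)).
have PA0 : 0 <= PA by apply: sumr_ge0 => s _; case/andP: (p01 s).
have PC0 : 0 <= PC by apply: sumr_ge0 => s _; case/andP: (p01 s).
have PAa : PA <= a.
  apply: le_trans (_ : _ <= \sum_(s in A) 1) _; last by rewrite sumr_const.
  by apply: ler_sum => s _; case/andP: (p01 s).
have PCb : PC <= b - a.
  apply: le_trans (_ : _ <= \sum_(s | s \notin A) 1) _.
    by apply: ler_sum => s _; case/andP: (p01 s).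
  have : b = a + \sum_(s | s \notin A) 1.
    by rewrite /b /a -!sum1_card !natr_sum (bigID (mem A)).
  by move=> ->; rewrite addrC addKr.
have QX : `|PA / a - Q / a| <= e + X / a.
  rewrite -mulrBl normrM [`|a^-1|]ger0_norm ?invr_ge0 ?(ltW a0) // ler_pdivrMr //.
  rewrite mulrDl divfK ?gt_eqF // /PA /Q -sumrB.
  apply: le_trans (ler_norm_sum _ _ _) _; apply: le_trans (ler_sum _ pq) _.
  by rewrite big_split /= sumr_const mulr_natr.
(* The two terms of the first bracket both lie between 0 and [1 - a / b], so their difference costs
   this quantity once and not twice. *)
have -> : (PA + PC) / b - Q / a = (PC / b - PA * (1 / a - 1 / b)) + (PA / a - Q / a).
  by field; rewrite !gt_eqF.
apply: le_trans (ler_normD _ _) _; rewrite -addrA; apply: lerD => //.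
have u0 : 0 <= PC / b by rewrite divr_ge0 // ltW.
have u1 : PC / b <= 1 - a / b.
  by rewrite ler_pdivrMr // mulrBl mul1r divfK ?gt_eqF.
have ab : 0 <= 1 / a - 1 / b by rewrite subr_ge0 !div1r lef_pV2.
have v0 : 0 <= PA * (1 / a - 1 / b) by rewrite mulr_ge0.
have v1 : PA * (1 / a - 1 / b) <= 1 - a / b.
  apply: le_trans (ler_wpM2r ab PAa) _.
  by rewrite le_eqVlt; apply/orP; left; apply/eqP; field; rewrite !gt_eqF.
by rewrite ler_norml; apply/andP; split; lra.
Qed.

(** * A continuous cutoff for large degrees *)

Definition unit_cap (R : realType) (u : R) : R := Num.min 1 (pos u).

Lemma unit_cap_itv (R : realType) (u : R) : 0 <= unit_cap u <= 1.
Proof. by rewrite /unit_cap le_min ler01 pos_ge0 ge_min lexx. Qed.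

Lemma unit_cap_ge0 (R : realType) (u : R) : 0 <= unit_cap u.
Proof. by case/andP: (unit_cap_itv u). Qed.

Lemma continuous_unit_cap (R : realType) : continuous (@unit_cap R).
Proof.
by move=> u; apply: continuous_min; [exact: cvg_cst|exact: continuous_pos].
Qed.

Section Cutoff.
Variables (R : realType) (k : nat).

(* At least 1 as soon as y * z_j ^+ 2 exceeds K ^+ 2 for some j. *)
Definition cutoff (K : R) (z : 'I_k -> R) (y : R) : R :=
  \sum_j unit_cap (pos y * pos (z j) ^+ 2 - (K ^+ 2 - 1)).

Lemma cutoff_ge0 K z y : 0 <= cutoff K z y.
Proof. by apply: sumr_ge0 => j _; exact: unit_cap_ge0. Qed.

Lemma cutoff_le K z y : cutoff K z y <= k%:R.
Proof.
rewrite -[in leRHS](card_ord k) -sum1_card natr_sum; apply: ler_sum => j _.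
by case/andP: (unit_cap_itv (pos y * pos (z j) ^+ 2 - (K ^+ 2 - 1))).
Qed.

Lemma cutoff_ge1 K z y j : K ^+ 2 <= pos y * pos (z j) ^+ 2 -> 1 <= cutoff K z y.
Proof.
move=> h; rewrite /cutoff (bigD1 j) //= -[leLHS]addr0; apply: lerD; last first.
  by apply: sumr_ge0 => i _; rewrite le_min ler01 pos_ge0.
rewrite /unit_cap le_min lexx [X in _ <= X]/pos le_max; apply/orP.
by move: h; set u := pos y * _; set v := K ^+ 2 => h; rewrite lerBrDr addrC subrK h ?orbT; auto.
Qed.

Lemma cvg_cutoff (T : Type) (G : set_system T) (FG : Filter G) (K : R)
    (z_ : T -> 'I_k -> R) (z : 'I_k -> R) (y_ : T -> R) (y : R) :
  (forall a, pos (z_ t a) @[t --> G] --> pos (z a)) ->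
  pos (y_ t) @[t --> G] --> pos y ->
  cutoff K (z_ t) (y_ t) @[t --> G] --> cutoff K z y.
Proof.
move=> zz yy; apply: cvg_sumr => j _.
apply: continuous_cvg; first exact: continuous_unit_cap.
apply: cvgB; last exact: cvg_cst.
by apply: cvgM => //; rewrite expr2; under eq_fun do rewrite expr2; exact: cvgM.
Qed.

Lemma measurable_cutoff d (T : measurableType d) (K : R) (z : T -> 'I_k -> R) (y : T -> R) :
  (forall a, measurable_fun setT (fun t => z t a)) -> measurable_fun setT y ->
  measurable_fun setT (fun t => cutoff K (z t) (y t)).
Proof.
move=> mz my; apply: measurable_sum => j.
have mcap : measurable_fun setT (@unit_cap R).
  by apply: continuous_measurable_fun; exact: continuous_unit_cap.
apply: (measurableT_comp mcap); apply: measurable_funB => //.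
apply: measurable_funM; first exact: measurable_pos.
by apply: measurable_funX; exact: measurable_pos.
Qed.

End Cutoff.

Definition injections (k n : nat) : {set {ffun 'I_k -> 'I_n}} :=
  [set s : {ffun 'I_k -> 'I_n} | injectiveb s]%SET.

(** * Averages over pairings and over samples of vertices *)

Section PairingAverages.
Variables (R : realType) (n k : nat) (F : multigraph k) (a : {ffun 'I_n.+1 -> nat}).
Hypothesis a_gt0 : forall i, (0 < a i)%N.
Hypothesis pairing_exists : (0 < #|pairings a|)%N.

Lemma pairing_mx_multigraph m : m \in pairings a -> is_multigraph (pairing_mx m).
Proof.
(* Colouring every half-edge by its own vertex turns the entries of the matrix into link counts,
   which are symmetric and even on the diagonal. *)
move=> mP; pose c (e : half_edge a) := Some (tag e).
have linksE i j : pairing_mx m i j = links c m (Some i) (Some j).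
  by rewrite mxE; apply: eq_card => e; rewrite !inE.
apply/andP; split.
  by apply/eqP/matrixP => i j; rewrite mxE !linksE links_sym.
by apply/forallP => i; rewrite linksE; exact: links_diag_even.
Qed.

Definition embedding_probability (s : {ffun 'I_k -> 'I_n.+1}) : R :=
  #|[set m in pairings a | embeds (val F) (pairing_mx m) s]%SET|%:R / #|pairings a|%:R.

Lemma embedding_probability_itv s : 0 <= embedding_probability s <= 1.
Proof.
have m0 : 0 < #|pairings a|%:R :> R by rewrite ltr0n.
rewrite /embedding_probability divr_ge0 //= ler_pdivrMr // mul1r ler_nat.
by apply: subset_leq_card; apply/fintype.subsetP => m; rewrite inE => /andP[].
Qed.

Lemma average_embeddings :
  (\sum_(m in pairings a) ((\sum_(s : {ffun 'I_k -> 'I_n.+1})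
      (embeds (val F) (pairing_mx m) s)%:R) / n.+1%:R ^+ k)) / #|pairings a|%:R
  = (\sum_s embedding_probability s) / #|{ffun 'I_k -> 'I_n.+1}|%:R.
Proof.
rewrite card_ffun !card_ord natrX -mulr_suml exchange_big /= -!mulrA [_^-1 * _]mulrC mulrA.
congr (_ / _); rewrite mulr_suml; apply: eq_bigr => s _; congr (_ / _).
rewrite -sum1_card natr_sum [LHS]big_mkcond [RHS]big_mkcond /=; apply: eq_bigr => m _.
by rewrite [in RHS]inE; case: (m \in pairings a) => //=; case: (embeds _ _ _).
Qed.

Lemma degree_sum_ge : (n.+1 <= degree_sum a)%N.
Proof.
rewrite /degree_sum -[leqLHS](card_ord n.+1) -sum1_card; apply: leq_sum => i _; exact: a_gt0.
Qed.

(** The error of [pairing_tail] with the degree sum replaced by its lower bound n + 1, hence uniform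
    over positive degree sequences. *)
Definition pairing_error (K : R) : R :=
  2 * ((8 * K + 4 * k%:R * K ^+ 3) / Num.sqrt n.+1%:R) * expR (4 * (2 * K ^+ 2)) ^+ (k * k).

(** Since Y Z_j^2 = d_j^2 / L, a violation of the degree bound is a condition on the rescaled sample
    alone. There the cutoff is at least 1 and dominates the difference of two numbers in [0, 1]. *)
Lemma embedding_probability_approx (K : R) (s : {ffun 'I_k -> 'I_n.+1}) :
  injective s -> 1 <= K -> 4 * k%:R * K <= Num.sqrt (n.+1%:R : R) ->
  `|embedding_probability s
    - poisson_hom (val F) (fun j => rescaled_degree R a (s j)) (edge_density R a)|
  <= pairing_error K + cutoff K (fun j => rescaled_degree R a (s j)) (edge_density R a).
Proof.
move=> s_inj K1 Kn; have K0 : 0 <= K by apply: le_trans K1.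
have L0 : (0 < degree_sum a)%N by apply: leq_trans degree_sum_ge.
have L0' : 0 < (degree_sum a)%:R :> R by rewrite ltr0n.
have n0' : 0 < n.+1%:R :> R by rewrite ltr0n.
have sqrt_le : Num.sqrt n.+1%:R <= Num.sqrt (degree_sum a)%:R :> R.
  by rewrite ler_sqrt // ler_nat degree_sum_ge.
have err0 : 0 <= pairing_error K.
  rewrite /pairing_error !mulr_ge0 ?exprn_ge0 ?expR_ge0 ?invr_ge0 ?sqrtr_ge0 //.
  by rewrite addr_ge0 ?mulr_ge0 ?exprn_ge0.
have [small|] := boolP [forall j : 'I_k, ((a (s j))%:R : R) <= K * Num.sqrt (degree_sum a)%:R].
  apply: (@le_trans _ _ (pairing_error K)); last by rewrite lerDl cutoff_ge0.
  apply: le_trans (pairing_tail s_inj (valP F) (ltn0Sn n) L0 K1 _ _ pairing_exists) _.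
  - by move=> j; exact: (forallP small).
  - exact: le_trans Kn sqrt_le.
  apply: ler_wpM2r; first by rewrite exprn_ge0 ?expR_ge0.
  apply: ler_wpM2l => //; apply: ler_wpM2l.
    by rewrite addr_ge0 ?mulr_ge0 ?exprn_ge0.
  by rewrite lef_pV2 ?posrE ?sqrtr_gt0.
rewrite negb_forall => /existsP[j]; rewrite -ltNge => big.
apply: (@le_trans _ _ 1).
  have /andP[p0 p1] := embedding_probability_itv s.
  have /andP[q0 q1] := poisson_hom_itv (val F) (fun j => rescaled_degree R a (s j)) (edge_density R a).
  by rewrite ler_norml; apply/andP; split; lra.
apply: (@le_trans _ _ (cutoff K (fun j => rescaled_degree R a (s j)) (edge_density R a))).
  apply: (@cutoff_ge1 _ _ _ _ _ j).
  rewrite !pos_id ?divr_ge0 ?mulr_ge0 ?exprn_ge0 //.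
  have -> : edge_density R a * rescaled_degree R a (s j) ^+ 2 = (a (s j))%:R ^+ 2 / (degree_sum a)%:R.
    by rewrite /edge_density /rescaled_degree; field; rewrite !gt_eqF.
  rewrite ler_pdivlMr // -(sqr_sqrtr (ltW L0')) -exprMn lerXn2r ?nnegrE ?mulr_ge0 ?sqrtr_ge0 //.
  exact: ltW.
by rewrite lerDr.
Qed.

(** The probability that k independent uniform vertices are not all distinct. *)
Definition collision_error : R :=
  1 - #|injections k n.+1|%:R / #|{ffun 'I_k -> 'I_n.+1}|%:R.

Lemma average_embeddings_approx (K : R) :
  (0 < #|injections k n.+1|)%N ->
  1 <= K -> 4 * k%:R * K <= Num.sqrt (n.+1%:R : R) ->
  `|(\sum_s embedding_probability s) / #|{ffun 'I_k -> 'I_n.+1}|%:R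
    - (\sum_(s in injections k n.+1) poisson_hom (val F) (fun j => rescaled_degree R a (s j)) (edge_density R a))
        / #|injections k n.+1|%:R|
  <= collision_error + pairing_error K
     + (\sum_(s in injections k n.+1) cutoff K (fun j => rescaled_degree R a (s j)) (edge_density R a)) / #|injections k n.+1|%:R.
Proof.
move=> inj0 K1 Kn; apply: average_compare => // s; first exact: embedding_probability_itv.
by rewrite inE => /injectiveP s_inj; exact: embedding_probability_approx.
Qed.

End PairingAverages.

Lemma measurable_forall_fin d (T : measurableType d) (I : finType) (A : I -> set T) :
  (forall i, measurable (A i)) -> measurable [set w | forall i, A i w].
Proof.
move=> mA; rewrite (_ : [set w | _] = \bigcap_(i in [set: I]) A i).
  by apply: fin_bigcap_measurable => //; exact: finite_finset.
by apply/seteqP; split => w /= h i; [move=> _; exact: h|by apply: h].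
Qed.

Lemma measurable_countable_range d (T : measurableType d) (R : realType) (C : countType)
    (c : T -> C) (f : C -> R) :
  (forall b, measurable [set w | c w = b]) -> measurable_fun setT (fun w => f (c w)).
Proof.
move=> mc _ B mB; rewrite setTI.
rewrite (_ : _ @^-1` B = \bigcup_(b in [set b | B (f b)]) [set w | c w = b]).
  rewrite bigcup_mkcond; apply: countable_bigcupT_measurable; first exact: countableP.
  by move=> m; case: ifP.
by apply/seteqP; split => w /=; [move=> h; exists (c w)|case=> b h /= ->].
Qed.

(** * Comparison of expectations for a fixed number of vertices *)

Section FixedNumberOfVertices.
Context (R : realType) d (Omega : measurableType d) (P : probability Omega R).
Variables (n k : nat) (F : multigraph k) (D : Omega -> {ffun 'I_n.+1 -> nat}).
Hypothesis k_le : (k <= n.+1)%N.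
Hypothesis D_meas : forall i, measurable_fun setT (fun w => D w i).
Hypothesis D_gt0 : forall w i, (0 < D w i)%N.
Variables (G : Omega -> multigraph n.+1) (Zk : Omega -> 'rV[R]_k).
Hypothesis G_meas : forall g, measurable [set w | G w = g].
Hypothesis G_CM : cond_pmf P D G (fun a => cm_pmf a R).
Hypothesis Zk_meas : forall j, measurable_fun setT (fun w => Zk w ord0 j).
Hypothesis Zk_sample : cond_pmf P D Zk (fun a => sample_pmf (rescaled_degree R a)).

Lemma measurable_degrees_eq a : measurable [set w | D w = a].
Proof.
rewrite (_ : [set w | _] = [set w | forall i, [set w | D w i = a i] w]).
  apply: measurable_forall_fin => i; rewrite -[X in measurable X]setTI.
  by apply: (D_meas i measurableT (_ : measurable [set a i])).
by apply/seteqP; split => w /= h; [move=> i; rewrite h|apply/ffunP].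
Qed.

Lemma measurable_sample_eq z : measurable [set w | Zk w = z].
Proof.
rewrite (_ : [set w | _] = [set w | forall j, [set w | Zk w ord0 j = z ord0 j] w]).
  apply: measurable_forall_fin => j; rewrite -[X in measurable X]setTI.
  by apply: (Zk_meas j measurableT (measurable_set1 (z ord0 j))).
by apply/seteqP; split => w /= h; [move=> i; rewrite h|apply/rowP].
Qed.

Lemma measurable_edge_density : measurable_fun setT (fun w => edge_density R (D w)).
Proof. exact: (measurable_countable_range (edge_density R) measurable_degrees_eq). Qed.

Lemma injections_gt0 : (0 < #|injections k n.+1|)%N.
Proof. by rewrite /injections card_inj_ffuns !card_ord ffact_gt0. Qed.

Lemma sample_integral (g : ('I_k -> R) -> R -> R) (M : R) a :
  (forall y, measurable_fun setT (fun w => g (fun j => Zk w ord0 j) y)) ->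
  (forall z y, `|g z y| <= M) ->
  \int[P]_(w in [set w | D w = a]) g (fun j => Zk w ord0 j) (edge_density R (D w))
  = fine (P [set w | D w = a]) *
    ((\sum_(s in injections k n.+1) g (fun j => rescaled_degree R a (s j)) (edge_density R a))
       / #|injections k n.+1|%:R).
Proof.
move=> mg gM; set E := [set w | D w = a].
transitivity (\int[P]_(w in E) g (fun j => Zk w ord0 j) (edge_density R a)).
  by apply: eq_Rintegral => w; rewrite inE /= => ->.
rewrite (@finite_law_integral _ _ _ P E _ Zk _ (injections k n.+1)
  (fun s => \row_j rescaled_degree R a (s j))
  (fun z => g (fun j => z ord0 j) (edge_density R a)) M).
- congr (_ * (_ / _)); apply: eq_bigr => s _; congr g.
  by apply/funext => j; rewrite mxE.
- exact: measurable_degrees_eq.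
- exact: measurable_sample_eq.
- exact: injections_gt0.
- move=> z; rewrite Zk_sample /sample_pmf -/(injections k n.+1).
  congr (_ * (_%:R / _)%:E)%E; apply: eq_card => s.
  by rewrite !finset.in_set eq_sym.
- exact: mg.
- by move=> z; exact: gM.
Qed.

(** Without pairings [cm_pmf] is 0 / 0, that is 0, so every event [G w = g] would be null within
    [D w = a]; there are countably many of them, and they cover it. *)
Lemma pairings_gt0 a : (0 < P [set w | D w = a])%E -> (0 < #|pairings a|)%N.
Proof.
move=> Pa; rewrite lt0n; apply/negP => /eqP pa0.
have z g : P ([set w | D w = a] `&` [set w | G w = g]) = 0%E.
  by rewrite G_CM /cm_pmf pa0 invr0 mulr0 mule0.
suff : P [set w | D w = a] = 0%E by move=> e; rewrite e ltxx in Pa.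
pose Fs i := [set w | D w = a] `&` [set w | pickle (G w) = i].
have FsE i : Fs i = if (unpickle i : option (multigraph n.+1)) is Some c then
    (if pickle c == i then [set w | D w = a] `&` [set w | G w = c] else set0) else set0.
  rewrite /Fs; apply/seteqP; split => w /=.
    by move=> [Dw <-]; rewrite pickleK eqxx.
  by case e : (unpickle i) => [c|] //; case: eqP => // <- [? ->].
have -> : [set w | D w = a] = \bigcup_i Fs i.
  by apply/seteqP; split => [w Dw|w [i _ []]] //; exists (pickle (G w)).
apply/(negligibleP _); last first.
  apply: negligible_bigcup => i; rewrite FsE; case: (unpickle i) => [c|]; last exact: negligible_set0.
  case: ifP => _; last exact: negligible_set0.
  apply/(negligibleP _); last exact: z.
  by apply: measurableI => //; exact: measurable_degrees_eq.
apply: bigcup_measurable => i _; rewrite FsE; case: (unpickle i) => // c; case: ifP => // _.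
by apply: measurableI => //; exact: measurable_degrees_eq.
Qed.

Lemma measurable_t_hom_graphon : measurable_fun setT (fun w => t_hom F (graphon_of R (G w))).
Proof. exact: (measurable_countable_range (fun g => t_hom F (graphon_of R g)) G_meas). Qed.

Lemma pairing_integral a : (0 < #|pairings a|)%N ->
  \int[P]_(w in [set w | D w = a]) t_hom F (graphon_of R (G w))
  = fine (P [set w | D w = a]) *
    ((\sum_s embedding_probability R F a s) / #|{ffun 'I_k -> 'I_n.+1}|%:R).
Proof.
move=> pa0; have [m0 m0P] := card_gt0P pa0.
(* The pairing [m0] only supplies the default that makes [v] total; on [pairings a] the value is the
   matrix of the pairing itself. *)
pose v (m : {ffun half_edge a -> half_edge a}) : multigraph n.+1 := insubd (exist _ (pairing_mx m0) (pairing_mx_multigraph m0P)) (pairing_mx m).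
have vE m : m \in pairings a -> val (v m) = pairing_mx m.
  by move=> mP; rewrite insubdK //; exact: pairing_mx_multigraph.
rewrite (@finite_law_integral _ _ _ P _ _ G _ (pairings a) v (fun g => t_hom F (graphon_of R g)) 1) //.
- rewrite -average_embeddings; congr (_ * (_ / _)); apply: eq_bigr => m mP.
  by rewrite t_hom_graphon_of vE.
- exact: measurable_degrees_eq.
- move=> g; rewrite G_CM /cm_pmf; congr (_ * (_%:R / _)%:E)%E; apply: eq_card => m.
  rewrite [LHS]finset.in_set [RHS]finset.in_set; case: (boolP (m \in pairings a)) => //= mP.
  by rewrite -vE // (inj_eq val_inj).
- exact: measurable_t_hom_graphon.
- move=> g; have /andP[h0 h1] := t_hom_itv F (@graphon_of_plane R n g).
  by rewrite ger0_norm.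
Qed.

Lemma expectation_compare (K : R) : 1 <= K -> 4 * k%:R * K <= Num.sqrt (n.+1%:R : R) ->
  `|\int[P]_w t_hom F (graphon_of R (G w))
    - \int[P]_w poisson_hom (val F) (fun j => Zk w ord0 j) (edge_density R (D w))|
  <= collision_error R n k + pairing_error n k K
     + \int[P]_w cutoff K (fun j => Zk w ord0 j) (edge_density R (D w)).
Proof.
move=> K1 Kn; set c := collision_error R n k + pairing_error n k K.
pose T1 w := t_hom F (graphon_of R (G w)).
pose T2 w := poisson_hom (val F) (fun j => Zk w ord0 j) (edge_density R (D w)).
pose T3 w := cutoff K (fun j => Zk w ord0 j) (edge_density R (D w)).
rewrite -/(T1 _) -/(T2 _) -/(T3 _).
have m1 : measurable_fun setT T1 by exact: measurable_t_hom_graphon.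
have m2 : measurable_fun setT T2.
  apply: measurable_poisson_hom => [j|]; apply: measurable_pos; first exact: Zk_meas.
  exact: measurable_edge_density.
have m3 : measurable_fun setT T3.
  by apply: measurable_cutoff => //; exact: measurable_edge_density.
have b1 w : `|T1 w| <= 1.
  by have /andP[h0 h1] := t_hom_itv F (@graphon_of_plane R n (G w)); rewrite ger0_norm.
have b2 w : `|T2 w| <= 1.
  have /andP[h0 h1] := poisson_hom_itv (val F) (fun j => Zk w ord0 j) (edge_density R (D w)).
  by rewrite ger0_norm.
have b3 w : `|T3 w| <= k%:R by rewrite ger0_norm ?cutoff_ge0 ?cutoff_le.
have bi (E : set Omega) (f : Omega -> R) M : measurable E -> measurable_fun setT f ->
    (forall w, `|f w| <= M) -> P.-integrable E (EFin \o f).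
  move=> mE mf fM; apply: (bounded_integrable mE (probability_lty_set P mE) (M := M)) => //.
  exact: measurable_funTS.
(* Integrals over the degree classes add up for one-sided inequalities, so the absolute value is
   treated through the signs [e = 1] and [e = -1]. *)
have side (e : R) : `|e| = 1 -> e * (\int[P]_w T1 w - \int[P]_w T2 w) <= c + \int[P]_w T3 w.
  move=> e1; pose h w := e * (T1 w - T2 w) - (c + T3 w).
  have m12 : measurable_fun setT (fun w => T1 w - T2 w) by exact: measurable_funB.
  have me12 : measurable_fun setT (fun w => e * (T1 w - T2 w)) by exact: measurable_funM.
  have mc3 : measurable_fun setT (fun w => c + T3 w) by exact: measurable_funD.
  have b12 w : `|T1 w - T2 w| <= 2.
    by apply: le_trans (ler_normB _ _) _; rewrite -[2]/(1 + 1) lerD.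
  have be12 w : `|e * (T1 w - T2 w)| <= 2 by rewrite normrM e1 mul1r.
  have bc3 w : `|c + T3 w| <= `|c| + k%:R.
    by apply: le_trans (ler_normD _ _) _; rewrite lerD.
  have splitE E : measurable E ->
      \int[P]_(w in E) h w = e * (\int[P]_(w in E) T1 w - \int[P]_(w in E) T2 w)
        - (c * fine (P E) + \int[P]_(w in E) T3 w).
    move=> mE; rewrite /h RintegralB //; [|exact: bi be12|exact: bi bc3].
    rewrite RintegralZl //; last exact: bi b12.
    rewrite RintegralB //; [|exact: bi b1|exact: bi b2].
    rewrite RintegralD //; [|exact: (bi _ (fun=> c) `|c|)|exact: bi b3].
    by rewrite Rintegral_cst.
  rewrite -subr_le0; have := splitE setT measurableT.
  rewrite [X in fine X]probability_setT /= mulr1 => <-.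
  have mh : measurable_fun setT h by exact: measurable_funB.
  have bh w : `|h w| <= 2 + (`|c| + k%:R).
    by apply: le_trans (ler_normB _ _) _; rewrite lerD.
  apply: (countable_partition_le0 measurable_degrees_eq mh bh) => a.
  have mE := measurable_degrees_eq a; set E := [set w | D w = a] in mE *.
  have PE0 : 0 <= fine (P E) by exact: fine_ge0.
  (* On a null class [pairings_gt0] gives no pairing, but the integral of a bounded function over it
     vanishes. *)
  have [PE|PE] := eqVneq (P E) 0%E.
    have /andP[_] : - (2 + (`|c| + k%:R)) * fine (P E) <= \int[P]_(w in E) h w
        <= (2 + (`|c| + k%:R)) * fine (P E).
      apply: (Rintegral_bounded mE (probability_lty_set P mE)).
        exact: measurable_funTS.
      by move=> w _; rewrite -ler_norml.
    by rewrite PE mulr0.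
  have PE' : (0 < P E)%E by rewrite lt0e PE measure_ge0.
  have pa0 := pairings_gt0 PE'.
  have a0 i : (0 < a i)%N.
    have [w Ew] : E !=set0 by apply/set0P; apply: contra_neq PE => ->; rewrite measure0.
    by rewrite -(Ew : D w = a).
  rewrite splitE // pairing_integral // (sample_integral (g := poisson_hom (val F)) (M := 1)); last 2 first.
  - move=> y; apply: measurable_poisson_hom => [j|]; last exact: measurable_cst.
    by apply: measurable_pos; exact: Zk_meas.
  - by move=> z y; have /andP[h0 h1] := poisson_hom_itv (val F) z y; rewrite ger0_norm.
  rewrite (sample_integral (g := cutoff K) (M := k%:R)); last 2 first.
  - by move=> y; apply: measurable_cutoff.
  - by move=> z y; rewrite ger0_norm ?cutoff_ge0 ?cutoff_le.
  rewrite -mulrBr [c * _]mulrC -mulrDr mulrCA -mulrBr mulr_ge0_le0 // subr_le0.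
  apply: le_trans (average_embeddings_approx F a0 pa0 injections_gt0 K1 Kn).
  by apply: le_trans (ler_norm _) _; rewrite normrM e1 mul1r.
rewrite ler_norml; apply/andP; split.
  by have := side (-1) (normrN1 _); rewrite mulN1r lerNl.
by have := side 1 (normr1 _); rewrite mul1r.
Qed.

End FixedNumberOfVertices.

(** * The limit *)

Lemma expectation_Rintegral (R : realType) d (T : measurableType d) (P : probability T R)
    (X : T -> R) (M : R) : measurable_fun setT X -> (forall w, `|X w| <= M) ->
  'E_P[X]%E = (\int[P]_w X w)%:E.
Proof.
move=> mX XM; rewrite unlock /Rintegral fineK //; apply: integrable_fin_num => //.
exact: (bounded_integrable measurableT (probability_lty P) (M := M)).
Qed.

Lemma cvg_cutoff_pinfty (R : realType) k (z : 'I_k -> R) (y : R) :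
  cutoff m.+1%:R z y @[m --> \oo] --> (0 : R).
Proof.
rewrite [X in _ --> X](_ : (0 : R) = \sum_(j < k) 0); last by rewrite big1.
apply: cvg_sumr => j _; apply: cvg_near_cst.
near=> m; rewrite /unit_cap /pos max_l ?min_r //.
rewrite subr_le0; apply: (@le_trans _ _ m%:R); first by near: m; exact: nbhs_infty_ger.
by rewrite lerBrDr -natrX natr1 ler_nat; nia.
Unshelve. all: by end_near. Qed.

Section VanishingErrors.
Variables (R : realType) (k : nat).

Lemma cvg_collision_error : collision_error R n k @[n --> \oo] --> (0 : R).
Proof.
suff h : (#|injections k n.+1|%:R / #|{ffun 'I_k -> 'I_n.+1}|%:R) @[n --> \oo] --> (1 : R).
  by rewrite -(subrr 1); apply: cvgB => //; exact: cvg_cst.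
rewrite [X in _ --> X](_ : 1 = \prod_(j < k) 1); last by rewrite big1.
have -> : (fun n => #|injections k n.+1|%:R / #|{ffun 'I_k -> 'I_n.+1}|%:R) =
    (fun n => \prod_(j < k) ((n.+1 - j)%:R * n.+1%:R^-1)) :> (nat -> R).
  apply/funext => n; rewrite card_inj_ffuns card_ffun !card_ord ffact_prod natrX natr_prod.
  by rewrite big_split /= prodr_const card_ord exprVn.
apply: cvg_prodr => j _.
have h : (1 - j%:R * harmonic n : R) @[n --> \oo] --> (1 - j%:R * 0 : R).
  by apply: cvgB; [exact: cvg_cst|apply: cvgM; [exact: cvg_cst|exact: cvg_harmonic]].
rewrite mulr0 subr0 in h; apply: cvg_trans h.
apply: near_eq_cvg; near=> n; rewrite natrB; last by apply: leqW; near: n; exact: nbhs_infty_ge.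
by rewrite mulrBl divff // pnatr_eq0.
Unshelve. all: by end_near. Qed.

Lemma cvg_pairing_error (K : R) : pairing_error n k K @[n --> \oo] --> (0 : R).
Proof.
rewrite -(mul0r (expR (4 * (2 * K ^+ 2)) ^+ (k * k))).
apply: cvgM; last exact: cvg_cst.
rewrite -(mulr0 2); apply: cvgM; first exact: cvg_cst.
rewrite -(mulr0 (8 * K + 4 * k%:R * K ^+ 3)); apply: cvgM; first exact: cvg_cst.
have -> : (fun n => (Num.sqrt n.+1%:R)^-1) = (fun n => Num.sqrt (harmonic n)) :> (nat -> R).
  by apply/funext => n; rewrite sqrtrV.
rewrite -[X in _ --> X](sqrtr0 R); apply: continuous_cvg; first exact: sqrt_continuous.
exact: cvg_harmonic.
Qed.

Lemma near_sqrt_ge (C : R) : \forall n \near \oo, C <= Num.sqrt (n.+1%:R : R).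
Proof.
near=> n; apply: le_trans (ler_norm C) _; rewrite -sqrtr_sqr ler_sqrt //.
apply: (@le_trans _ _ n%:R); first by near: n; exact: nbhs_infty_ger.
by rewrite ler_nat.
Unshelve. all: by end_near. Qed.

End VanishingErrors.

(* The limit kernel is a multigraphon only almost surely, so that its composition with
   a test function need not be measurable. *)
Section NonmeasurableIntegrand.
Local Open Scope ereal_scope.
Context d (T : measurableType d) (R : realType) (mu : {measure set T -> \bar R}).

(** The integral of a nonnegative function is a supremum over the simple functions below it, which
    is monotone without any measurability. *)
Lemma le_integral_nonmeasurable (f g : T -> \bar R) :
  (forall x, 0 <= f x) -> (forall x, f x <= g x) -> \int[mu]_x f x <= \int[mu]_x g x.
Proof.
move=> f0 fg; rewrite !ge0_integralTE //; last by move=> x; exact: le_trans (fg x).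
apply/ge_ereal_sup => _ /= [h hf <-]; apply: ereal_sup_ubound.
by exists h => // x; exact: le_trans (fg x).
Qed.

(** Squeezes both functions between two measurable ones that equal [g] outside [N] and take the
    values 0 and +oo on it; these have the same integral because [N] is null. *)
Lemma ge0_ae_eq_integral_nonmeasurable (f g : T -> \bar R) (N : set T) :
  measurable N -> mu N = 0 -> measurable_fun setT g ->
  (forall x, 0 <= f x) -> (forall x, 0 <= g x) -> (forall x, ~ N x -> f x = g x) ->
  \int[mu]_x f x = \int[mu]_x g x.
Proof.
move=> mN N0 mg f0 g0 fg.
pose lo := g \_ (~` N); pose up x := maxe (g x) ((cst +oo \_ N) x).
have mlo : measurable_fun setT lo.
  by apply/(measurable_restrictT _ (measurableC mN)); exact: measurable_funTS.
have mup : measurable_fun setT up.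
  by apply: measurable_maxe => //; apply/(measurable_restrictT _ mN); exact: measurable_cst.
have loN x : N x -> lo x = 0 by move=> Nx; rewrite /lo patchN // notin_setE => /(_ Nx).
have lonN x : ~ N x -> lo x = g x by move=> Nx; rewrite /lo patchT // inE.
have upN x : N x -> up x = +oo by move=> Nx; rewrite /up patchT ?inE // maxey.
have upnN x : ~ N x -> up x = g x.
  by move=> Nx; rewrite /up patchN ?notin_setE //; apply/max_idPl; exact: g0.
have lo0 x : 0 <= lo x.
  by have [Nx|Nx] := pselect (N x); [rewrite loN|rewrite lonN].
have up0 x : 0 <= up x.
  by have [Nx|Nx] := pselect (N x); [rewrite upN|rewrite upnN].
have between h : (forall x, 0 <= h x) -> (forall x, ~ N x -> h x = g x) ->
    \int[mu]_x h x = \int[mu]_x lo x.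
  move=> h0 hg; apply/eqP; rewrite eq_le; apply/andP; split.
    rewrite (_ : \int[mu]_x lo x = \int[mu]_x up x).
      apply: le_integral_nonmeasurable => // x.
      by have [Nx|Nx] := pselect (N x); [rewrite upN // leey|rewrite upnN // hg].
    apply: ge0_ae_eq_integral => //; exists N; split => // x /= nx.
    by apply: contrapT => Nx; apply: nx => _; rewrite lonN ?upnN.
  apply: le_integral_nonmeasurable => // x.
  by have [Nx|Nx] := pselect (N x); [rewrite loN|rewrite lonN // hg].
by rewrite (between f) // (between g).
Qed.

Lemma ae_eq_integral_nonmeasurable (f g : T -> \bar R) :
  measurable_fun setT g -> {ae mu, forall x, f x = g x} ->
  \int[mu]_x f x = \int[mu]_x g x.
Proof.
move=> mg [N [mN N0 fgN]].
have fg x : ~ N x -> f x = g x.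
  by move=> Nx; apply: contrapT => fgx; apply: Nx; exact: fgN.
rewrite integralE [RHS]integralE; congr (_ - _).
  apply: (ge0_ae_eq_integral_nonmeasurable mN N0) => //; first exact: measurable_funepos.
  by move=> x Nx; rewrite !funeposE fg.
apply: (ge0_ae_eq_integral_nonmeasurable mN N0) => //; first exact: measurable_funeneg.
by move=> x Nx; rewrite !funenegE fg.
Qed.

End NonmeasurableIntegrand.

(** * Nonnegativity in the limit *)

Section NonnegativeLimit.
Variable R : realType.

Lemma Rintegral_ge0_eq0_ae d (T : measurableType d) (P : probability T R) (f : T -> R) (M : R) :
  measurable_fun setT f -> (forall w, 0 <= f w <= M) -> \int[P]_w f w = 0 ->
  {ae P, forall w, f w = 0}.
Proof.
move=> mf fM f0.
have fi : P.-integrable setT (EFin \o f).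
  apply: (bounded_integrable measurableT (probability_lty P) (M := M)) => // w _.
  by have /andP[h0 h1] := fM w; rewrite ger0_norm.
have mf' : measurable_fun setT (EFin \o f) by apply/measurable_EFinP.
have [+ _] := ae_eq_integral_abs P measurableT mf'.
have fin := integrable_fin_num measurableT fi.
have -> : (\int[P]_w `|(EFin \o f) w| = \int[P]_w (f w)%:E)%E.
  by apply: eq_integral => w _ /=; rewrite ger0_norm //; case/andP: (fM w).
have -> : (\int[P]_w (f w)%:E = 0)%E by rewrite -(fineK fin) [fine _]f0.
move=> /(_ erefl) [N [mN N0 h]]; exists N; split => // w nw; apply: h => /= h.
by apply: nw; have [] := h I.
Qed.

Lemma unit_cap_eq0 (u : R) : (unit_cap (- u) == 0) = (0 <= u).
Proof.
rewrite /unit_cap /pos; have [u0|u0] := leP 0 u.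
  by rewrite max_l ?oppr_le0 // min_r ?eqxx.
have u0' : 0 < - u by rewrite oppr_gt0.
by rewrite (max_r (ltW u0')); apply/negbTE; rewrite gt_eqF // lt_min ltr01.
Qed.

(** Monotonicity spreads the zeros at the points -1 / (m + 1) to all negative arguments. A countable
    family of points is used so that the corresponding null sets can be united; for x <= 0 the
    infimum is the default 0. *)
Lemma quantile_ge0 (Psi : cumulativeBounded (0 : R) (1 : R)) (x : R) :
  (forall m, Psi (- m.+1%:R^-1) = 0) -> 0 <= quantile Psi x.
Proof.
move=> Psi0; rewrite /quantile; set S := [set y | x <= Psi y].
have [x0|x0] := leP x 0.
  rewrite inf_out // => -[_ [b bS]].
  have : b <= b - 1 by apply: bS; apply: le_trans x0 _; case/andP: (cumulativeBounded_itv Psi (b - 1)).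
  by lra.
have [->|/set0P S0] := eqVneq S set0; first by rewrite inf0.
apply: lb_le_inf => // y Sy; rewrite leNgt; apply/negP => y0.
have [m ym] : exists m, y <= - m.+1%:R^-1.
  have y0' : 0 < - y by rewrite oppr_gt0.
  exists (Num.bound (- y)^-1); rewrite lerNr -[leRHS]invrK lef_pV2 ?posrE ?invr_gt0 ?ltr0n //.
  by apply: le_trans (ltW (archi_boundP (ltW (_ : 0 < (- y)^-1)))) _; rewrite ?invr_gt0 ?ler_nat.
have h : x <= Psi (- m.+1%:R^-1) := le_trans Sy (cumulative_is_nondecreasing Psi _ _ ym).
by rewrite Psi0 leNgt x0 in h.
Qed.

Lemma cm_limit_poisson_kernel (y : R) (Psi : R -> R) :
  0 <= y -> (forall x, 0 <= quantile Psi x) ->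
  cm_limit y Psi = poisson_kernel y (quantile Psi).
Proof.
move=> y0 q0; apply/funext => r; apply/funext => a; apply/funext => b.
by rewrite /cm_limit /poisson_kernel !pos_id //; case: (a == b).
Qed.

End NonnegativeLimit.

(** * Passage to the limit along the samples *)

Section SampleLimits.
Variables (R : realType)
    (d : measure_display) (Omega : measurableType d) (P : probability Omega R)
    (D : forall n, Omega -> {ffun 'I_n.+1 -> nat})
    (D_meas : forall n i, measurable_fun [set: Omega] (fun w => D n w i))
    (D_gt0 : forall n w i, (0 < D n w i)%N)
    (G : forall n, Omega -> multigraph n.+1)
    (G_meas : forall n g, measurable [set w | G n w = g])
    (G_CM : forall n, cond_pmf P (@D n) (@G n) (fun a => cm_pmf a R))
    (Zn : forall n k, Omega -> 'rV[R]_k)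
    (Zn_meas : forall n k j, measurable_fun [set: Omega] (fun w => @Zn n k w ord0 j))
    (Zn_sample : forall n k, (0 < k <= n.+1)%N ->
       cond_pmf P (@D n) (@Zn n k) (fun a => sample_pmf (rescaled_degree R a)))
    (d' : measure_display) (Omega' : measurableType d') (P' : probability Omega' R)
    (Y : Omega' -> R) (Y_meas : measurable_fun [set: Omega'] Y)
    (Psi : R -> cumulativeBounded (0 : R) (1 : R))
    (Z : forall k, Omega' -> 'rV[R]_k)
    (Z_meas : forall k j, measurable_fun [set: Omega'] (fun w => @Z k w ord0 j))
    (Z_indep : forall k, (0 < k)%N ->
       cond_independent P' Y (fun j w => @Z k w ord0 j))
    (Z_cdf : forall k j, (0 < k)%N ->
       cond_cdf P' Y (fun w => @Z k w ord0 j) (fun y => Psi y))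
    (ZY_cvg : forall k, (0 < k)%N ->
       weak_cvg P P' (fun n w => (@Zn n k w, edge_density R (D n w)))
                     (fun w => (@Z k w, Y w))).

Lemma sample_test_cvg k (g : ('I_k -> R) -> R -> R) (M : R) : (0 < k)%N ->
  continuous (fun p : 'rV[R]_k * R => g (fun j => p.1 ord0 j) p.2) ->
  (forall z y, `|g z y| <= M) ->
  (forall dT (T : measurableType dT) (z : T -> 'I_k -> R) (y : T -> R),
     (forall j, measurable_fun setT (fun t => z t j)) -> measurable_fun setT y ->
     measurable_fun setT (fun t => g (z t) (y t))) ->
  \int[P]_w g (fun j => Zn n k w ord0 j) (edge_density R (D n w)) @[n --> \oo]
  --> \int[P']_w g (fun j => Z k w ord0 j) (Y w).
Proof.
move=> k0 gc gM mg.
have gM' (p : 'rV[R]_k * R) : `|g (fun j => p.1 ord0 j) p.2| <= M by exact: gM.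
have := ZY_cvg k0 gc (ex_intro _ M gM').
have m1 n : measurable_fun setT (fun w => g (fun j => Zn n k w ord0 j) (edge_density R (D n w))).
  by apply: mg => //; apply: measurable_edge_density; exact: D_meas.
have m2 : measurable_fun setT (fun w => g (fun j => Z k w ord0 j) (Y w)) by exact: mg.
rewrite (expectation_Rintegral P' m2 (fun w => gM _ _)).
have -> : (fun n => 'E_P[fun w => g (fun j => Zn n k w ord0 j) (edge_density R (D n w))])%E =
  (fun n => (\int[P]_w g (fun j => Zn n k w ord0 j) (edge_density R (D n w)))%:E).
  by apply/funext => n; rewrite (expectation_Rintegral P (m1 n) (fun w => gM _ _)).
exact: fine_cvg.
Qed.

Lemma cvg_pos_coord k (p : 'rV[R]_k * R) (j : 'I_k) :
  (fun q : 'rV[R]_k * R => pos (q.1 ord0 j)) @ p --> pos (p.1 ord0 j).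
Proof.
apply: continuous_cvg; first exact: continuous_pos.
apply: (cvg_comp (fun q : 'rV[R]_k * R => q.1) (fun M : 'rV[R]_k => M ord0 j)).
  exact: cvg_fst.
exact: (@coord_continuous R 1 k ord0 j p.1).
Qed.

Lemma cvg_pos_snd k (p : 'rV[R]_k * R) :
  (fun q : 'rV[R]_k * R => pos q.2) @ p --> pos p.2.
Proof. by apply: continuous_cvg; [exact: continuous_pos|exact: cvg_snd]. Qed.

Lemma sample_poisson_cvg k (F : 'M[nat]_k) : (0 < k)%N ->
  \int[P]_w poisson_hom F (fun j => Zn n k w ord0 j) (edge_density R (D n w)) @[n --> \oo]
  --> \int[P']_w poisson_hom F (fun j => Z k w ord0 j) (Y w).
Proof.
move=> k0; apply: (@sample_test_cvg k (poisson_hom F) 1) => // [p|z y|dT T z y mz my].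
- by apply: cvg_poisson_hom; [move=> j; exact: cvg_pos_coord|exact: cvg_pos_snd].
- by have /andP[h0 h1] := poisson_hom_itv F z y; rewrite ger0_norm.
- by apply: measurable_poisson_hom => [j|]; apply: measurable_pos.
Qed.

Lemma sample_cutoff_cvg k (K : R) : (0 < k)%N ->
  \int[P]_w cutoff K (fun j => Zn n k w ord0 j) (edge_density R (D n w)) @[n --> \oo]
  --> \int[P']_w cutoff K (fun j => Z k w ord0 j) (Y w).
Proof.
move=> k0; apply: (@sample_test_cvg k (cutoff K) k%:R) => // [p|z y|dT T z y mz my].
- by apply: cvg_cutoff; [move=> j; exact: cvg_pos_coord|exact: cvg_pos_snd].
- by rewrite ger0_norm ?cutoff_ge0 ?cutoff_le.
- exact: measurable_cutoff.
Qed.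

Lemma limit_cutoff_cvg k :
  \int[P']_w cutoff m.+1%:R (fun j => Z k w ord0 j) (Y w) @[m --> \oo] --> (0 : R).
Proof.
have -> : (0 : R) = \int[P']_w (fun=> 0) w by rewrite Rintegral_cst // mul0r.
apply: (@Rintegral_bounded_cvg _ _ R P' setT measurableT (probability_lty P')
  (fun m w => cutoff m.+1%:R (fun j => Z k w ord0 j) (Y w)) (fun=> 0) k%:R) => //.
- by move=> m; exact: measurable_cutoff.
- by move=> m w _; rewrite ger0_norm ?cutoff_ge0 ?cutoff_le.
- by move=> w _; exact: cvg_cutoff_pinfty.
Qed.

(** The five shares [e / 5] go to the collisions, the switching error, the cutoff of the limit, the
    convergence of the cutoff and the convergence of the Poisson integrand. *)
Lemma t_hom_cvg_poisson k (F : multigraph k) : (0 < k)%N ->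
  \int[P]_w t_hom F (graphon_of R (G n w)) @[n --> \oo]
  --> \int[P']_w poisson_hom (val F) (fun j => Z k w ord0 j) (Y w).
Proof.
move=> k0; apply/cvgrPdist_le => e e0; have e5 : 0 < e / 5 by rewrite divr_gt0.
(* The level [K] comes from the limit variables alone, before [n], so the switching error is taken
   at a fixed [K]. *)
have [m mP] : exists m, \int[P']_w cutoff m.+1%:R (fun j => Z k w ord0 j) (Y w) <= e / 5.
  have /cvgrPdist_le/(_ _ e5)[m _ /(_ _ (leqnn m))] := @limit_cutoff_cvg k.
  by rewrite sub0r normrN => h; exists m; apply: le_trans (ler_norm _) h.
set K : R := m.+1%:R in mP.
near=> n.
have kn : (0 < k <= n.+1)%N.
  by rewrite k0; apply: leqW; near: n; exact: nbhs_infty_ge.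
have K1 : 1 <= K by rewrite /K ler1n.
have sq : 4 * k%:R * K <= Num.sqrt (n.+1%:R : R) by near: n; exact: near_sqrt_ge.
have kn' := andP kn; have := expectation_compare F kn'.2 (@D_meas n) (@D_gt0 n) (@G_meas n) (@G_CM n)
  (@Zn_meas n k) (Zn_sample kn) K1 sq.
have c1 : `|0 - collision_error R n k| <= e / 5.
  by near: n; have /cvgrPdist_le/(_ _ e5) := @cvg_collision_error R k; exact.
have c2 : `|0 - pairing_error n k K| <= e / 5.
  by near: n; have /cvgrPdist_le/(_ _ e5) := @cvg_pairing_error R k K; exact.
have c3 : `|\int[P']_w cutoff K (fun j => Z k w ord0 j) (Y w)
   - \int[P]_w cutoff K (fun j => Zn n k w ord0 j) (edge_density R (D n w))| <= e / 5.
  by near: n; have /cvgrPdist_le/(_ _ e5) := @sample_cutoff_cvg k K k0; exact.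
have c4 : `|\int[P']_w poisson_hom (val F) (fun j => Z k w ord0 j) (Y w)
   - \int[P]_w poisson_hom (val F) (fun j => Zn n k w ord0 j) (edge_density R (D n w))| <= e / 5.
  by near: n; have /cvgrPdist_le/(_ _ e5) := @sample_poisson_cvg k (val F) k0; exact.
move: c1 c2 c3 c4 mP; rewrite !sub0r !normrN.
set t1 := \int[P]_w t_hom _ _; set t2 := Rintegral P setT (fun w => poisson_hom _ _ (edge_density _ _)).
set t3 := Rintegral P setT _; set l2 := Rintegral P' setT _; set l3 := Rintegral P' setT _.
set e1 := collision_error _ _ _; set e2 := pairing_error _ _ _; clear.
rewrite !ler_norml => /andP[? ?] /andP[? ?] /andP[? ?] /andP[? ?] ? /andP[? ?].
by apply/andP; split; lra.
Unshelve. all: by end_near. Qed.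

Lemma sample_test_eq0 k (g : ('I_k -> R) -> R -> R) (M : R) : (0 < k)%N ->
  continuous (fun p : 'rV[R]_k * R => g (fun j => p.1 ord0 j) p.2) ->
  (forall z y, `|g z y| <= M) ->
  (forall dT (T : measurableType dT) (z : T -> 'I_k -> R) (y : T -> R),
     (forall j, measurable_fun setT (fun t => z t j)) -> measurable_fun setT y ->
     measurable_fun setT (fun t => g (z t) (y t))) ->
  (forall n, \int[P]_w g (fun j => Zn n k w ord0 j) (edge_density R (D n w)) = 0) ->
  \int[P']_w g (fun j => Z k w ord0 j) (Y w) = 0.
Proof.
move=> k0 gc gM mg g0; have := sample_test_cvg k0 gc gM mg.
rewrite [X in X @ _ --> _](_ : _ = (fun=> 0)); last by apply/funext => n; exact: g0.
by move=> /(cvg_lim (@Rhausdorff R)) <-; rewrite lim_cst.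
Qed.

Lemma measurable_unit_cap : measurable_fun setT (@unit_cap R).
Proof. by apply: continuous_measurable_fun; exact: continuous_unit_cap. Qed.

(** The bounded continuous function [unit_cap (- y)] vanishes exactly for y >= 0. Its expectation is
    zero for every n, hence in the limit, and a nonnegative function of zero integral vanishes
    almost surely. *)
Lemma Y_ge0_ae : {ae P', forall w, 0 <= Y w}.
Proof.
have mcap := measurable_unit_cap.
have h : \int[P']_w unit_cap (- Y w) = 0.
  apply: (@sample_test_eq0 1 (fun _ y => unit_cap (- y)) 1) => //.
  - move=> p; apply: continuous_cvg; first exact: continuous_unit_cap.
    by apply: cvgN; exact: cvg_snd.
  - by move=> _ y; have /andP[h0 h1] := unit_cap_itv (- y); rewrite ger0_norm.
  - by move=> dT T z y _ my; apply: (measurableT_comp mcap); exact: measurable_funN.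
  move=> n; transitivity (\int[P]_w (0 : R)); last by rewrite Rintegral_cst ?mul0r.
  apply: eq_Rintegral => w _.
  by apply/eqP; rewrite unit_cap_eq0 /edge_density divr_ge0 ?exprn_ge0.
have mf : measurable_fun setT (fun w => unit_cap (- Y w)).
  by apply: (measurableT_comp mcap); exact: measurable_funN.
have [N [mN N0 hN]] := Rintegral_ge0_eq0_ae mf (fun w => unit_cap_itv _) h.
exists N; split => // w nw; apply: hN => /= /eqP; rewrite unit_cap_eq0; exact: nw.
Qed.

Lemma Z_ge0_ae : {ae P', forall w, 0 <= Z 1 w ord0 ord0}.
Proof.
have mcap := measurable_unit_cap.
pose g (z : 'I_1 -> R) (y : R) := unit_cap (- z ord0).
have gM z y : `|g z y| <= 1.
  by have /andP[h0 h1] := unit_cap_itv (- z ord0); rewrite ger0_norm.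
have mg dT (T : measurableType dT) (z : T -> 'I_1 -> R) (y : T -> R) :
    (forall j, measurable_fun setT (fun t => z t j)) -> measurable_fun setT y ->
    measurable_fun setT (fun t => g (z t) (y t)).
  by move=> mz _; apply: (measurableT_comp mcap); exact: measurable_funN.
have h : \int[P']_w g (fun j => Z 1 w ord0 j) (Y w) = 0.
  apply: (@sample_test_eq0 1 g 1) => //.
    move=> p; apply: continuous_cvg; first exact: continuous_unit_cap.
    apply: cvgN; apply: (cvg_comp (fun q : 'rV[R]_1 * R => q.1) (fun M : 'rV[R]_1 => M ord0 ord0)).
      exact: cvg_fst.
    exact: (@coord_continuous R 1 1 ord0 ord0 p.1).
  move=> n; apply/eqP; rewrite eq_le; apply/andP; split; last first.
    by apply: Rintegral_ge0 => // w _; exact: unit_cap_ge0.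
  have mgn : measurable_fun setT (fun w => g (fun j => Zn n 1 w ord0 j) (edge_density R (D n w))).
    by apply: mg => //; apply: measurable_edge_density; exact: D_meas.
  have gMn w : `|g (fun j => Zn n 1 w ord0 j) (edge_density R (D n w))| <= 1 by exact: gM.
  have mD := measurable_degrees_eq (@D_meas n).
  apply: (countable_partition_le0 mD mgn gMn) => a.
  rewrite (@sample_integral _ _ _ P n 1 (D n) isT (@D_meas n) (Zn n 1) (@Zn_meas n 1)
    (Zn_sample (isT : (0 < 1 <= n.+1)%N)) g 1 a) //.
  rewrite big1 ?mul0r ?mulr0 ?lexx // => s _; apply/eqP; rewrite /g unit_cap_eq0.
  by rewrite /rescaled_degree divr_ge0 ?mulr_ge0.
have mf : measurable_fun setT (fun w => unit_cap (- Z 1 w ord0 ord0)).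
  by apply: (measurableT_comp mcap); exact: measurable_funN.
have [N [mN N0 hN]] := Rintegral_ge0_eq0_ae mf (fun w => unit_cap_itv _) h.
exists N; split => // w nw; apply: hN => /= /eqP; rewrite unit_cap_eq0; exact: nw.
Qed.

(** Conditioning on the whole space shows that the expectation of [Psi (Y w) t] is the probability
    of a sample value at most t, which is zero for t < 0. *)
Lemma Psi_neg_ae : {ae P', forall w m, Psi (Y w) (- m.+1%:R^-1) = 0}.
Proof.
apply: (@ae_foralln _ _ _ P' (fun m w => Psi (Y w) (- m.+1%:R^-1) = 0)) => m.
set t : R := - m.+1%:R^-1.
have t0 : t < 0 by rewrite oppr_lt0 invr_gt0 ltr0n.
have [mPsi cond] := @Z_cdf 1 ord0 isT t.
have mPsiY : measurable_fun setT (fun w => Psi (Y w) t) by exact: (measurableT_comp mPsi).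
apply: (Rintegral_ge0_eq0_ae mPsiY (M := 1)) => [w|]; first exact: cumulativeBounded_itv.
have := cond setT measurableT; rewrite preimage_setT setIT /Rintegral => <-.
have [N [mN N0 hN]] := Z_ge0_ae.
rewrite (_ : P' _ = 0%E) //; apply: (subset_measure0 _ mN _ N0).
  have := @Z_meas 1 ord0 measurableT _ (measurable_itv `]-oo, t]).
  rewrite setTI; congr measurable; apply/seteqP; split => w; by rewrite /= in_itv.
by move=> w /= Zt; apply: hN => /= Z0; have := le_lt_trans (le_trans Z0 Zt) t0; rewrite ltxx.
Qed.

Lemma cm_limit_ae : {ae P', forall w,
  cm_limit (Y w) (Psi (Y w)) = poisson_kernel (Y w) (quantile (Psi (Y w)))}.
Proof.
have [N [mN N0 hN]] := Y_ge0_ae; have [N' [mN' N'0 hN']] := Psi_neg_ae.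
exists (N `|` N'); split => [||w /= nw]; [exact: measurableU| |].
  by apply/eqP; rewrite eq_le measure_ge0 andbT;
    apply: le_trans (measureU2 _ mN mN') _; rewrite [X in X + _]N0 [X in _ + X]N'0 adde0.
have [Y0|nY0] := pselect (0 <= Y w); last by left; exact: hN.
right; apply: hN' => /= Psi0; apply: nw; apply: cm_limit_poisson_kernel => // x.
exact: quantile_ge0.
Qed.

Lemma t_hom_poisson_kernel_expectation k (F : multigraph k) : (0 < k)%N ->
  let X' w := poisson_kernel (Y w) (quantile (Psi (Y w))) in
  measurable_fun setT (fun w => t_hom F (X' w)) /\
  \int[P']_w poisson_hom (val F) (fun j => Z k w ord0 j) (Y w) = \int[P']_w t_hom F (X' w).
Proof.
case: k F => // k F _ X'.
have e : (fun w => t_hom F (X' w)) = (fun w => rcube (fun v : k.+1.-tuple R =>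
    poisson_hom (val F) (fun j => quantile (Psi (Y w)) (tnth v j)) (Y w))).
  apply/funext => w; rewrite t_hom_poisson_kernel //; apply: measurable_pos.
  exact: measurable_quantile.
rewrite e; split.
  exact: (measurable_limit_density Y_meas (fun j => @Z_cdf k.+1 j isT) (val F)).
exact: (poisson_hom_expectation Y_meas (@Z_meas k.+1) (@Z_indep k.+1 isT)
  (fun j => @Z_cdf k.+1 j isT) (val F)).
Qed.

Lemma ms_weak_cvg_poisson (F : nat -> any_multigraph) : bijective F ->
  ms_weak_cvg F P P' (fun n w => graphon_of R (G n w))
                     (fun w => cm_limit (Y w) (Psi (Y w))).
Proof.
move=> F_enum; pose X' w := poisson_kernel (Y w) (quantile (Psi (Y w))).
pose X n w := graphon_of R (G n w).
have X'_plane w : plane_kernel (X' w).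
  by apply: poisson_kernel_plane; apply: measurable_pos; exact: measurable_quantile.
have X_plane n w : plane_kernel (X n w) by exact: graphon_of_plane.
have X_meas M n : measurable_fun setT (fun w => t_of M (X n w)).
  exact: (measurable_countable_range (fun g => t_of M (graphon_of R g)) (@G_meas n)).
have X'_meas M : measurable_fun setT (fun w => t_of M (X' w)).
  by case: (t_hom_poisson_kernel_expectation (projT2 M) isT).
have t_cvg M : \int[P]_w t_of M (X n w) @[n --> \oo] --> \int[P']_w t_of M (X' w).
  have [_ <-] := t_hom_poisson_kernel_expectation (projT2 M) isT.
  exact: t_hom_cvg_poisson.
split.
- by move=> n; apply: aeW => w; apply: plane_kernel_multigraphon; exact: X_plane.
- apply: filterS cm_limit_ae => w /= ->; apply: plane_kernel_multigraphon; exact: X'_plane.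
move=> f ft; have [_ [B fB] _] := ft.
have fX n w : `|f (X n w)| <= B by apply: fB; apply: plane_kernel_multigraphon.
have fX' w : `|f (X' w)| <= B by apply: fB; apply: plane_kernel_multigraphon.
have mX n : measurable_fun setT (fun w => f (X n w)).
  exact: (measurable_countable_range (fun g => f (graphon_of R g)) (@G_meas n)).
have mX' : measurable_fun setT (fun w => f (X' w)).
  (* Any plane kernel will do: it makes [reg_set] nonempty. *)
  have h0 : plane_kernel (poisson_kernel (0 : R) (fun=> 0)).
    by apply: poisson_kernel_plane; apply: measurable_pos.
  apply: (test_measurable F_enum ft _ h0 X'_plane X'_meas (B := B)) => h ph.
  by apply: fB; exact: plane_kernel_multigraphon.
(* The integrand on the left is only known to agree almost surely with a measurable one, so the
   integrals are identified without measurability. *)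
have -> : 'E_P'[fun w => f (cm_limit (Y w) (Psi (Y w)))]%E = (\int[P']_w f (X' w))%:E.
  rewrite -(expectation_Rintegral P' mX' fX') unlock.
  apply: ae_eq_integral_nonmeasurable; first exact/measurable_EFinP.
  by apply: filterS cm_limit_ae => w ->.
have -> : (fun n => 'E_P[fun w => f (graphon_of R (G n w))])%E =
    (fun n => (\int[P]_w f (X n w))%:E).
  by apply/funext => n; rewrite (expectation_Rintegral P (mX n) (fX n)).
apply: cvg_EFin; first exact: nearW.
exact: (ms_test_cvg X_plane X'_plane X_meas X'_meas t_cvg F_enum ft).
Qed.

End SampleLimits.

(* The objects with index n live on n.+1 vertices. *)
Theorem theorem3p1 (R : realType)
    (F : nat -> any_multigraph) (F_enum : bijective F)
    (d : measure_display) (Omega : measurableType d) (P : probability Omega R)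
    (D : forall n, Omega -> {ffun 'I_n.+1 -> nat})
    (D_meas : forall n i, measurable_fun [set: Omega] (fun w => D n w i))
    (D_gt0 : forall n w i, (0 < D n w i)%N)
    (D_even : forall n w, ~~ odd (degree_sum (D n w)))
    (G : forall n, Omega -> multigraph n.+1)
    (G_meas : forall n g, measurable [set w | G n w = g])
    (G_CM : forall n, cond_pmf P (D n) (G n) (fun a => cm_pmf a R))
    (Zn : forall n k, Omega -> 'rV[R]_k)
    (Zn_meas : forall n k j, measurable_fun [set: Omega] (fun w => Zn n k w ord0 j))
    (Zn_sample : forall n k, (0 < k <= n.+1)%N ->
       cond_pmf P (D n) (Zn n k) (fun a => sample_pmf (rescaled_degree R a)))
    (d' : measure_display) (Omega' : measurableType d') (P' : probability Omega' R)
    (Y : Omega' -> R) (Y_meas : measurable_fun [set: Omega'] Y)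
    (Psi : R -> cumulativeBounded (0 : R) (1 : R))
    (Z : forall k, Omega' -> 'rV[R]_k)
    (Z_meas : forall k j, measurable_fun [set: Omega'] (fun w => Z k w ord0 j))
    (Z_indep : forall k, (0 < k)%N ->
       cond_independent P' Y (fun j w => Z k w ord0 j))
    (Z_cdf : forall k j, (0 < k)%N ->
       cond_cdf P' Y (fun w => Z k w ord0 j) (fun y => Psi y))
    (ZY_cvg : forall k, (0 < k)%N ->
       weak_cvg P P' (fun n w => (Zn n k w, edge_density R (D n w)))
                     (fun w => (Z k w, Y w)))
    (D_as : {ae P, forall w,
       (forall n, (n.+1 <= degree_sum (D n w))%N) /\
       (\max_(i < n.+1) D n w i)%:R
         / (Num.sqrt (degree_sum (D n w))%:R * ln (n.+1%:R : R) ^+ 2)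
         @[n --> \oo] --> (0 : R)}) :
  ms_weak_cvg F P P' (fun n w => graphon_of R (G n w))
                     (fun w => cm_limit (Y w) (Psi (Y w))).
Proof.
exact: (@ms_weak_cvg_poisson R d Omega P D D_meas D_gt0 G G_meas G_CM Zn Zn_meas Zn_sample
  d' Omega' P' Y Y_meas Psi Z Z_meas Z_indep Z_cdf ZY_cvg F F_enum).
Qed.
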